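(* Let $\mathbb F$ be a field of characteristic $0$ and let $\mathcal V=\mathbb F[x_i^{(j)}\mid 1\le i\le N,\ j\ge0]$, with derivation $\partial x_i^{(j)}=x_i^{(j+1)}$, be a finitely-generated algebra of differential polynomials. Then the symmetric $s$-sesquilinear Harrison cohomology of $\mathcal V$ with coefficients in $\mathcal V$ satisfies $$H^n(C^s_{\mathrm{sym},\mathrm{Har}}(\mathcal V,\mathcal V),d)=0\quad\text{for}\quad 1\le s<n.$$
   Context: All vector spaces, tensor products and Homs are over a field $\mathbb F$ of characteristic $0$. $\langle\Phi\rangle$ denotes the image of an endomorphism $\Phi$; $\overset{i}{\curlyvee}$ denotes an omitted entry. **Symmetric $s$-sesquilinear Harrison complex ($s\ge1$).** Let $A$ be a commutative associative differential algebra with derivation $\partial$ and $M$ a symmetric differential $A$-bimodule ($am=ma$, $\partial(am)=(\partial a)m+a\,\partial m$). (In the claim $A=M=\mathcal V$.) For $\underline k=(k_1,\dots,k_s)\in\mathbb Z_{\ge0}^s$ put $K_0=0$, $K_t=k_1+\dots+k_t$, $n=K_s$, and for $v=v_1\otimes\dots\otimes v_n\in A^{\otimes n}$ put $v^t_{\underline k}=v_{K_{t-1}+1}\otimes\dots\otimes v_{K_t}\in A^{\otimes k_t}$, so that $v=v^1_{\underline k}\otimes\dots\otimes v^s_{\underline k}$ ($v^t_{\underline k}=1\in\mathbb F$ if $k_t=0$). $C^{\underline k}_{\mathrm{Hoc}}$ is the space of linear maps $F\colon A^{\otimes n}\to M[\Lambda_1,\dots,\Lambda_s]/\langle\partial+\Lambda_1+\dots+\Lambda_s\rangle$,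 $v\mapsto F_{\Lambda_1,\dots,\Lambda_s}(v)$, with $F_{\Lambda_1,\dots,\Lambda_s}(v^1_{\underline k}\otimes\cdots\partial v^t_{\underline k}\cdots\otimes v^s_{\underline k})=-\Lambda_tF_{\Lambda_1,\dots,\Lambda_s}(v)$ for $t=1,\dots,s$, where $\partial$ acts on $A^{\otimes k_t}$ as a derivation of the tensor product (by $0$ if $k_t=0$). For $m\ge1$, $\mathcal M^m_k\subset S_k$ is the set of monotone permutations starting at $m$: those $\pi\in S_k$ with $\pi(1)=m$ such that for each $2\le i\le k$ either $\pi(j)<\pi(i)$ for all $j<i$, or $\pi(j)>\pi(i)$ for all $j<i$; in the latter case $i$ is called a drop, and $\mathrm{dr}(\pi)$ is the sum of all drops $i\ge2$. $C^{\underline k}_{\mathrm{Har}}\subset C^{\underline k}_{\mathrm{Hoc}}$ is the subspace of those $F$ such that for all $1\le t\le s$, $2\le m\le k_t$: $\sum_{\pi\in\mathcal M^m_{k_t}}(-1)^{\mathrm{dr}(\pi)}F_{\Lambda_1,\dots,\Lambda_s}(v^1_{\underline k}\otimes\cdots\pi^{-1}(v^t_{\underline k})\cdots\otimes v^s_{\underline k})=F_{\Lambda_1,\dots,\Lambda_s}(v)$, where $\pi^{-1}(a_1\otimes\dots\otimes a_k)=a_{\pi(1)}\otimes\dots\otimes a_{\pi(k)}$. For $t=1,\dots,s$ let $d^{(t)}\colon C^{\underline k}_{\mathrm{Har}}\to C^{\underline k+\underline e_t}_{\mathrm{Har}}$ ($\underline e_t$ the $t$-th unit vector) be $$(d^{(t)}F)_{\Lambda_1,\dots,\Lambda_s}(v_1\otimes\dots\otimes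 v_{n+1})=(-1)^{K_{t-1}}\big(\big|_{x=\partial}v_{K_{t-1}+1}\big)F_{\Lambda_1,\dots,\Lambda_t+x,\dots,\Lambda_s}(v_1\otimes\dots\overset{K_{t-1}+1}{\curlyvee}\dots\otimes v_{n+1})$$ $$+\sum_{i=K_{t-1}+1}^{K_t}(-1)^iF_{\Lambda_1,\dots,\Lambda_s}(v_1\otimes\dots\otimes v_iv_{i+1}\otimes\dots\otimes v_{n+1})$$ $$+(-1)^{K_t+1}F_{\Lambda_1,\dots,\Lambda_t+x,\dots,\Lambda_s}(v_1\otimes\dots\overset{K_t+1}{\curlyvee}\dots\otimes v_{n+1})\big(\big|_{x=\partial}v_{K_t+1}\big),$$ where $|_{x=\partial}w$ means: expand in powers of $x$, replace $x$ by $\partial$ and apply it to $w$. Put $C^{s,n}_{\mathrm{Har}}=\bigoplus_{\underline k:K_s=n}C^{\underline k}_{\mathrm{Har}}$ and $d=\sum_td^{(t)}\colon C^{s,n}_{\mathrm{Har}}\to C^{s,n+1}_{\mathrm{Har}}$. The group $S_s$ acts on $C^{s,n}_{\mathrm{Har}}$, commuting with $d$: $\sigma\in S_s$ maps $F\in C^{\underline k}_{\mathrm{Har}}$ to $F^\sigma\in C^{\sigma(\underline k)}_{\mathrm{Har}}$, $\sigma(\underline k)=(k_{\sigma^{-1}(1)},\dots,k_{\sigma^{-1}(s)})$, where $$(F^\sigma)_{\Lambda_1,\dots,\Lambda_s}(v)=(-1)^{\sum_{t<t',\,\sigma(t')<\sigma(t)}k_tk_{t'}}F_{\Lambda_{\sigma(1)},\dots,\Lambda_{\sigma(s)}}\big(v^{\sigma(1)}_{\sigma(\underline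 k)}\otimes\dots\otimes v^{\sigma(s)}_{\sigma(\underline k)}\big).$$ Then $C^s_{\mathrm{sym},\mathrm{Har}}(A,M)=\bigoplus_{n\ge0}(C^{s,n}_{\mathrm{Har}})^{S_s}$ with differential $d$. *)

(* Defs.v *)
From HB Require Import structures.
From mathcomp Require Import all_boot all_algebra.
From mathcomp Require Import perm.
From mathcomp Require Import finmap.
From mathcomp Require Import boolp.
From mathcomp Require Import zify.
From mathcomp Require Import monalg mpoly.

Set Implicit Arguments.
Unset Strict Implicit.
Unset Printing Implicit Defensive.

Import GRing.Theory.

Local Open Scope ring_scope.
Local Open Scope quotient_scope.

Lemma leibniz_span (F : fieldType) (A : comAlgType F) (D : {linear A -> A})
    (I : Type) (b : I -> A) :
  (forall P : A -> Prop,
     P 0 -> (forall c m p, P p -> P (c *: b m + p)) -> forall p, P p) ->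
  (forall m1 m2, D (b m1 * b m2) = D (b m1) * b m2 + b m1 * D (b m2)) ->
  forall p q, D (p * q) = D p * q + p * D q.
Proof.
move=> ind Db p q; elim/ind: p => [|c m1 p IHp].
  by rewrite mul0r linear0 !mul0r addr0.
rewrite mulrDl -scalerAl !linearP /= IHp !mulrDl -!scalerAl.
suff -> : D (b m1 * q) = D (b m1) * q + b m1 * D q.
  by rewrite scalerDr addrACA.
elim/ind: q {IHp} => [|e m2 q IHq].
  by rewrite mulr0 linear0 !mulr0 addr0.
by rewrite mulrDr -scalerAr !linearP /= IHq !mulrDr -!scalerAr Db scalerDr addrACA.
Qed.

Section DiffPolyDef.
Context (F : fieldType) (N : nat).

(* The variable x_i^(j) is indexed by the pair (i, j), with i counted from 0. *)
Definition diffvar := ('I_N * nat)%type.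
HB.instance Definition _ := Countable.on diffvar.

Definition diffmonom := {cmonom diffvar}.
HB.instance Definition _ := ConomialDef.on diffmonom.

Definition diffpoly := {malg F[diffmonom]}.
HB.instance Definition _ := GRing.ComAlgebra.on diffpoly.

End DiffPolyDef.

HB.lock Definition dpmono (F : fieldType) (N : nat) (m : diffmonom N) :
  diffpoly F N := mkmalgU m (1 : F).

Section DiffPoly.
Context (F : fieldType) (N : nat).
Local Notation diffvar := (diffvar N).
Local Notation diffmonom := (diffmonom N).
Local Notation diffpoly := (diffpoly F N).
Local Notation dpmono := (@dpmono F N).

Definition dpX (i : 'I_N) (j : nat) : diffpoly :=
  dpmono (ucm ((i, j) : diffvar)).

(* The value on a monomial of the vector field
   sum_(i, j) x_i^(j+1) d/dx_i^(j). *)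
Definition dpder_monom (m : diffmonom) : diffpoly :=
  \sum_(x <- finsupp m)
    (m x)%:R *: dpmono (mmul (divcm m (ucm x)) (ucm ((x.1, x.2.+1) : diffvar))).

Definition dpder (p : diffpoly) : diffpoly :=
  \sum_(m <- monalg.msupp p) monalg.mcoeff m p *: dpder_monom m.

Lemma dpderEw (d : {fset diffmonom}) (p : diffpoly) :
  (monalg.msupp p `<=` d)%fset ->
  dpder p = \sum_(m <- d) monalg.mcoeff m p *: dpder_monom m.
Proof.
move=> le; rewrite /dpder [LHS](big_fset_incl _ le) //= => x xd /mcoeff_outdom ->.
by rewrite scale0r.
Qed.

Fact dpder_is_linear : linear dpder.
Proof.
move=> c p q.
pose d := (monalg.msupp p `|` monalg.msupp q `|` monalg.msupp (c *: p + q)%R)%fset.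
rewrite (@dpderEw d (c *: p + q)) ?fsubsetUr //.
rewrite (@dpderEw d p) ?(@dpderEw d q) //; first last.
- by rewrite /d -fsetUA fsubsetUl.
- by rewrite /d fsetUAC fsubsetUr.
rewrite scaler_sumr -big_split /=; apply: eq_bigr => m _.
by rewrite monalg.mcoeffD monalg.mcoeffZ scalerDl scalerA.
Qed.

HB.instance Definition _ :=
  GRing.isLinear.Build F diffpoly diffpoly *:%R dpder dpder_is_linear.

Lemma dpder_mono (m : diffmonom) : dpder (dpmono m) = dpder_monom m.
Proof.
rewrite dpmono.unlock (@dpderEw [fset m]%fset) ?msuppU_le // big_seq_fset1.
by rewrite monalg.mcoeffUU scale1r.
Qed.

Lemma dpmonoM (m1 m2 : diffmonom) :
  dpmono (mmul m1 m2) = dpmono m1 * dpmono m2.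
Proof.
rewrite dpmono.unlock; symmetry; apply: etrans (@fgmulUU _ _ _ _ _ _) _.
by rewrite mulr1.
Qed.

Lemma diffpolyE (p : diffpoly) :
  p = \sum_(m <- monalg.msupp p) monalg.mcoeff m p *: dpmono m.
Proof.
rewrite dpmono.unlock {1}[p]monalgE; apply: eq_bigr => m _; apply/malgP => k.
rewrite (monalg.mcoeffZ (monalg.mcoeff m p) (mkmalgU m 1)).
have E (x : F) : monalg.mcoeff k (mkmalgU m x) = x *+ (m == k).
  exact: monalg.mcoeffU.
apply: etrans (E _) _; symmetry; apply: etrans (congr1 ( *%R _) (E 1)) _.
by move: (m == k) => b; rewrite mulrnAr mulr1.
Qed.

Lemma dpder_monomEw (d : {fset diffvar}) (m : diffmonom) :
  (finsupp m `<=` d)%fset ->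
  dpder_monom m = \sum_(x <- d)
    (m x)%:R *: dpmono (mmul (divcm m (ucm x)) (ucm ((x.1, x.2.+1) : diffvar))).
Proof.
move=> le; rewrite /dpder_monom [LHS](big_fset_incl _ le) //= => x xd.
by move/fsfun_dflt => ->; rewrite scale0r.
Qed.

Lemma dpderX i j : dpder (dpX i j) = dpX i j.+1.
Proof.
rewrite /dpX dpder_mono (@dpder_monomEw [fset ((i, j) : diffvar)]%fset) ?mdomU //.
rewrite big_seq_fset1 cmUU scale1r; congr (dpmono _).
by apply/eqP/cmP => y; rewrite cmM divcmE subnn.
Qed.

Lemma dpder_monomM (m1 m2 : diffmonom) :
  dpder_monom (mmul m1 m2) =
  dpder_monom m1 * dpmono m2 + dpmono m1 * dpder_monom m2.
Proof.
pose d := (finsupp m1 `|` finsupp m2)%fset.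
rewrite (@dpder_monomEw d) ?mdomD //.
rewrite (@dpder_monomEw d m1) ?fsubsetUl // (@dpder_monomEw d m2) ?fsubsetUr //.
rewrite mulr_suml mulr_sumr -big_split /=; apply: eq_bigr => x _.
rewrite -scalerAl -(scalerAr _ (dpmono m1)).
rewrite -(dpmonoM _ m2) -(dpmonoM m1).
rewrite cmM natrD scalerDl.
apply: (f_equal2 +%R).
- have [->|m1x] := eqVneq (m1 x) 0%N; first by rewrite !scale0r.
  apply: (congr1 (fun z => _ *: dpmono z)); apply/eqP/cmP => y; rewrite !cmM !divcmE !cmM !cmU.
  by case: (eqVneq x y) m1x => [<-|_] /=; lia.
- have [->|m2x] := eqVneq (m2 x) 0%N; first by rewrite !scale0r.
  apply: (congr1 (fun z => _ *: dpmono z)); apply/eqP/cmP => y; rewrite !cmM !divcmE !cmM !cmU.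
  by case: (eqVneq x y) m2x => [<-|_] /=; lia.
Qed.

Lemma diffpoly_ind (P : diffpoly -> Prop) :
  P 0 -> (forall c m p, P p -> P (c *: dpmono m + p)) -> forall p, P p.
Proof.
move=> P0 PS p; rewrite (diffpolyE p).
elim: (enum_fset _) => [|m r IHr]; first by rewrite big_nil.
by rewrite big_cons; apply: PS.
Qed.

Lemma dpderM (p q : diffpoly) : dpder (p * q) = dpder p * q + p * dpder q.
Proof.
apply: (leibniz_span diffpoly_ind) => m1 m2.
by rewrite -dpmonoM /= !dpder_mono dpder_monomM.
Qed.

End DiffPoly.

Section Complex.
Context (F : fieldType) (A : comAlgType F) (D : {linear A -> A}) (s : nat).

(* M[Lambda_1, ..., Lambda_s] for M = A *)
Local Notation lampoly := (mpoly.mpoly s A).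

(* partial, acting on the coefficients *)
Definition coef_der (p : lampoly) : lampoly := map_mpoly D p.

Definition totder (p : lampoly) : lampoly :=
  coef_der p + (\sum_(t < s) 'X_t) * p.

Definition totder_im : {pred lampoly} :=
  fun p => `[< exists q, p = totder q >].

Lemma totderB : {morph totder : p q / p - q}.
Proof.
by move=> p q; rewrite /totder /coef_der raddfB mulrBr opprD addrACA.
Qed.

Lemma totderZ (c : F) p : totder (c%:A *: p) = c%:A *: totder p.
Proof.
rewrite /totder /coef_der scalerDr scalerAr; congr (_ + _); apply/mpolyP => m.
rewrite mpoly.mcoeffZ !mcoeff_map_mpoly mpoly.mcoeffZ !mulr_algl.
have DZ x : D (c *: x) = c *: D x by rewrite linearZ.
exact: DZ.
Qed.

Fact totder_im_zmod : zmod_closed totder_im.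
Proof.
split=> [|p q /asboolP[p' ->] /asboolP[q' ->]]; apply/asboolP.
  by exists 0; rewrite -[0 in RHS](subrr 0) totderB subrr.
by exists (p' - q'); rewrite totderB.
Qed.

HB.instance Definition _ :=
  GRing.isZmodClosed.Build lampoly totder_im totder_im_zmod.

(* M[Lambda_1, ..., Lambda_s] / <partial + Lambda_1 + ... + Lambda_s> *)
Definition lamquot := Quotient.quot totder_im.
HB.instance Definition _ := Choice.on lamquot.
HB.instance Definition _ := GRing.Zmodule.on lamquot.
HB.instance Definition _ := EqQuotient.on lamquot.

Lemma lamquot_eqP (p q : lampoly) :
  reflect (exists r, p - q = totder r) (\pi_lamquot p == \pi_lamquot q).
Proof. by rewrite piE; apply: asboolP. Qed.

Lemma lamquot_piB (p q : lampoly) :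
  \pi_lamquot (p - q) = \pi_lamquot p - \pi_lamquot q.
Proof. exact: (raddfB (\pi_lamquot)). Qed.

Lemma lamquot_piD (p q : lampoly) :
  \pi_lamquot (p + q) = \pi_lamquot p + \pi_lamquot q.
Proof. exact: (raddfD (\pi_lamquot)). Qed.

(* The map induced on the quotient by an operator on M[Lambda_1, ..., Lambda_s];
   it is only meaningful for additive operators preserving the image of totder.
   The operators used below do when D is a derivation: see lamquot_mulX_pi,
   lamquot_perm_pi and lamquot_act_pi. *)
Definition lamquot_map (op : lampoly -> lampoly) (q : lamquot) : lamquot :=
  \pi_lamquot (op (repr q)).

Lemma lamquot_map_pi (op : lampoly -> lampoly) :
  {morph op : p q / p - q} -> (forall p, exists q, op (totder p) = totder q) ->
  forall p, lamquot_map op (\pi_lamquot p) = \pi_lamquot (op p).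
Proof.
move=> opB op_im p; apply/eqP/lamquot_eqP; rewrite -opB.
have /eqP/lamquot_eqP[r ->] : \pi_lamquot (repr (\pi_lamquot p)) = \pi_lamquot p.
  by rewrite reprK.
exact: op_im.
Qed.

Definition lamquot_scale (c : F) : lamquot -> lamquot :=
  lamquot_map (fun p => c%:A *: p).

Lemma lamquot_scale_pi c p : lamquot_scale c (\pi_lamquot p) = \pi_lamquot (c%:A *: p).
Proof.
apply: (lamquot_map_pi (op := fun p => c%:A *: p)) => [x y|x].
  exact: scalerBr.
by exists (c%:A *: x); rewrite totderZ.
Qed.

Fact lamquot_scaleA c e q :
  lamquot_scale c (lamquot_scale e q) = lamquot_scale (c * e) q.
Proof.
elim/quotW: q => p; rewrite (lamquot_scale_pi e) !(lamquot_scale_pi _ p) lamquot_scale_pi.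
by rewrite scalerA mulr_algl scalerA.
Qed.

Fact lamquot_scale1 : left_id 1 lamquot_scale.
Proof. by elim/quotW => p; rewrite lamquot_scale_pi !scale1r. Qed.

Fact lamquot_scaleDr : right_distributive lamquot_scale +%R.
Proof.
move=> c; elim/quotW => p; elim/quotW => q.
by rewrite -lamquot_piD !lamquot_scale_pi scalerDr lamquot_piD.
Qed.

Fact lamquot_scaleDl q : {morph lamquot_scale^~ q : c e / c + e}.
Proof.
by move=> c e; elim/quotW: q => p; rewrite !lamquot_scale_pi !scalerDl lamquot_piD.
Qed.

HB.instance Definition _ := GRing.Zmodule_isLmodule.Build F lamquot
  lamquot_scaleA lamquot_scale1 lamquot_scaleDr lamquot_scaleDl.

(* p |-> p(Lambda_(sigma 1), ..., Lambda_(sigma s)) is [msym sigma p]. *)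

(* p(Lambda_1, ..., Lambda_t + x, ..., Lambda_s), as a polynomial in x *)
Definition lam_shift (t : 'I_s) (p : lampoly) : {poly lampoly} :=
  mpoly.mmap (polyC \o @mpolyC s A)
    (fun u => ('X_u)%:P + (if u == t then 'X else 0)) p.

(* (|_(x = partial) a) P(x) *)
Definition eval_der (a : A) (P : {poly lampoly}) : lampoly :=
  \sum_(j < size P) iter j D a *: P`_j.

(* (|_(x = partial) a) p(Lambda_1, ..., Lambda_t + x, ..., Lambda_s) *)
Definition lam_act (t : 'I_s) (a : A) (p : lampoly) : lampoly :=
  eval_der a (lam_shift t p).

Section WellDefined.
Hypothesis DM : forall a b, D (a * b) = D a * b + a * D b.

Let D1 : D 1 = 0.
Proof.
have := DM 1 1; rewrite !mulr1 mul1r => /eqP.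
by rewrite -subr_eq0 opprD addNKr oppr_eq0 => /eqP.
Qed.

Let dCB : {morph coef_der : p q / p - q}. Proof. exact: raddfB. Qed.
Let dCD : {morph coef_der : p q / p + q}. Proof. exact: raddfD. Qed.
Let dC0 : coef_der 0 = 0. Proof. exact: raddf0. Qed.

Let dCE p m : (coef_der p)@_m = D p@_m.
Proof. exact: mcoeff_map_mpoly. Qed.

Let dC1 : coef_der 1 = 0.
Proof.
apply/mpolyP => m; rewrite dCE mcoeff1 mcoeff0.
by case: eqP => _; rewrite ?D1 ?linear0.
Qed.

Let dCM p q : coef_der (p * q) = coef_der p * q + p * coef_der q.
Proof.
apply/mpolyP => m; rewrite mpoly.mcoeffD dCE !mcoeffM linear_sum -big_split /=.
by apply: eq_bigr => k _; rewrite DM !dCE.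
Qed.

Let dCX t : coef_der 'X_t = 0.
Proof.
apply/mpolyP => m; rewrite dCE mcoeffX mcoeff0.
by case: eqP => _; rewrite ?D1 ?linear0.
Qed.

Let dCZ a p : coef_der (a *: p) = D a *: p + a *: coef_der p.
Proof.
by apply/mpolyP => m; rewrite mpoly.mcoeffD dCE !mpoly.mcoeffZ DM dCE.
Qed.

Lemma lamquot_mulX_pi t p :
  lamquot_map ( *%R 'X_t) (\pi_lamquot p) = \pi_lamquot ('X_t * p).
Proof.
apply: lamquot_map_pi => [x y|x]; first exact: mulrBr.
exists ('X_t * x); rewrite /totder mulrDr mulrCA.
by rewrite dCM dCX mul0r add0r.
Qed.

Lemma lamquot_perm_pi sigma p :
  lamquot_map (msym sigma) (\pi_lamquot p) = \pi_lamquot (msym sigma p).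
Proof.
apply: lamquot_map_pi => [x y|x]; first exact: raddfB.
have symS : msym sigma (\sum_(u < s) 'X_u) = \sum_(u < s) 'X_u :> lampoly.
  rewrite raddf_sum [RHS](reindex_inj (@perm_inj _ sigma)) /=.
  by apply: eq_bigr => i _; rewrite /msym mmapX mmap1U.
have symdC : msym sigma (coef_der x) = coef_der (msym sigma x).
  by apply/mpolyP => m; rewrite mcoeff_sym !dCE mcoeff_sym.
by exists (msym sigma x); rewrite /totder msymD msymM symS symdC.
Qed.

Let eval_derEw n a (P : {poly lampoly}) : (size P <= n)%N ->
  eval_der a P = \sum_(j < n) iter j D a *: P`_j.
Proof.
move=> le; rewrite /eval_der (big_ord_widen n (fun j => iter j D a *: P`_j)) //.
rewrite big_mkcond; apply: eq_bigr => j _; case: ltnP => // /leq_sizeP -> //.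
by rewrite scaler0.
Qed.

Let eval_derB a : {morph eval_der a : P Q / P - Q}.
Proof.
move=> P Q; pose n := maxn (size P) (size Q).
rewrite !(@eval_derEw n) ?leq_maxl ?leq_maxr //; last first.
  by rewrite (leq_trans (size_polyD _ _)) // size_polyN.
by rewrite -sumrB; apply: eq_bigr => j _; rewrite coefB scalerBr.
Qed.

Let eval_der0 a : eval_der a 0 = 0.
Proof. by rewrite /eval_der size_poly0 big_ord0. Qed.

Let eval_derD a : {morph eval_der a : P Q / P + Q}.
Proof.
move=> P Q; rewrite -[Q in LHS]opprK eval_derB -[- Q]sub0r eval_derB eval_der0.
by rewrite sub0r opprK.
Qed.

Let eval_derCM a c P : eval_der a (c%:P * P) = c * eval_der a P.
Proof.
rewrite (@eval_derEw (size P)) ?mul_polyC ?size_scale_leq // mulr_sumr.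
by apply: eq_bigr => j _; rewrite coefZ scalerAr.
Qed.

Let eval_derXM a P : eval_der a ('X * P) = eval_der (D a) P.
Proof.
rewrite (@eval_derEw (size P).+1); last first.
  by rewrite (leq_trans (size_polyMleq _ _)) // size_polyX.
rewrite big_ord_recl coefXM eqxx scaler0 add0r; apply: eq_bigr => j _.
by rewrite coefXM /= -iterSr.
Qed.

Local Definition poly_der (P : {poly lampoly}) := \poly_(j < size P) coef_der P`_j.

Let dPE P j : (poly_der P)`_j = coef_der P`_j.
Proof.
rewrite coef_poly; case: ltnP => [_|/leq_sizeP ->]; [by []|by rewrite dC0|by []].
Qed.

Let dPM P Q : poly_der (P * Q) = poly_der P * Q + P * poly_der Q.
Proof.
apply/polyP => j; rewrite coefD dPE !coefM (big_morph coef_der dCD dC0) -big_split /=.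
by apply: eq_bigr => k _; rewrite dCM !dPE.
Qed.

Let dPD P Q : poly_der (P + Q) = poly_der P + poly_der Q.
Proof. by apply/polyP => j; rewrite coefD !dPE coefD dCD. Qed.

Let dP0 : poly_der 0 = 0.
Proof. by apply/polyP => j; rewrite dPE coef0 dC0. Qed.

Let dPC c : poly_der c%:P = (coef_der c)%:P.
Proof.
apply/polyP => j; rewrite dPE.
rewrite [LHS](congr1 coef_der (coefC c j)) coefC.
by case: (j == 0)%N; [|exact: dC0].
Qed.

Let eval_der_dP a P :
  coef_der (eval_der a P) = eval_der (D a) P + eval_der a (poly_der P).
Proof.
rewrite (@eval_derEw (size P) a (poly_der P)) ?size_poly //.
rewrite /eval_der (big_morph coef_der dCD dC0) -big_split /=.
by apply: eq_bigr => j _; rewrite dCZ dPE -iterS iterSr.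
Qed.

Let dP_shiftX t m : poly_der (lam_shift t 'X_[m]) = 0.
Proof.
have dP1 : poly_der 1 = 0.
  by rewrite -polyC1 dPC dC1 polyC0.
rewrite /lam_shift mmapX /mmap1.
elim/big_ind: _ => // [P Q HP HQ|u _]; first by rewrite dPM HP HQ mul0r mulr0 addr0.
elim: (m u) => [|k IHk]; first by rewrite expr0.
rewrite exprS dPM IHk mulr0 addr0 dPD dPC dCX add0r.
suff -> : poly_der (if u == t then 'X else 0) = 0 by rewrite mul0r.
case: ifP => _; last exact: dP0.
apply/polyP => j; rewrite dPE coefX coef0; case: eqP => _ /=; last exact: dC0.
exact: dC1.
Qed.

Let lam_shiftD t : {morph lam_shift t : p q / p + q}.
Proof. exact: raddfD. Qed.

Let lam_shift_dC t p : lam_shift t (coef_der p) = poly_der (lam_shift t p).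
Proof.
elim/mpolyind: p => [|c m p _ _ IHp].
  by rewrite dC0 /lam_shift raddf0 dP0.
rewrite dCD !lam_shiftD dPD IHp; congr (_ + _).
have dCXm : coef_der 'X_[m] = 0.
  apply/mpolyP => k; rewrite dCE mcoeffX mcoeff0.
  by case: eqP => _; rewrite ?D1 ?linear0.
rewrite dCZ dCXm scaler0 addr0 /lam_shift !mmapZ /= dPM dP_shiftX mulr0 addr0.
by rewrite dPC /coef_der map_mpolyC.
Qed.

Lemma lamquot_act_pi t a p :
  lamquot_map (lam_act t a) (\pi_lamquot p) = \pi_lamquot (lam_act t a p).
Proof.
apply: lamquot_map_pi => [x y|x].
  by rewrite /lam_act /lam_shift raddfB eval_derB.
have shiftE : lam_shift t ((\sum_(u < s) 'X_u) * x) =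
    ((\sum_(u < s) 'X_u)%:P + 'X) * lam_shift t x.
  rewrite {1}/lam_shift rmorphM /=; apply: (congr1 ( *%R^~ _)).
  rewrite raddf_sum /=; under eq_bigr => u _ do rewrite mmapX mmap1U.
  by rewrite big_split /= -rmorph_sum -big_mkcond big_pred1_eq.
exists (lam_act t a x); rewrite /totder /lam_act lam_shiftD shiftE lam_shift_dC.
rewrite eval_der_dP mulrDl !eval_derD eval_derCM eval_derXM.
by rewrite [LHS]addrC [RHS]addrAC [X in X + _ = _]addrC.
Qed.

End WellDefined.
(* A word is v^1 (x) ... (x) v^s with v^t a list of k_t elements of A. *)
Definition word := {ffun 'I_s -> seq A}.

(* n = K_s = k_1 + ... + k_s *)
Definition wlen (v : word) : nat := \sum_(t < s) size (v t).

(* K_(t-1) = k_1 + ... + k_(t-1) *)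
Definition woff (t : 'I_s) (v : word) : nat :=
  \sum_(u < s | (u < t)%N) size (v u).

Definition set_block (v : word) (t : 'I_s) (w : seq A) : word :=
  [ffun u => if u == t then w else v u].

Definition set_letter (v : word) (t : 'I_s) (i : nat) (a : A) : word :=
  set_block v t (set_nth 0 (v t) i a).

(* A function on words is a family, indexed by k = (k_1, ..., k_s), of functions
   on A^(k_1) x ... x A^(k_s); the conditions below only relate words of the same
   shape k, and together say that each member of the family is in C^k_Har. *)
Definition cochain := word -> lamquot.

(* F_k is a linear map on the tensor power of A. *)
Definition multilinear (f : cochain) : Prop :=
  forall (v : word) (t : 'I_s) (i : nat), (i < size (v t))%N ->
  forall (c : F) (a b : A),
    f (set_letter v t i (c *: a + b)) =
    c *: f (set_letter v t i a) + f (set_letter v t i b).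

Definition sesquilinear (f : cochain) : Prop :=
  forall (v : word) (t : 'I_s),
    \sum_(i < size (v t)) f (set_letter v t i (D (v t)`_i)) =
    - lamquot_map ( *%R 'X_t) (f v).

(* The indices i, j and the values of pi : 'S_k are shifted by one with respect
   to {1, ..., k}. *)
Definition is_drop (k : nat) (pi : 'S_k) (i : 'I_k) : bool :=
  (0 < i)%N && [forall j : 'I_k, (j < i)%N ==> (pi i < pi j)%N].

Definition is_rise (k : nat) (pi : 'S_k) (i : 'I_k) : bool :=
  (0 < i)%N && [forall j : 'I_k, (j < i)%N ==> (pi j < pi i)%N].

Definition monotone_from (k m : nat) (pi : 'S_k) : bool :=
  [forall i : 'I_k,
     if i == 0%N :> nat then (pi i).+1 == m else is_rise pi i || is_drop pi i].

Definition drop_sum (k : nat) (pi : 'S_k) : nat :=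
  \sum_(i < k | is_drop pi i) i.+1.

(* pi^(-1)(a_1 (x) ... (x) a_k) = a_(pi 1) (x) ... (x) a_(pi k) *)
Definition perm_seq (w : seq A) (pi : 'S_(size w)) : seq A :=
  [seq w`_(pi j) | j <- enum 'I_(size w)].

Definition harrison (f : cochain) : Prop :=
  forall (v : word) (t : 'I_s) (m : nat), (2 <= m <= size (v t))%N ->
    \sum_(pi : 'S_(size (v t)) | monotone_from m pi)
       (-1) ^+ drop_sum pi *: f (set_block v t (perm_seq pi)) = f v.

(* F is in C^(s,n)_Har, the direct sum of the C^k_Har with K_s = n. *)
Definition Har_cochain (n : nat) (f : cochain) : Prop :=
  [/\ forall v, wlen v != n -> f v = 0,
      multilinear f, sesquilinear f & harrison f].

(* (d^(t) F)(v), where v^t = a :: w has length k_t + 1 *)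
Definition block_diff (t : 'I_s) (f : cochain) (v : word) : lamquot :=
  if v t is a :: w then
    (-1) ^+ woff t v *: lamquot_map (lam_act t a) (f (set_block v t w))
    + \sum_(i < size w) (-1) ^+ (woff t v + i.+1) *:
        f (set_block v t
             (take i (v t) ++ (v t)`_i * (v t)`_i.+1 :: drop i.+2 (v t)))
    + (-1) ^+ (woff t v + size w).+1 *:
        lamquot_map (lam_act t (last a w)) (f (set_block v t (belast a w)))
  else 0.

Definition diff (f : cochain) : cochain :=
  fun v => \sum_(t < s) block_diff t f v.

(* F^sigma; as v has shape sigma(k), its block v^(sigma t) has length k_t. *)
Definition sym_act (sigma : 'S_s) (f : cochain) : cochain := fun v =>
  (-1) ^+ (\sum_(t < s) \sum_(t' < s | (t < t')%N && (sigma t' < sigma t)%N)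
              size (v (sigma t)) * size (v (sigma t')))%N
  *: lamquot_map (msym sigma) (f [ffun t => v (sigma t)]).

Definition symHar_cochain (n : nat) (f : cochain) : Prop :=
  Har_cochain n f /\ forall sigma, sym_act sigma f =1 f.

Definition symHar_cocycle (n : nat) (f : cochain) : Prop :=
  symHar_cochain n f /\ forall v, diff f v = 0.

Definition symHar_coboundary (n : nat) (f : cochain) : Prop :=
  if n is m.+1 then exists2 g, symHar_cochain m g & diff g =1 f
  else forall v, f v = 0.

(* H^n(C^s_(sym,Har)(A, A), d) = 0 *)
Definition symHar_cohomology_eq0 (n : nat) : Prop :=
  forall f, symHar_cocycle n f -> symHar_coboundary n f.

End Complex.

(* Main.v *)
Require Import Defs.
From HB Require Import structures.
From mathcomp Require Import all_boot all_algebra.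
From mathcomp Require Import perm finmap boolp ring zify.
From mathcomp Require Import monalg mpoly.

(** The vanishing is an instance of the principle that a polynomial algebra has
    Hochschild cohomology only in the form of polyvector fields, and that the
    Harrison part of these is what has length at most one. The proof makes this
    explicit by a contraction, so that the sesquilinearity conditions, the
    action of the symmetric group and the infinite number of variables can be
    dealt with by inspection of formulas.

    For a block t, the operation (|_(x = partial) a) F_(Lambda_t + x) makes the
    coefficient space a module over the algebra ([lam_actM], [lam_module]), and
    multiplication by -Lambda_t becomes an operator that is a derivation over
    partial ([mulX_act]). Hence d^(t) is, up to the sign (-1)^(K_(t-1)), the
    Hochschild differential [bar] of the functions of the t-th block with values
    in a symmetric bimodule ([block_diffE]). The Harrison conditions are
    equivalent to vanishing on signed shuffles of nonempty words: a monotone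
    permutation starting at m lists the reversal of the letters before the m-th
    one, shuffled with the letters after it ([monotone_sumE],
    [harrison_shuffle_free], [shuffle_free_harrison]).

    In one block, let x run over the variables and set
      (h f)(v) = - sum_i +- sum_x f(x, d v_i / d x, (v_(i-1) ... v_1) sh (v_(i+1) ... v_k)),
    where sh is the signed shuffle product; one more term handles one-letter
    words. Any function of this form kills shuffles ([shuffle_free_pin]), and the
    passage from a function of a pinned letter to such a sum commutes with the
    differential ([pin_bar_nil]). Therefore, on functions that vanish on shuffles,
    b h + h b is the operator
      f |-> sum_i sum_x (f(.., x d v_i / d x, ..) - x f(.., d v_i / d x, ..))
    corrected on words of one or two letters ([homotopy]). On words of monomials it is
    triangular: modulo the values of f on words of smaller weight it multiplies
    f by the [weight] of the word, which is the total degree apart from the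
    short words concerned by the correction ([laplacian_mono]).

    The differential, the contraction and the conditions are all given blockwise.
    Operators changing the length of one block by an odd amount anticommute when
    they act on different blocks ([total_op_anticomm]) and commute with the signed
    action of the symmetric group ([total_op_sym_act]). So the total contraction
    h preserves symmetric Harrison cochains, and d h + h d multiplies by the sum
    of the weights of the blocks, in the triangular sense above. If this sum is 0
    and there are more letters than blocks, some block is a constant word with at
    least three letters, on which a function vanishing on shuffles is 0
    ([weight0_vanish]); this is where the hypothesis s < n enters.

    Given a cocycle f, put f_0 = f and f_(k+1) = f_k - (k+1)^(-1) d h f_k. By
    induction f_k vanishes on monomial words of weight at most k
    ([residue_mword]), so on each given word f_k is 0 for large k. The sum of
    the (k+1)^(-1) h f_k is thus finite on each word, and it is a symmetric
    Harrison cochain with differential f ([diff_primitive]). *)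

Set Implicit Arguments.
Unset Strict Implicit.
Unset Printing Implicit Defensive.

Import GRing.Theory.
Local Open Scope ring_scope.
Local Open Scope quotient_scope.

(** * Linear identities in modules *)

Section LinearCombination.
Context (R : comNzRingType) (M : lmodType R).

Inductive lincomb :=
  | LVar of nat
  | LZero
  | LOpp of lincomb
  | LAdd of lincomb & lincomb
  | LScale of R & lincomb.

Fixpoint lincomb_val (env : seq M) (e : lincomb) : M :=
  match e with
  | LVar i => env`_i
  | LZero => 0
  | LOpp e1 => - lincomb_val env e1
  | LAdd e1 e2 => lincomb_val env e1 + lincomb_val env e2
  | LScale r e1 => r *: lincomb_val env e1
  end.

Fixpoint lincomb_coef (i : nat) (e : lincomb) : R :=
  match e with
  | LVar j => if PeanoNat.Nat.eqb i j then 1 else 0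
  | LZero => 0
  | LOpp e1 => - lincomb_coef i e1
  | LAdd e1 e2 => lincomb_coef i e1 + lincomb_coef i e2
  | LScale r e1 => r * lincomb_coef i e1
  end.

Fixpoint same_coefs (n : nat) (e1 e2 : lincomb) : Prop :=
  if n is k.+1 then
    lincomb_coef k e1 = lincomb_coef k e2 /\ same_coefs k e1 e2
  else True.

Lemma lincomb_valE env e :
  lincomb_val env e = \sum_(i < size env) lincomb_coef i e *: env`_i.
Proof.
elim: e => [j||e IH|e1 IH1 e2 IH2|r e IH] /=.
- transitivity (\sum_(i < size env | i == j :> nat) env`_i).
    have [jlt|jge] := ltnP j (size env).
      by rewrite (big_pred1 (Ordinal jlt)).
    rewrite nth_default // big_pred0 // => i; apply/negbTE.
    by rewrite neq_ltn (leq_trans (ltn_ord i) jge).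
  rewrite big_mkcond; apply: eq_bigr => i _.
  have -> : PeanoNat.Nat.eqb i j = (i == j :> nat).
    by apply/idP/eqP => [/PeanoNat.Nat.eqb_eq|->] //; apply: PeanoNat.Nat.eqb_refl.
  by case: eqP => _; rewrite ?scale1r ?scale0r.
- by rewrite big1 // => i _; rewrite scale0r.
- by rewrite IH -sumrN; apply: eq_bigr => i _; rewrite scaleNr.
- by rewrite IH1 IH2 -big_split; apply: eq_bigr => i _; rewrite scalerDl.
- by rewrite IH scaler_sumr; apply: eq_bigr => i _; rewrite scalerA.
Qed.

Lemma lincomb_eq env e1 e2 :
  same_coefs (size env) e1 e2 -> lincomb_val env e1 = lincomb_val env e2.
Proof.
rewrite !lincomb_valE => H; apply: eq_bigr => i _; congr (_ *: _).
move: (nat_of_ord i) (ltn_ord i) H => {i}; elim: (size env) => // n IH i.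
rewrite ltnS leq_eqVlt => /orP[/eqP-> []//|lt [_]]; exact: IH.
Qed.
End LinearCombination.

Ltac lmod_mem t env :=
  lazymatch env with
  | nil => constr:(false)
  | cons ?h ?tl =>
    match constr:(Set) with
    | _ => let _ := match constr:(Set) with _ => unify t h end in constr:(true)
    | _ => lmod_mem t tl
    end
  end.

Ltac lmod_env env t :=
  lazymatch t with
  | GRing.add ?a ?b => let env := lmod_env env a in lmod_env env b
  | GRing.opp ?a => lmod_env env a
  | GRing.scale _ ?a => lmod_env env a
  | GRing.zero => env
  | _ => lazymatch lmod_mem t env with
         | true => env
         | false => constr:(cons t env)
         end
  end.

Ltac lmod_pos t env :=
  lazymatch env with
  | cons ?h ?tl =>
    match constr:(Set) with
    | _ => let _ := match constr:(Set) with _ => unify t h end in constr:(O)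
    | _ => let k := lmod_pos t tl in constr:(S k)
    end
  end.

Ltac lmod_reify R M env t :=
  lazymatch t with
  | GRing.add ?a ?b =>
    let a := lmod_reify R M env a in let b := lmod_reify R M env b in
    constr:(@LAdd R a b)
  | GRing.opp ?a => let a := lmod_reify R M env a in constr:(@LOpp R a)
  | GRing.scale ?r ?a => let a := lmod_reify R M env a in constr:(@LScale R r a)
  | GRing.zero => constr:(@LZero R)
  | _ => let k := lmod_pos t env in constr:(@LVar R k)
  end.

(** Reduces an equality of linear combinations to the equality of the coefficients of
    each atom, and leaves the goals that [ring] does not solve. *)
Ltac lmod_with R M :=
  match goal with
  | |- @eq _ ?a ?b =>
    let env := lmod_env constr:(@nil (GRing.Lmodule.sort M)) a in
    let env := lmod_env env b in
    let ea := lmod_reify R M env a in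
    let eb := lmod_reify R M env b in
    change (@lincomb_val R M env ea = @lincomb_val R M env eb);
    apply: lincomb_eq; cbn [size same_coefs lincomb_coef PeanoNat.Nat.eqb];
    repeat split; try ring
  end.

(** * Signed shuffles *)

Section Chains.
Context (A : comNzRingType).
Implicit Types (a b : A) (x y z w : seq A).

(** The sign (-1)^n, in a form that computes once the parity of n is known. *)
Definition alt_sign (n : nat) : A := if odd n then -1 else 1.

Lemma alt_signE n : alt_sign n = (-1) ^+ n.
Proof. by rewrite -signr_odd /alt_sign; case: (odd n). Qed.

(** The sign (-1)^(n(n-1)/2) of the permutation reversing n letters. *)
Definition rev_sign (n : nat) : A := alt_sign 'C(n, 2).

Lemma rev_signS n : rev_sign n.+1 = alt_sign n * rev_sign n.
Proof.
rewrite /rev_sign /alt_sign binS bin1 oddD.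
by case: (odd n); case: (odd _); rewrite /= ?mulrNN ?mulr1 ?mul1r.
Qed.

(** A formal combination of words. The operators on functions of words are all
    of the form f |-> ev f c with c a chain depending on the argument, which
    makes them linear in f and local: only finitely many values of f are used. *)
Definition chain := seq (A * seq A).

Definition prepend a (c : chain) : chain := [seq (p.1, a :: p.2) | p <- c].
Definition scale_chain r (c : chain) : chain := [seq (r * p.1, p.2) | p <- c].

Fixpoint shuffle x : seq A -> chain :=
  if x is a :: x' then
    fix shuffle_x y := if y is b :: y' then
        prepend a (shuffle x' y) ++ scale_chain (alt_sign (size x)) (prepend b (shuffle_x y'))
      else [:: (1, x)]
  else fun y => [:: (1, y)].

Section Ev.
Context (M : lmodType A).
Implicit Types (f g : seq A -> M).

Definition ev f (c : chain) : M := \sum_(p <- c) p.1 *: f p.2.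

Lemma ev_nil f : ev f [::] = 0. Proof. exact: big_nil. Qed.
Lemma ev_cons f p c : ev f (p :: c) = p.1 *: f p.2 + ev f c.
Proof. exact: big_cons. Qed.
Lemma ev_cat f c d : ev f (c ++ d) = ev f c + ev f d.
Proof. exact: big_cat. Qed.
Lemma ev_prepend f a c : ev f (prepend a c) = ev (fun w => f (a :: w)) c.
Proof. exact: big_map. Qed.
Lemma ev_scale f r c : ev f (scale_chain r c) = r *: ev f c.
Proof.
rewrite /ev big_map scaler_sumr; apply: eq_bigr => p _.
by rewrite -scalerA.
Qed.
Lemma ev_ext f g c : f =1 g -> ev f c = ev g c.
Proof. by move=> fg; apply: eq_bigr => p _; rewrite fg. Qed.
Lemma evD f g c : ev (fun w => f w + g w) c = ev f c + ev g c.
Proof. by rewrite -big_split; apply: eq_bigr => p _; rewrite scalerDr. Qed.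
Lemma evZ r f c : ev (fun w => r *: f w) c = r *: ev f c.
Proof.
rewrite scaler_sumr; apply: eq_bigr => p _.
by rewrite !scalerA mulrC.
Qed.
Lemma evN f c : ev (fun w => - f w) c = - ev f c.
Proof. by rewrite -sumrN; apply: eq_bigr => p _; rewrite scalerN. Qed.
Lemma ev0 c : ev (fun=> 0) c = 0.
Proof. by rewrite /ev big1 // => p _; rewrite scaler0. Qed.
Lemma ev_sum I (r : seq I) (P : pred I) (F : I -> seq A -> M) c :
  ev (fun w => \sum_(i <- r | P i) F i w) c = \sum_(i <- r | P i) ev (F i) c.
Proof.
rewrite exchange_big /=; apply: eq_bigr => p _; exact: scaler_sumr.
Qed.

Definition shsum f x y : M := ev f (shuffle x y).

Lemma shsum0s f y : shsum f [::] y = f y.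
Proof. by rewrite /shsum /= ev_cons ev_nil addr0 scale1r. Qed.
Lemma shsums0 f x : shsum f x [::] = f x.
Proof. by case: x => [|a x]; rewrite /shsum /= ev_cons ev_nil addr0 scale1r. Qed.
Lemma shsum_cons f a x b y :
  shsum f (a :: x) (b :: y) = shsum (fun w => f (a :: w)) x (b :: y)
    + alt_sign (size x).+1 *: shsum (fun w => f (b :: w)) (a :: x) y.
Proof. by rewrite /shsum /= ev_cat ev_scale !ev_prepend. Qed.

Lemma shsum_ext f g x y : f =1 g -> shsum f x y = shsum g x y.
Proof. exact: ev_ext. Qed.
Lemma shsumD f g x y : shsum (fun w => f w + g w) x y = shsum f x y + shsum g x y.
Proof. exact: evD. Qed.
Lemma shsumZ r f x y : shsum (fun w => r *: f w) x y = r *: shsum f x y.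
Proof. exact: evZ. Qed.
Lemma shsumN f x y : shsum (fun w => - f w) x y = - shsum f x y.
Proof. exact: evN. Qed.
Lemma shsum0 x y : shsum (fun=> 0) x y = 0.
Proof. exact: ev0. Qed.

Lemma shsum_sizeE f g x y :
  (forall w, size w = (size x + size y)%N -> f w = g w) ->
  shsum f x y = shsum g x y.
Proof.
elim: x y f g => [|a x IHx] y f g; first by rewrite !shsum0s; apply.
elim: y f g => [|b y IHy] f g; first by rewrite !shsums0 addn0; apply.
move=> fg; rewrite !shsum_cons; congr (_ + _ *: _).
  by apply: IHx => w /= sw; rewrite fg //= sw.
by apply: IHy => w /= sw; rewrite fg //= sw addnS.
Qed.
End Ev.
End Chains.

Section Shuffles.
Context (A : comNzRingType) (M : lmodType A).
Implicit Types (a b c : A) (x y z w : seq A) (f g : seq A -> M).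
Local Notation sg := (@alt_sign A).
Ltac lmod := lmod_with A M.

(** Coefficients that only depend on the length of the word, as all signs do, can
    be moved in and out of a shuffle. *)
Lemma shsum_sizeZ f x y (k : nat -> A) :
  shsum (fun w => k (size w) *: f w) x y = k (size x + size y)%N *: shsum f x y.
Proof. by rewrite -shsumZ; apply: shsum_sizeE => w ->. Qed.

Lemma shsumC f x y : shsum f x y = sg (size x * size y) *: shsum f y x.
Proof.
elim: x y f => [|a x IHx] y f; first by rewrite shsum0s shsums0 scale1r.
elim: y f => [|b y IHy] f; first by rewrite shsum0s shsums0 muln0 scale1r.
rewrite !shsum_cons IHx IHy /alt_sign /= !mulnS !mulSn !(oddD, oddS, oddM) /=.
case: (odd (size x)); case: (odd (size y)) => /=; lmod.
Qed.

Lemma shsumA f x y z :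
  shsum (fun w => shsum f w z) x y = shsum (fun w => shsum f x w) y z.
Proof.
elim: x y z f => [|a x IHx] y z f.
  by rewrite shsum0s; apply: shsum_ext => w; rewrite shsum0s.
elim: y z f => [|b y IHy] z f; first by rewrite shsums0 shsum0s.
elim: z f => [|c z IHz] f.
  by rewrite shsums0; apply: shsum_ext => w; rewrite shsums0.
have E w d : shsum f (d :: w) (c :: z) = shsum (fun w => f (d :: w)) w (c :: z)
    + sg (size w).+1 *: shsum (fun w => f (c :: w)) (d :: w) z.
  exact: shsum_cons.
have E' w d : shsum f (a :: x) (d :: w) = shsum (fun w => f (a :: w)) x (d :: w)
    + sg (size x).+1 *: shsum (fun w => f (d :: w)) (a :: x) w.
  exact: shsum_cons.
rewrite shsum_cons (shsum_ext _ _ (E^~ a)) (shsum_ext _ _ (E^~ b)).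
rewrite [RHS]shsum_cons (shsum_ext _ _ (E'^~ b)) (shsum_ext _ _ (E'^~ c)).
rewrite !shsumD !(shsum_sizeZ _ _ _ (fun n => sg n.+1)) !shsumZ.
rewrite IHx IHy.
have -> : shsum (fun w => shsum (fun w0 => f (a :: w0)) x w) (b :: y) (c :: z) =
  shsum (fun w => shsum (fun w0 => f (a :: w0)) x (b :: w)) y (c :: z)
  + sg (size y).+1 *: shsum (fun w => shsum (fun w0 => f (a :: w0)) x (c :: w)) (b :: y) z.
  exact: shsum_cons.
have := IHz (fun w => f (c :: w)).
rewrite [X in X = _ -> _]shsum_cons => H.
rewrite -H /= /alt_sign /= !(oddD, oddS) /=.
case: (odd (size x)); case: (odd (size y)) => /=; lmod.
Qed.
End Shuffles.

(** * The Hochschild differential and shuffles *)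

Section BarChains.
Context (A : comNzRingType).
Implicit Types (a b : A) (x y z w : seq A) (c d : chain A).

Definition csize (n : nat) (c : chain A) := all (fun p => size p.2 == n) c.

Lemma csize_cat n c d : csize n (c ++ d) = csize n c && csize n d.
Proof. exact: all_cat. Qed.
Lemma csize_prepend n a c : csize n c -> csize n.+1 (prepend a c).
Proof. by rewrite /csize all_map. Qed.
Lemma csize_scale n r c : csize n c -> csize n (scale_chain r c).
Proof. by rewrite /csize all_map. Qed.

(** The end w = [::] encodes the last term of the Hochschild differential, in which
    the letter a acts on the coefficients; over a symmetric bimodule it fits in the
    same pattern as the product of a with the next letter. *)
Definition merge_chain a w : chain A :=
  if w is b :: w' then [:: (1, a * b :: w')] else [:: (a, [::])].

(** Up to sign, the Hochschild differential without its first term. *)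
Fixpoint dbar_chain w : chain A :=
  if w is a :: w' then merge_chain a w' ++ scale_chain (-1) (prepend a (dbar_chain w')) else [::].

Definition bar_chain w : chain A :=
  if w is a :: w' then (a, w') :: scale_chain (-1) (dbar_chain w) else [::].

Lemma csize_merge_chain a w : csize (size w) (merge_chain a w).
Proof. by case: w => [|b w]; rewrite /csize all_seq1. Qed.

Lemma csize_dbar_chain w : csize (size w).-1 (dbar_chain w).
Proof.
elim: w => // a w IH /=; rewrite csize_cat csize_merge_chain /=.
by case: w IH => // b w IH; apply/csize_scale/csize_prepend.
Qed.

Lemma csize_bar_chain w : csize (size w).-1 (bar_chain w).
Proof. by case: w => // a w; apply/andP; split=> //; apply/csize_scale/(csize_dbar_chain (a :: w)). Qed.

Section Functionals.
Context (M : lmodType A).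
Implicit Types (f g : seq A -> M).

Lemma ev_sizeE n f g c : csize n c -> (forall w, size w = n -> f w = g w) ->
  ev f c = ev g c.
Proof.
move=> /allP cn fg; apply: eq_big_seq => p /cn/eqP sp.
by rewrite fg.
Qed.

Lemma ev_sizeZ n (k : nat -> A) f c : csize n c ->
  ev (fun w => k (size w) *: f w) c = k n *: ev f c.
Proof. by move=> cn; rewrite -evZ; apply: ev_sizeE cn _ => w ->. Qed.

Definition merge a f w := ev f (merge_chain a w).
Definition dbar f w := ev f (dbar_chain w).
Definition bar f w := ev f (bar_chain w).

Lemma merge0 a f : merge a f [::] = a *: f [::].
Proof. by rewrite /merge /= ev_cons ev_nil addr0. Qed.
Lemma merge_cons a f b w : merge a f (b :: w) = f (a * b :: w).
Proof. by rewrite /merge /= ev_cons ev_nil addr0 scale1r. Qed.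
Lemma dbar_nil f : dbar f [::] = 0.
Proof. exact: ev_nil. Qed.
Lemma dbar_cons f a w : dbar f (a :: w) = merge a f w - dbar (fun w => f (a :: w)) w.
Proof. by rewrite /dbar /= ev_cat ev_scale scaleN1r ev_prepend. Qed.
Lemma bar_nil f : bar f [::] = 0.
Proof. exact: ev_nil. Qed.
Lemma bar_cons f a w : bar f (a :: w) = a *: f w - dbar f (a :: w).
Proof. by rewrite /bar /bar_chain ev_cons ev_scale scaleN1r. Qed.

Lemma dbar_ext f g : f =1 g -> dbar f =1 dbar g.
Proof. by move=> fg w; apply: ev_ext. Qed.

Lemma dbar_sizeZ (k : nat -> A) f w :
  dbar (fun w => k (size w) *: f w) w = k (size w).-1 *: dbar f w.
Proof. exact: ev_sizeZ (csize_dbar_chain w). Qed.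

Ltac lmod := lmod_with A M.

Lemma dbar_dbar f w : dbar (dbar f) w = 0.
Proof.
elim: w f => [|a w IH] f; first exact: dbar_nil.
rewrite dbar_cons [X in _ - X](_ : _ = dbar (merge a f) w - 0); last first.
  rewrite -(IH (fun w => f (a :: w))) -evN -evD; apply: dbar_ext => w'.
  exact: dbar_cons.
rewrite subr0; case: w {IH} => [|b w].
  by rewrite merge0 !dbar_nil scaler0 subr0.
rewrite merge_cons !dbar_cons [X in _ - (_ - X)](_ : _ = dbar (fun w => f (a * b :: w)) w).
  suff -> : merge b (merge a f) w = merge (a * b) f w by lmod.
  by case: w => [|e w]; rewrite ?merge0 ?merge_cons ?scalerA ?mulrA // mulrC.
by apply: dbar_ext => w'; rewrite merge_cons.
Qed.

Lemma bar_bar f w : bar (bar f) w = 0.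
Proof.
case: w => [|a w]; rewrite ?bar_nil // bar_cons dbar_cons.
have -> : dbar (fun w => bar f (a :: w)) w = a *: dbar f w - dbar (merge a f) w.
  rewrite -[a *: _]evZ -[in RHS]evN -evD.
  rewrite [LHS](@dbar_ext _ (fun w => (a *: f w - merge a f w) + dbar (fun w => f (a :: w)) w)).
    by rewrite [LHS]evD [X in _ + X](dbar_dbar (fun w => f (a :: w)) w) addr0.
  by move=> w'; rewrite bar_cons dbar_cons; lmod.
case: w => [|b w].
  by rewrite merge0 !bar_nil !dbar_nil; lmod.
rewrite merge_cons !bar_cons !dbar_cons.
rewrite [X in _ - (_ - (_ - (_ - X)))](_ : _ = dbar (fun w => f (a * b :: w)) w); last first.
  by apply: dbar_ext => w'; rewrite merge_cons.
suff -> : merge b (merge a f) w = merge (a * b) f w by lmod.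
by case: w => [|e w]; rewrite ?merge0 ?merge_cons ?scalerA ?mulrA // mulrC.
Qed.

Lemma shsum_mergel a f x b y : shsum (merge a f) x (b :: y) =
  (if x is a' :: x' then shsum (fun w => f (a * a' :: w)) x' (b :: y) else 0)
  + alt_sign A (size x) *: shsum (fun w => f (a * b :: w)) x y.
Proof.
case: x => [|a' x]; first by rewrite !shsum0s merge_cons scale1r add0r.
rewrite shsum_cons; congr (_ + _ *: _); apply: shsum_ext => w; exact: merge_cons.
Qed.

Lemma shsum_merger b f a x y : shsum (merge b f) (a :: x) y =
  shsum (fun w => f (b * a :: w)) x y + alt_sign A (size x).+1 *:
  (if y is b' :: y' then shsum (fun w => f (b * b' :: w)) (a :: x) y' else 0).
Proof.
case: y => [|b' y]; first by rewrite !shsums0 merge_cons scaler0 addr0.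
rewrite shsum_cons; congr (_ + _ *: _); apply: shsum_ext => w; exact: merge_cons.
Qed.

(** In a shuffle, two neighbours multiplied together come from the same factor,
    which gives the right hand side, or one from each; those cases occur in pairs
    of opposite signs since the algebra is commutative. *)
Lemma shsum_dbar f x y :
  shsum (dbar f) x y =
  dbar (fun x => shsum f x y) x + alt_sign A (size x) *: dbar (fun y => shsum f x y) y.
Proof.
elim: x y f => [|a x IHx] y f.
  rewrite shsum0s dbar_nil add0r scale1r; apply: dbar_ext => w; by rewrite shsum0s.
elim: y f => [|b y IHy] f.
  rewrite shsums0 dbar_nil scaler0 addr0; apply: dbar_ext => w; by rewrite shsums0.
rewrite shsum_cons.
rewrite (shsum_ext _ _ (dbar_cons f a)) (shsum_ext _ _ (dbar_cons f b)).
rewrite !shsumD !shsumN IHx IHy shsum_mergel shsum_merger.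
rewrite [X in _ = X + _]dbar_cons [X in _ = _ + _ *: X]dbar_cons.
rewrite [X in _ = _ - X + _](_ : _ = dbar (fun x => shsum (fun w => f (a :: w)) x (b :: y)) x
   + alt_sign A (size x) *: dbar (fun x => shsum (fun w => f (b :: w)) (a :: x) y) x); last first.
  rewrite /dbar [X in _ = _ + X](_ : _ =
    dbar (fun x => alt_sign A (size x).+1 *: shsum (fun w => f (b :: w)) (a :: x) y) x).
    by rewrite -evD; apply: ev_ext => w; rewrite shsum_cons.
  rewrite -/(dbar _ x) (dbar_sizeZ (fun n => alt_sign A n.+1)).
  by case: (x) => [|a' x']; rewrite ?dbar_nil ?scaler0.
rewrite [X in _ = _ + _ *: (_ - X)](_ : _ = dbar (fun y => shsum (fun w => f (a :: w)) x (b :: y)) y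
   + alt_sign A (size x).+1 *: dbar (fun y => shsum (fun w => f (b :: w)) (a :: x) y) y); last first.
  by rewrite -evZ -evD; apply: dbar_ext => w; rewrite shsum_cons.
rewrite [dbar (fun y => shsum (fun w => f (a :: w)) x y) (b :: y)]dbar_cons.
rewrite [dbar (fun x => shsum (fun w => f (b :: w)) x y) (a :: x)]dbar_cons.
rewrite [b * a]mulrC /alt_sign.
case: x {IHx IHy} => [|a' x]; last first.
  case: y => [|b' y];
  rewrite ?merge0 ?merge_cons ?shsum_cons ?dbar_nil ?shsum0s ?shsums0 /= /alt_sign /=;
  case: (odd (size x)) => /=; lmod.
case: y => [|b' y];
rewrite ?merge0 ?merge_cons ?shsum_cons ?dbar_nil ?shsum0s ?shsums0 /= /alt_sign /=; lmod.
Qed.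

Definition shuffle_free f := forall a x b y, shsum f (a :: x) (b :: y) = 0.

Lemma shuffle_free_shsum f x y : shuffle_free f -> x != [::] -> y != [::] -> shsum f x y = 0.
Proof. by case: x => // a x; case: y => // b y. Qed.

(** The first term of the differential and the part [dbar] are compared separately:
    by [shsum_dbar], the latter contributes only when one of the two words has a
    single letter, and then it cancels the former. *)
Lemma shuffle_free_bar f : shuffle_free f -> shuffle_free (bar f).
Proof.
move=> H a x b y; rewrite shsum_cons.
rewrite (shsum_ext _ _ (bar_cons f a)) (shsum_ext _ _ (bar_cons f b)) !shsumD !shsumZ !shsumN.
have := shsum_dbar f (a :: x) (b :: y); rewrite shsum_cons.
have -> : dbar (fun x => shsum f x (b :: y)) (a :: x) =
   if x is [::] then a *: f (b :: y) else 0.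
  rewrite -(shsum0s f (b :: y)); case: x => [|a' x].
    by rewrite dbar_cons merge0 dbar_nil subr0.
  rewrite [LHS](ev_sizeE (g := fun=> 0) (csize_dbar_chain _)) ?ev0 // => w sw.
  by apply: shuffle_free_shsum; rewrite // -size_eq0 sw.
have -> : dbar [eta shsum f (a :: x)] (b :: y) =
   if y is [::] then b *: f (a :: x) else 0.
  rewrite -(shsums0 f (a :: x)); case: y => [|b' y].
    by rewrite dbar_cons merge0 dbar_nil subr0.
  rewrite [LHS](ev_sizeE (g := fun=> 0) (csize_dbar_chain _)) ?ev0 // => w sw.
  by apply: shuffle_free_shsum; rewrite // -size_eq0 sw.
have E (u v p q r s : M) k : p + k *: q = r + k *: s -> u = r -> v = s ->
   (u - p) + k *: (v - q) = 0.
  by move=> e -> ->; rewrite scalerBr addrACA -opprD e subrr.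
move=> e; apply: E e _ _.
  by case: x => [|a' x]; rewrite ?shsum0s ?(shuffle_free_shsum H) ?scaler0.
by case: y => [|b' y]; rewrite ?shsums0 ?(shuffle_free_shsum H) ?scaler0.
Qed.
End Functionals.
End BarChains.

(** * Pinning a letter of a word *)

Section Pinning.
Context (A : comNzRingType) (M : lmodType A).
Implicit Types (a b c : A) (x y z w v q : seq A) (f g : seq A -> M).
Implicit Types (psi : A -> seq A -> M).
Local Notation sg := (@alt_sign A).
Local Notation eps := (@rev_sign A).
Ltac lmod := lmod_with A M.

(** The sum over the letters c of v of the values psi c on the shuffles of what
    follows c with the reversal of what precedes it; z holds the letters already
    passed, in reverse order. The sign is such that a function vanishing on shuffles
    is unchanged when the pinned letter is taken to the front
    ([shuffle_free_catrev]). *)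
Fixpoint pin psi z v : M :=
  if v is c :: q then eps (size z) *: shsum (psi c) z q + pin psi (c :: z) q else 0.

Lemma pin_ext psi phi : (forall c, psi c =1 phi c) -> forall z, pin psi z =1 pin phi z.
Proof.
by move=> e z v; elim: v z => //= c q IH z; rewrite IH (shsum_ext _ _ (e c)).
Qed.

Lemma pinD psi phi z v :
  pin (fun c w => psi c w + phi c w) z v = pin psi z v + pin phi z v.
Proof.
elim: v z => [|c q IH] z /=; first by rewrite addr0.
by rewrite shsumD IH; lmod.
Qed.

Lemma pinN psi z v : pin (fun c w => - psi c w) z v = - pin psi z v.
Proof.
elim: v z => [|c q IH] z /=; first by rewrite oppr0.
by rewrite shsumN IH; lmod.
Qed.

Section PinBar.
Context (psi : A -> seq A -> M) (mu : A -> A -> seq A -> M).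
Hypothesis psiM : forall c e w, psi (c * e) w = mu c e w + mu e c w.

(** The letter following c in the argument is the next letter of the word or, the prefix
    being reversed, the previous one. The products of c with these two neighbours are
    thus recovered from the two parts of psi (c * e) = mu c e + mu e c. *)
Definition mu_head c w := if w is e :: w' then mu c e w' else 0.

Lemma shsum_mu_head c z q : shsum (mu_head c) z q =
  (if z is a :: z' then shsum (mu c a) z' q else 0)
  + sg (size z) *: (if q is e :: q' then shsum (mu c e) z q' else 0).
Proof.
case: z => [|a z]; case: q => [|e q]; rewrite ?shsum_cons ?shsum0s ?shsums0 //=;
  rewrite ?scaler0 ?addr0 ?add0r ?scale1r //=.
Qed.

Definition pinned_bar c w := dbar (psi c) w - mu_head c w.

Definition pin_border z v := if v is c :: q then
    - (eps (size z) *: (if z is a :: z' then shsum (mu c a) z' q else 0))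
    + sg (size z) *: merge c (fun z => pin psi z q) z
  else 0.

(** The derivation property [shsum_dbar] turns the differential of psi c into the
    differential of the reversed prefix and that of the suffix. The products with
    the pinned letter itself are accounted for by [mu_head]; what is left is the
    product across the junction with z, gathered in [pin_border]. *)
Lemma pin_bar z v : pin pinned_bar z v =
  - (sg (size z) *: dbar (fun z => pin psi z v) z)
  - sg (size z) *: dbar (pin psi z) v + pin_border z v.
Proof.
elim: v z => [|c q IH] z.
  rewrite dbar_nil /= /dbar ev0; lmod.
rewrite [LHS]/= /pinned_bar shsumD shsumN shsum_dbar shsum_mu_head IH.
have -> : dbar (fun z => pin psi z (c :: q)) z =
   eps (size z).-1 *: dbar (fun z => shsum (psi c) z q) z + dbar (fun z => pin psi (c :: z) q) z.
  by rewrite -dbar_sizeZ -evD.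
rewrite [dbar _ (c :: z)]dbar_cons [dbar _ (c :: q)]dbar_cons.
have -> : dbar (fun w => pin psi z (c :: w)) q =
   eps (size z) *: dbar (shsum (psi c) z) q + dbar (pin psi (c :: z)) q.
  by rewrite -evZ -evD.
have Es : sg (size z).+1 = - sg (size z).
  by rewrite /alt_sign /=; case: (odd _); rewrite ?opprK.
have ss : sg (size z) * sg (size z) = 1.
  by rewrite /alt_sign; case: (odd _); rewrite ?mulrNN mulr1.
have Ez : eps (size z).-1 *: dbar ((shsum (psi c))^~ q) z =
     - (sg (size z) * eps (size z)) *: dbar ((shsum (psi c))^~ q) z.
  case: (z) => [|a z']; first by rewrite dbar_nil !scaler0.
  rewrite /= rev_signS /alt_sign /=; congr (_ *: _); case: (odd _) => /=; ring.
rewrite Ez.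
case: q {IH Ez} => [|e q]; rewrite /= Es.
  rewrite !merge0 /= !dbar_nil; lmod; ring: ss.
rewrite !merge_cons /= [e * c]mulrC rev_signS.
rewrite (shsum_ext _ _ (psiM c e)) shsumD.
lmod; ring: ss.
Qed.
End PinBar.

Lemma rev_sign_add m n : eps (m + n) = sg (m * n) * (eps m * eps n).
Proof.
elim: m => [|m IH]; first by rewrite add0n mul0n !mul1r.
rewrite addSn !rev_signS IH mulSn /alt_sign !oddD.
by case: (odd m); case: (odd n); case: (odd _) => /=; ring.
Qed.

Lemma rev_sign_sq n : eps n * eps n = 1.
Proof. by rewrite /rev_sign /alt_sign; case: odd; rewrite ?mulrNN mulr1. Qed.

(** When the pinned letter is in x, the letters of y are cut in all ways into a
    part before it, which gets reversed, and a part after it. The alternating sum of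
    the shuffles of the reversed part with the other one telescopes, as in the
    antipode identity of the shuffle algebra; the terms that remain have y entirely
    on the far side of the letter z0. *)
Lemma shsum_pin psi (z0 : A) z x y :
  shsum (pin psi (z0 :: z)) x y =
    (sg (((size z).+1 + size x) * size y) * eps (size y).+1) *:
       shsum (fun w => pin psi (z0 :: w) x) z y
  + (sg ((size z).+1 * size x) * eps (size x).+1) *:
       shsum (fun w => pin psi (z0 :: w) y) z x.
Proof.
elim: x y z0 z => [|a x IHx] y z0 z.
  by rewrite shsum0s shsums0 /= shsum0 muln0 /rev_sign /alt_sign /=; lmod.
elim: y z0 z => [|b y IHy] z0 z.
  by rewrite !shsums0 /= shsum0 muln0 /rev_sign /alt_sign /=; lmod.
rewrite shsum_cons /= !shsumD !shsumZ IHx IHy /= !shsumD.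
have Ea : shsum (shsum (psi a) (z0 :: z)) x (b :: y) =
   sg (size x * (size y).+1) *: (shsum (fun w => shsum (psi a) (z0 :: w) x) z (b :: y)
   + sg (size z).+1 *: shsum (fun w => shsum (psi a) (b :: w) x) (z0 :: z) y).
  by rewrite shsumC -shsumA shsum_cons.
have Eb : shsum (shsum (psi b) (z0 :: z)) (a :: x) y =
   shsum (fun w => shsum (psi b) (z0 :: w) y) z (a :: x)
   + sg (size z).+1 *: shsum (fun w => shsum (psi b) (a :: w) y) (z0 :: z) x.
  by rewrite -shsumA shsum_cons.
rewrite Ea Eb !(shsum_sizeZ _ _ _ (fun n => eps n.+1)) !shsum_cons /=.
rewrite ?(addSn, addnS) !rev_signS /= !rev_sign_add.
have := rev_sign_sq (size x); have := rev_sign_sq (size y); have := rev_sign_sq (size z).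
move: (eps (size x)) (eps (size y)) (eps (size z)) => ex ey ez hz hy hx.
rewrite /alt_sign /= !(mulnS, mulSn, oddD, oddM, oddS) /=.
case: (odd (size x)); case: (odd (size y)); case: (odd (size z)) => /=; lmod; ring: hx hy hz.
Qed.

(** Whatever psi is: once the words are cut by [shsum_pin], each term occurs twice, with
    opposite signs. *)
Lemma shuffle_free_pin psi : shuffle_free (pin psi [::]).
Proof.
have E c w : pin psi [::] (c :: w) = psi c w + pin psi [:: c] w.
  by rewrite /= shsum0s /rev_sign /alt_sign /= scale1r.
move=> a x b y; rewrite shsum_cons (shsum_ext _ _ (E a)) (shsum_ext _ _ (E b)) !shsumD.
rewrite !shsum_pin !shsum0s /= [shsum (psi a) (b :: y) x]shsumC [shsum (psi b) (a :: x) y]shsumC.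
rewrite [shsum (psi b) y (a :: x)]shsumC.
rewrite !rev_signS.
have := rev_sign_sq (size x); have := rev_sign_sq (size y).
move: (eps (size x)) (eps (size y)) => ex ey hy hx.
rewrite /alt_sign /= !(mul1n, add1n, mulnS, mulSn, oddD, oddM, oddS) /=.
case: (odd (size x)); case: (odd (size y)) => /=; lmod; ring: hx hy.
Qed.
End Pinning.

(** * Operators acting on one letter at a time *)

Section Local.
Context (A : comNzRingType).
Implicit Types (x y z w q v : seq A) (beta : A -> seq (A * A)).

(** The operator replacing one letter a by the tensor beta a, whose left factor acts
    on the value. *)
Fixpoint letters_chain beta w : chain A :=
  if w is a :: w' then [seq (p.1, p.2 :: w') | p <- beta a] ++ prepend a (letters_chain beta w')
  else [::].

Context (M : lmodType A).
Implicit Types (f : seq A -> M).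
Ltac lmod := lmod_with A M.

Definition letters beta f w := ev f (letters_chain beta w).

Lemma letters_nil beta f : letters beta f [::] = 0. Proof. exact: ev_nil. Qed.

Lemma letters_cons beta f a w : letters beta f (a :: w) =
  \sum_(p <- beta a) p.1 *: f (p.2 :: w) + letters beta (fun w => f (a :: w)) w.
Proof. by rewrite /letters /= ev_cat ev_prepend /ev big_map. Qed.

Lemma letters_ext beta f g : f =1 g -> letters beta f =1 letters beta g.
Proof. by move=> fg w; apply: ev_ext. Qed.

Lemma csize_letters_chain beta w : csize (size w) (letters_chain beta w).
Proof.
elim: w => // a w IH; rewrite csize_cat csize_prepend // andbT /csize all_map.
by apply/allP => p _ /=.
Qed.

Lemma letters_sizeZ beta (k : nat -> A) f w :
  letters beta (fun w => k (size w) *: f w) w = k (size w) *: letters beta f w.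
Proof. exact: ev_sizeZ (csize_letters_chain _ _). Qed.

Lemma lettersD beta f g w : letters beta (fun w => f w + g w) w = letters beta f w + letters beta g w.
Proof. exact: evD. Qed.

Lemma shsum_letters beta f x y :
  shsum (letters beta f) x y = letters beta (fun x => shsum f x y) x + letters beta (shsum f x) y.
Proof.
elim: x y f => [|a x IHx] y f.
  by rewrite shsum0s letters_nil add0r; apply: letters_ext => w; rewrite shsum0s.
elim: y f => [|b y IHy] f.
  by rewrite shsums0 letters_nil addr0; apply: letters_ext => w; rewrite shsums0.
rewrite shsum_cons (shsum_ext _ _ (letters_cons beta f a)) (shsum_ext _ _ (letters_cons beta f b)).
rewrite !shsumD IHx IHy [X in _ = X + _]letters_cons [X in _ = _ + X]letters_cons.
have shsum_big I (r : seq I) c (F : I -> seq A -> M) x' y' :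
   shsum (fun w => \sum_(p <- r) c p *: F p w) x' y' = \sum_(p <- r) c p *: shsum (F p) x' y'.
  by rewrite /shsum ev_sum; apply: eq_bigr => p _; rewrite evZ.
rewrite !shsum_big.
under [X in _ = X + _ + _]eq_bigr => p _ do rewrite shsum_cons scalerDr.
under [X in _ = _ + (X + _)]eq_bigr => p _ do rewrite shsum_cons scalerDr.
rewrite !big_split /=.
rewrite [X in _ = _ + X + _](_ : _ = letters beta (fun x => shsum (fun w => f (a :: w)) x (b :: y)) x
   + alt_sign A (size x).+1 *: letters beta (fun x => shsum (fun w => f (b :: w)) (a :: x) y) x); last first.
  rewrite -(letters_sizeZ beta (fun n => alt_sign A n.+1)) -lettersD.
  by apply: letters_ext => w; rewrite shsum_cons.
rewrite [X in _ = _ + (_ + X)](_ : _ = letters beta (fun y => shsum (fun w => f (a :: w)) x (b :: y)) y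
   + alt_sign A (size x).+1 *: letters beta (fun y => shsum (fun w => f (b :: w)) (a :: x) y) y); last first.
  by rewrite -evZ -lettersD; apply: letters_ext => w; rewrite shsum_cons.
rewrite [letters _ (fun y => shsum (fun w => f (a :: w)) x y) (b :: y)]letters_cons.
rewrite [letters _ (fun x => shsum (fun w => f (b :: w)) x y) (a :: x)]letters_cons.
under [X in _ = _ + _ + (_ + X + _)]eq_bigr => p _ do rewrite scalerA mulrC -scalerA.
under [X in _ = _ + X + _ + _]eq_bigr => p _ do rewrite scalerA mulrC -scalerA.
rewrite -!scaler_sumr; lmod.
Qed.

(** The words z and a :: q shuffled give 0; the words beginning with a form the right
    hand side, and induction on z handles those beginning with a letter of z. *)
Lemma shuffle_free_catrev f a z q : shuffle_free f ->
  f (catrev z (a :: q)) = rev_sign A (size z) *: shsum (fun w => f (a :: w)) z q.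
Proof.
move=> H; elim: z a q => [|c z IH] a q; first by rewrite shsum0s scale1r.
rewrite /= IH rev_signS mulrC -scalerA; congr (_ *: _).
have := H c z a q; rewrite shsum_cons /= /alt_sign /=; case: (odd _) => /= /eqP.
  by rewrite scale1r addr_eq0 scaleN1r => /eqP.
by rewrite scaleN1r subr_eq0 scale1r => /eqP.
Qed.

(** Bringing each letter to the front by [shuffle_free_catrev] turns a sum over
    pinned letters into an operator acting on one letter at a time. *)
Lemma pin_letters beta f z q : shuffle_free f ->
  pin (fun c w => \sum_(p <- beta c) p.1 *: f (p.2 :: w)) z q =
  letters beta (fun q => f (catrev z q)) q.
Proof.
move=> H; elim: q z => [|c q IH] z /=; first by rewrite letters_nil.
rewrite IH letters_cons; congr (_ + _).
rewrite /shsum ev_sum scaler_sumr; apply: eq_bigr => p _.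
rewrite evZ (shuffle_free_catrev _ _ _ H) !scalerA mulrC //.
Qed.
End Local.

(** * Multilinearity and the derivation *)

Section Multilinear.
Context (F : fieldType) (A : comAlgType F) (M : lmodType A).
Implicit Types (a b : A) (p q x y z w v : seq A) (f : seq A -> M) (k : F).
Implicit Types (psi : A -> seq A -> M).
Ltac lmod := lmod_with A M.

Definition multilin f := forall p q k a b,
  f (p ++ (k *: a + b) :: q) = k%:A *: f (p ++ a :: q) + f (p ++ b :: q).

Lemma multilin_cons f a : multilin f -> multilin (fun w => f (a :: w)).
Proof. by move=> H p q k b c; apply: (H (a :: p)). Qed.

Lemma multilin_head f : multilin f -> forall k a b q,
  f ((k *: a + b) :: q) = k%:A *: f (a :: q) + f (b :: q).
Proof. by move=> H k a b q; apply: (H [::]). Qed.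

Lemma multilin_merge a f : multilin f -> multilin (merge a f).
Proof.
move=> H [|e p] q k b c /=; rewrite !merge_cons; last exact: (H (_ :: p)).
by rewrite mulrDr -scalerAr multilin_head.
Qed.

Lemma merge_linear f k a b w : multilin f ->
  merge (k *: a + b) f w = k%:A *: merge a f w + merge b f w.
Proof.
move=> H; case: w => [|e w].
  by rewrite !merge0 scalerDl -[k *: a]mulr_algl scalerA.
by rewrite !merge_cons mulrDl -scalerAl multilin_head.
Qed.

Lemma multilin_dbar f : multilin f -> multilin (dbar f).
Proof.
move=> H p; elim: p f H => [|e p IH] f H q k b c /=; rewrite !dbar_cons.
  rewrite (merge_linear _ _ _ _ H).
  rewrite (dbar_ext (g := fun w => k%:A *: f (b :: w) + f (c :: w))).
    by rewrite [X in _ - X]evD evZ /dbar; lmod.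
  by move=> w; apply: multilin_head.
by rewrite (multilin_merge _ H) IH; [lmod|apply: multilin_cons].
Qed.

Lemma multilin_bar f : multilin f -> multilin (bar f).
Proof.
move=> H [|e p] q k b c; rewrite /= !bar_cons.
  rewrite (multilin_dbar H [::]) scalerDl -[X in X *: _]mulr_algl -scalerA.
  by rewrite /=; lmod.
by rewrite (multilin_dbar H (e :: p)) H /=; lmod.
Qed.

Lemma multilin_shsuml f y : multilin f -> multilin (fun x => shsum f x y).
Proof.
elim: y f => [|e y IHy] f H p q k a b; first by rewrite !shsums0.
elim: p f H => [|c p IHp] f H /=; rewrite !shsum_cons.
  rewrite (shsum_ext (g := fun w => k%:A *: f (a :: w) + f (b :: w))).
    by rewrite shsumD shsumZ (IHy _ (multilin_cons _ H) [::]); lmod.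
  by move=> w; apply: multilin_head.
rewrite IHp; last exact: multilin_cons.
rewrite (IHy _ (multilin_cons _ H) (c :: p)) !size_cat /=; lmod.
Qed.

Lemma multilin_shsumr f x : multilin f -> multilin (shsum f x).
Proof.
move=> H p q k a b.
by rewrite !(shsumC f x) (multilin_shsuml x H) !size_cat /=; lmod.
Qed.

Lemma multilin_pinl psi v : (forall c, multilin (psi c)) -> multilin (fun z => pin psi z v).
Proof.
move=> H; elim: v => [|c v IH] p q k a b /=; first by rewrite scaler0 addr0.
by rewrite (multilin_shsuml v (H c)) (IH (c :: p)) !size_cat /=; lmod.
Qed.

Lemma multilin_pin psi z : (forall c, multilin (psi c)) ->
  (forall k a b w, psi (k *: a + b) w = k%:A *: psi a w + psi b w) ->
  multilin (pin psi z).
Proof.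
move=> H L p q k a b; elim: p z => [|c p IH] z /=.
  rewrite (shsum_ext _ _ (L k a b)) shsumD shsumZ.
  by rewrite (multilin_pinl q H [::]); lmod.
by rewrite (multilin_shsumr z (H c)) IH; lmod.
Qed.

Section Derivation.
Context (D : {linear A -> A}).
Hypothesis DM : forall a b, D (a * b) = D a * b + a * D b.

Lemma der1 : D 1 = 0.
Proof.
have := DM 1 1; rewrite !mulr1 mul1r => /eqP.
by rewrite -subr_eq0 opprD addNKr oppr_eq0 => /eqP.
Qed.

Lemma der_alt_sign n : D (alt_sign A n) = 0.
Proof. by rewrite /alt_sign; case: odd; rewrite ?linearN /= der1 ?oppr0. Qed.

(** The operator [letters der_letter] is the action of the derivation on tensors,
    which the sesquilinearity conditions equate with -Lambda_t. *)
Definition der_letter a : seq (A * A) := [:: (1, D a)].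
Local Notation lD := (letters der_letter).

Lemma letters_der_cons f a w : lD f (a :: w) = f (D a :: w) + lD (fun w => f (a :: w)) w.
Proof. by rewrite letters_cons big_seq1 scale1r. Qed.

(** The terms by which an operator given by chains fails to commute with the
    derivation: the derivatives of the coefficients of the chain. *)
Definition der_coefs f (c : chain A) := \sum_(p <- c) D p.1 *: f p.2.

Lemma der_coefs_cat f c d : der_coefs f (c ++ d) = der_coefs f c + der_coefs f d.
Proof. exact: big_cat. Qed.

Lemma der_coefs_opp f c : der_coefs f (scale_chain (-1) c) = - der_coefs f c.
Proof.
rewrite /der_coefs big_map -sumrN; apply: eq_bigr => p _ /=.
by rewrite mulN1r linearN scaleNr.
Qed.

Lemma der_coefs_prepend f a c : der_coefs f (prepend a c) = der_coefs (fun w => f (a :: w)) c.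
Proof. exact: big_map. Qed.

Lemma multilinD f a b q : multilin f -> f ((a + b) :: q) = f (a :: q) + f (b :: q).
Proof. by move=> /multilin_head H; have := H 1 a b q; rewrite scale1r !scale1r. Qed.

Lemma multilin0 f p q : multilin f -> f (p ++ 0 :: q) = 0.
Proof.
move=> H; have := H p q 1 0 0; rewrite !scale1r addr0 => /eqP.
by rewrite -subr_eq0 opprD addNKr oppr_eq0 => /eqP.
Qed.

(** The derivation passes through products of letters by the Leibniz rule; in the last
    term it also meets the coefficient, and this is corrected by [der_coefs]. *)
Lemma letters_der_dbar f w : multilin f -> lD (dbar f) w = dbar (lD f) w + der_coefs f (dbar_chain w).
Proof.
elim: w f => [|a w IH] f H.
  by rewrite letters_nil dbar_nil /der_coefs big_nil addr0.
rewrite letters_der_cons [dbar f (D a :: w)]dbar_cons [dbar _ (a :: w)]dbar_cons /=.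
rewrite der_coefs_cat der_coefs_opp der_coefs_prepend.
rewrite (letters_ext _ (dbar_cons f a)) /letters evD evN -!/(letters der_letter _ _).
rewrite IH; last exact: multilin_cons.
rewrite (dbar_ext (f := fun w => lD f (a :: w))
  (g := fun w => f (D a :: w) + lD (fun w => f (a :: w)) w)); last first.
  by move=> w'; rewrite letters_der_cons.
rewrite [X in _ = _ - X + _]evD.
suff E : merge (D a) f w + lD (merge a f) w = merge a (lD f) w + der_coefs f (merge_chain a w).
  by rewrite /letters /dbar in E *; move: E; set u := merge _ _ _; move=> /(canRL (addrK _)) ->; lmod.
case: w {IH} => [|b w]; rewrite /der_coefs /= big_seq1 /=.
  by rewrite !merge0 !letters_nil scaler0 addr0 add0r.
rewrite der1 scale0r addr0 !merge_cons !letters_der_cons merge_cons DM multilinD // -addrA; congr (_ + (_ + _)).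
by apply: letters_ext => w'; rewrite merge_cons.
Qed.

Lemma letters_der_bar f w : multilin f -> lD (bar f) w = bar (lD f) w + der_coefs f (bar_chain w).
Proof.
move=> H; case: w => [|a w].
  by rewrite letters_nil bar_nil /der_coefs big_nil addr0.
rewrite letters_der_cons (letters_ext _ (bar_cons f a)) !bar_cons.
have := letters_der_dbar (a :: w) H; rewrite letters_der_cons => /(canRL (addKr _)) E.
rewrite /letters evD evN evZ -!/(letters der_letter _ _) E /bar_chain /der_coefs big_cons -!/(der_coefs _ _) der_coefs_opp.
lmod.
Qed.

Lemma letters_der_pin psi z v : (forall c, multilin (psi c)) ->
   (forall k a b w, psi (k *: a + b) w = k%:A *: psi a w + psi b w) ->
  lD (fun z => pin psi z v) z + lD (pin psi z) v
  = pin (fun c w => psi (D c) w + lD (psi c) w) z v.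
Proof.
move=> H L; elim: v z => [|c v IH] z.
  by rewrite letters_nil addr0 /= /letters ev0.
rewrite [RHS]/= shsumD shsum_letters -IH !letters_der_cons.
rewrite (letters_ext der_letter (f := fun z => pin psi z (c :: v))
  (g := fun z => rev_sign A (size z) *: shsum (psi c) z v + pin psi (c :: z) v)) //.
rewrite lettersD letters_sizeZ.
rewrite (letters_ext der_letter (f := fun v => pin psi z (c :: v))
  (g := fun v => rev_sign A (size z) *: shsum (psi c) z v + pin psi (c :: z) v)) //.
rewrite lettersD.
have -> : lD (fun v => rev_sign A (size z) *: shsum (psi c) z v) v =
  rev_sign A (size z) *: lD (shsum (psi c) z) v by exact: evZ.
rewrite /=; lmod.
Qed.

(** * The contraction and its homotopy formula *)

Definition tensor_sum (B : A -> A -> M) (s : seq (A * A)) := \sum_(p <- s) B p.1 p.2.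

(** The scalars of the base field act through the algebra, since the values are in a
    module over the algebra. *)
Definition bilinear (B : A -> A -> M) :=
  (forall k a b (y : A), B (k *: a + b) y = k%:A *: B a y + B b y) /\
  (forall (x : A) k a b, B x (k *: a + b) = k%:A *: B x a + B x b).

(* The polarization of a is sum_x x (x) da/dx, the sum being over the variables x.
   Only its values under bilinear maps are used, for which the hypotheses say
   that it is linear, a derivation, and compatible with the derivation D. *)
Context (pol : A -> seq (A * A)).
Hypothesis polL : forall B k a b, bilinear B ->
  tensor_sum B (pol (k *: a + b)) = k%:A *: tensor_sum B (pol a) + tensor_sum B (pol b).
Hypothesis polM : forall B a b, bilinear B ->
  tensor_sum B (pol (a * b)) = tensor_sum (fun x y : A => B x (y * b)) (pol a)
                       + tensor_sum (fun x y : A => B x (y * a)) (pol b).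
Hypothesis polD : forall B a, bilinear B ->
  tensor_sum B (pol (D a)) = tensor_sum (fun x y : A => B (D x) y + B x (D y)) (pol a).

Definition split_pinned f c w := tensor_sum (fun x y : A => f (x :: y :: w)) (pol c).

Fixpoint pin_chain z v : chain A :=
  if v is c :: q then
    scale_chain (rev_sign A (size z))
      (flatten [seq [seq (u.1, xy.1 :: xy.2 :: u.2) | u <- shuffle z q] | xy <- pol c])
    ++ pin_chain (c :: z) q
  else [::].

(** On one-letter words, the value a f(1, 1) is added to the contraction. It makes the
    homotopy formula multiply by 1 the values on the words (1) and (1, 1), which
    have no variables. *)
Definition contr_chain v : chain A :=
  scale_chain (-1) (pin_chain [::] v) ++ (if v is [:: a] then [:: (a, [:: 1; 1])] else [::]).

Definition contr f v := ev f (contr_chain v).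

Definition unit_part f v := if v is [:: a] then a *: f [:: 1; 1] else 0.

Lemma ev_pin_chain f z v : ev f (pin_chain z v) = pin (split_pinned f) z v.
Proof.
elim: v z => [|c v IH] z /=; first exact: ev_nil.
rewrite ev_cat ev_scale IH; congr (_ *: _ + _).
rewrite /ev big_flatten big_map /shsum ev_sum; apply: eq_bigr => xy _.
by rewrite big_map.
Qed.

Lemma contrE f v : contr f v = - pin (split_pinned f) [::] v + unit_part f v.
Proof.
rewrite /contr ev_cat ev_scale scaleN1r ev_pin_chain; congr (_ + _).
by case: v => [|a [|b v]]; rewrite ?ev_nil //= ev_cons ev_nil addr0.
Qed.

Lemma csize_shuffle x y : csize (size x + size y) (shuffle x y).
Proof.
elim: x y => [|a x IHx] y; first by rewrite /csize all_seq1.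
elim: y => [|b y IHy]; first by rewrite /csize all_seq1 addn0.
rewrite [shuffle _ _]/= csize_cat csize_prepend ?IHx // andTb.
by rewrite [(_ + size (b :: y))%N]addnS csize_scale ?csize_prepend.
Qed.

Lemma csize_contr_chain v : csize (size v).+1 (contr_chain v).
Proof.
rewrite csize_cat; apply/andP; split; last by case: v => [|a []].
apply: csize_scale; rewrite -[size v]/(size (Nil A) + size v)%N.
elim: v [::] => // c v IH z /=; rewrite csize_cat addnS -addSn -[(size z).+1]/(size (c :: z)).
rewrite IH andbT; apply: csize_scale; rewrite /csize.
elim: (pol c) => //= xy s IHs; rewrite all_cat IHs andbT all_map.
apply: sub_all (csize_shuffle z v) => p /= /eqP->; by rewrite addSn.
Qed.

Lemma bilinear_two_letters f w : multilin f -> bilinear (fun x y : A => f (x :: y :: w)).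
Proof.
move=> H; split=> [k a b y|x k a b]; first exact: multilin_head.
exact: multilin_head (multilin_cons _ H) _ _ _ _.
Qed.

Lemma split_pinnedL f k a b w : multilin f ->
  split_pinned f (k *: a + b) w = k%:A *: split_pinned f a w + split_pinned f b w.
Proof. by move=> H; apply/polL/bilinear_two_letters. Qed.

Lemma multilin_split_pinned f c : multilin f -> multilin (split_pinned f c).
Proof.
move=> H p q k a b; rewrite /split_pinned /tensor_sum scaler_sumr -big_split.
by apply: eq_bigr => xy _; apply: (H (_ :: _ :: p)).
Qed.

Lemma multilin_contr f : multilin f -> multilin (contr f).
Proof.
move=> H p q k a b; rewrite !contrE.
rewrite multilin_pin; last 2 first.
- by move=> c; apply: multilin_split_pinned.
- by move=> *; apply: split_pinnedL.
have -> : unit_part f (p ++ (k *: a + b) :: q) =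
  k%:A *: unit_part f (p ++ a :: q) + unit_part f (p ++ b :: q).
  case: p => [|c [|c' p]] /=; [|by rewrite scaler0 addr0..].
  by case: q => [|d q]; rewrite ?scaler0 ?addr0 // scalerDl -[k *: a]mulr_algl -scalerA.
lmod.
Qed.

(** The added term is concerned with one-letter words only, and a shuffle of two
    nonempty words has at least two letters. *)
Lemma shuffle_free_contr f : shuffle_free (contr f).
Proof.
move=> a x b y; rewrite (shsum_ext _ _ (contrE f)) shsumD shsumN shuffle_free_pin oppr0 add0r.
rewrite -[RHS](shsum0 M (a :: x) (b :: y)); apply: shsum_sizeE => -[|c [|d w]] //=.
by rewrite addnS.
Qed.

Lemma der_coefs_pin_chain f z v : der_coefs f (pin_chain z v) = 0.
Proof.
elim: v z => [|c v IH] z /=; first exact: big_nil.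
rewrite der_coefs_cat IH addr0 /der_coefs big_map big_flatten big_map big1 // => xy _.
rewrite big_map big_seq big1 // => p pS /=.
suff: D (rev_sign A (size z) * p.1) = 0 by move=> ->; rewrite scale0r.
rewrite DM der_alt_sign mul0r add0r.
suff -> : D p.1 = 0 by rewrite mulr0.
elim: z v p pS {IH} => [|a z IHz] v p; first by rewrite inE => /eqP->; apply: der1.
elim: v p => [|b v IHv] p; first by rewrite inE => /eqP->; apply: der1.
rewrite [shuffle _ _]/= mem_cat => /orP[] /mapP[p' pS ->] /=; first exact: IHz pS.
rewrite DM der_alt_sign mul0r add0r; case/mapP: pS => p'' pS -> /=.
by rewrite (IHv _ pS) mulr0.
Qed.

Lemma letters_der_contr f w : multilin f ->
  lD (contr f) w = contr (lD f) w + der_coefs f (contr_chain w).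
Proof.
move=> H; rewrite (letters_ext _ (contrE f)) lettersD contrE.
rewrite der_coefs_cat der_coefs_opp der_coefs_pin_chain oppr0 add0r.
have -> : lD (fun v => - pin (split_pinned f) [::] v) w =
   - pin (split_pinned (lD f)) [::] w.
  rewrite {1}/letters evN; congr (- _).
  transitivity (lD (fun z => pin (split_pinned f) z w) [::] + lD (pin (split_pinned f) [::]) w).
    by rewrite letters_nil add0r.
  rewrite letters_der_pin; last 2 first.
  - by move=> c; apply: multilin_split_pinned.
  - by move=> *; apply: split_pinnedL.
  apply: pin_ext => c w'; rewrite /split_pinned polD; last exact: bilinear_two_letters.
  rewrite /tensor_sum [X in _ + X]ev_sum -big_split; apply: eq_bigr => xy _ /=.
  by rewrite !letters_der_cons addrA.
rewrite -addrA; congr (_ + _); case: w => [|a [|b w]].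
- by rewrite letters_nil /der_coefs big_nil addr0.
- rewrite letters_der_cons letters_nil addr0 /der_coefs big_seq1 /= !letters_der_cons.
  by rewrite letters_nil der1 (multilin0 [::] _ H) (multilin0 [:: 1] _ H); lmod.
rewrite letters_der_cons letters_der_cons /= /der_coefs big_nil !add0r; exact: ev0.
Qed.

(** The tensor of the operator sum_x (L_(x d/dx) - x L_(d/dx)), where L_X replaces
    a letter by its image under the vector field X. *)
Definition euler c : seq (A * A) :=
  flatten [seq [:: (1, xy.1 * xy.2); (- xy.1, xy.2)] | xy <- pol c].

(** The sum subtracted on one-letter words is the projection onto vector fields: the
    cocycle a |-> sum_x f(x) da/dx is out of reach of any contraction. The remaining
    corrections come from the term added to the contraction. *)
Definition contr_laplacian f w := letters euler f w
  + (if w is [:: a] then a *: f [:: 1] - tensor_sum (fun x y : A => y *: f [:: x]) (pol a) else 0)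
  + (if w is [:: a; b] then (a * b) *: f [:: 1; 1] else 0).

Lemma pin_bar_nil psi mu w :
  (forall c e w, psi (c * e) w = mu c e w + mu e c w) ->
  pin (pinned_bar psi mu) [::] w = bar (pin psi [::]) w.
Proof.
move=> psiM; rewrite (pin_bar psiM) dbar_nil.
case: w => [|c q]; first by rewrite bar_nil dbar_nil /=; lmod.
rewrite bar_cons [pin_border _ _ _ _]/= merge0 /alt_sign /=; lmod.
Qed.

Lemma pin_short (r : A -> M) w :
  pin (fun c w => if w is [::] then r c else 0) [::] w =
  if w is [:: a] then r a else 0.
Proof.
have E z v : z != [::] -> pin (fun c w => if w is [::] then r c else 0) z v = 0.
  elim: v z => [|c q IH] z zN //=; rewrite IH // addr0.
  rewrite (shsum_sizeE (g := fun=> 0)) ?shsum0 ?scaler0 // => -[|//] /eqP.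
  by case: z zN.
case: w => [|a w] //=; rewrite E // addr0 shsum0s scale1r.
by case: w.
Qed.

Lemma bar_unit_part f w :
  bar (unit_part f) w = if w is [:: a; b] then (a * b) *: f [:: 1; 1] else 0.
Proof.
case: w => [|a [|b [|c w]]]; first exact: bar_nil.
- by rewrite bar_cons dbar_cons merge0 dbar_nil /=; lmod.
- by rewrite bar_cons !dbar_cons merge_cons merge0 dbar_nil /=; lmod.
rewrite [LHS](ev_sizeE (g := fun=> 0) (csize_bar_chain _)) ?ev0 //.
by case=> [|d [|e v]].
Qed.

(** In h b f, the pinned letter split into x and y gives rise to the products x y and y e,
    and to the first term x f(y, ..). The products y e with a following letter form
    [mu_head], so that by [pin_bar_nil] they combine with the other products into
    - b h f. The first term and the product x y form [euler], which [pin_letters]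
    turns into an operator acting letter by letter. *)
Lemma homotopy f w : multilin f -> shuffle_free f ->
  bar (contr f) w + contr (bar f) w = contr_laplacian f w.
Proof.
move=> L H.
pose mu c e w := tensor_sum (fun x y : A => f (x :: y * e :: w)) (pol c).
have psiM c e v : split_pinned f (c * e) v = mu c e v + mu e c v.
  exact/polM/bilinear_two_letters.
pose r c := tensor_sum (fun x y : A => y *: f [:: x]) (pol c).
have split_pinned_bar c v : split_pinned (bar f) c v =
  - \sum_(p <- euler c) p.1 *: f (p.2 :: v)
  - pinned_bar (split_pinned f) mu c v
  + (if v is [::] then r c else 0).
  rewrite /pinned_bar /split_pinned /tensor_sum /euler [X in _ - (X - _)]ev_sum.
  rewrite big_flatten big_map.
  have shift (u1 u2 u3 u4 : M) : - u1 - (u2 - u3) + u4 = u3 + u4 + (- u1 - u2).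
    by lmod.
  rewrite shift -!sumrN.
  have -> : mu_head mu c v + (if v is [::] then r c else 0) =
     \sum_(xy <- pol c) merge xy.2 (fun w => f (xy.1 :: w)) v.
    case: v => [|e v] /=; rewrite ?add0r ?addr0; apply: eq_bigr => xy _.
      by rewrite merge0.
    by rewrite merge_cons.
  rewrite -!big_split; apply: eq_bigr => xy _ /=.
  rewrite big_cons big_seq1 /= bar_cons dbar_cons merge_cons dbar_cons /dbar; lmod.
rewrite (contrE (bar f)) (pin_ext split_pinned_bar) !pinD !pinN pin_bar_nil // pin_short.
rewrite (pin_letters euler) // -/(unit_part _ _).
have -> : bar (contr f) w = - bar (pin (split_pinned f) [::]) w + bar (unit_part f) w.
  by rewrite -evN -evD; apply: ev_ext => v; rewrite contrE.
rewrite bar_unit_part /contr_laplacian /r.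
case: w => [|a [|b w]] /=.
- by lmod.
- have -> : bar f [:: 1; 1] = f [:: 1].
    by rewrite bar_cons !dbar_cons merge_cons merge0 dbar_nil mulr1; lmod.
  by lmod.
by case: w => [|c w]; lmod.
Qed.
End Derivation.
End Multilinear.

(** * The action of the algebra on the coefficients *)

Section LamAct.
Context (F : fieldType) (A : comAlgType F) (D : {linear A -> A}) (s : nat).
Local Notation lampoly := (mpoly.mpoly s A).
Implicit Types (a b c : A) (p q : lampoly) (t u : 'I_s).

Lemma lampoly_ind (P : lampoly -> Prop) :
  P 1 -> (forall u p, P p -> P ('X_u * p)) -> (forall c p, P p -> P (c *: p)) ->
  (forall p q, P p -> P q -> P (p + q)) -> forall p, P p.
Proof.
move=> P1 PX PZ PD; elim/mpolyind => [|c m p _ _ Pp].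
  by rewrite -(scale0r (1 : lampoly)); apply: PZ.
apply: PD => //; apply: PZ; rewrite mpolyXE_id -[X in P X]mulr1.
elim/big_rec: _ => [|i q _ Pq]; first by rewrite mul1r.
rewrite -mulrA; elim: (m i) => [|k IH]; first by rewrite mul1r.
by rewrite exprS -mulrA; apply: PX.
Qed.

Local Notation evd := (@eval_der F A D s).
Local Notation la := (@lam_act F A D s).

Lemma eval_der_widen n a (P : {poly lampoly}) : (size P <= n)%N ->
  evd a P = \sum_(j < n) iter j D a *: P`_j.
Proof.
move=> le; rewrite /eval_der (big_ord_widen n (fun j => iter j D a *: P`_j)) //.
rewrite big_mkcond; apply: eq_bigr => j _; case: ltnP => // /leq_sizeP -> //.
by rewrite scaler0.
Qed.

Lemma eval_derD a (P Q : {poly lampoly}) : evd a (P + Q) = evd a P + evd a Q.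
Proof.
pose n := maxn (size P) (size Q).
rewrite !(@eval_der_widen n) ?leq_maxl ?leq_maxr ?size_polyD //.
by rewrite -big_split; apply: eq_bigr => j _; rewrite coefD scalerDr.
Qed.

Lemma eval_der_mulC a (c : lampoly) P : evd a (c%:P * P) = c * evd a P.
Proof.
rewrite (@eval_der_widen (size P)) ?mul_polyC ?size_scale_leq // mulr_sumr.
by apply: eq_bigr => j _; rewrite coefZ scalerAr.
Qed.

Lemma eval_der_mulX a (P : {poly lampoly}) : evd a ('X * P) = evd (D a) P.
Proof.
rewrite (@eval_der_widen (size P).+1); last first.
  by rewrite (leq_trans (size_polyMleq _ _)) // size_polyX.
rewrite big_ord_recl coefXM eqxx scaler0 add0r; apply: eq_bigr => j _.
by rewrite coefXM /= -iterSr.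
Qed.

Lemma lam_act1 t a : la t a 1 = a *: 1.
Proof.
rewrite /lam_act /lam_shift rmorph1 /eval_der size_poly1 big_ord1.
by rewrite coefC.
Qed.

Lemma lam_actD t a p q : la t a (p + q) = la t a p + la t a q.
Proof. by rewrite /lam_act /lam_shift raddfD eval_derD. Qed.

Lemma lam_actZ t a c p : la t a (c *: p) = c *: la t a p.
Proof. by rewrite /lam_act /lam_shift mmapZ /= eval_der_mulC mul_mpolyC. Qed.

(** With the values on 1 and linearity, this rule determines the action:
    shifting Lambda_u by x = partial adds a derivative of a. *)
Lemma lam_actX t a u p :
  la t a ('X_u * p) = 'X_u * la t a p + (if u == t then la t (D a) p else 0).
Proof.
rewrite /lam_act /lam_shift rmorphM /= mmapX mmap1U mulrDl eval_derD eval_der_mulC.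
by case: eqP => _; rewrite ?eval_der_mulX // mul0r /eval_der size_poly0 big_ord0.
Qed.

Local Opaque lam_act.

Lemma lam_actDl t a b p : la t (a + b) p = la t a p + la t b p.
Proof.
elim/lampoly_ind: p a b => [|u p IH|c p IH|p q IHp IHq] a b.
- by rewrite !lam_act1 scalerDl.
- rewrite !lam_actX IH mulrDr linearD; case: eqP => _; rewrite ?IH ?addr0 //.
  exact: addrACA.
- by rewrite !lam_actZ IH scalerDr.
rewrite !lam_actD IHp IHq; exact: addrACA.
Qed.

Lemma lam_act0 t a : la t a 0 = 0.
Proof. by apply: (addrI (la t a 0)); rewrite -lam_actD !addr0. Qed.

Lemma lam_act0l t p : la t 0 p = 0.
Proof. by apply: (addrI (la t 0 p)); rewrite -lam_actDl !addr0. Qed.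

Section Leibniz.
Hypothesis DM : forall a b, D (a * b) = D a * b + a * D b.

(** The operator is sum_j (partial^j a / j!) (d/dLambda_t)^j, and the Leibniz rule makes
    it multiplicative in a; by [lam_actX] only its commutator with 'X_t has to be known. *)
Lemma lam_actM t a b p : la t (a * b) p = la t a (la t b p).
Proof.
elim/lampoly_ind: p a b => [|u p IH|c p IH|p q IHp IHq] a b.
- by rewrite !lam_act1 lam_actZ lam_act1 scalerA mulrC.
- rewrite !lam_actX lam_actD lam_actX IH; case: eqP => _; last first.
    by rewrite lam_act0 !addr0.
  by rewrite DM lam_actDl !IH addrA.
- by rewrite !lam_actZ IH.
by rewrite !lam_actD IHp IHq.
Qed.

Lemma der_scalar (k : F) : D k%:A = 0.
Proof.
suff D1 : D 1 = 0 by rewrite linearZ /= D1 scaler0.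
have := DM 1 1; rewrite !mulr1 mul1r => /eqP.
by rewrite -subr_eq0 opprD addNKr oppr_eq0 => /eqP.
Qed.

Lemma lam_act_scalar t (k : F) p : la t k%:A p = k%:A *: p.
Proof.
elim/lampoly_ind: p => [|u p IH|c p IH|p q IHp IHq].
- by rewrite lam_act1.
- by rewrite lam_actX der_scalar lam_act0l if_same addr0 IH scalerAr.
- by rewrite lam_actZ IH !scalerA mulrC.
by rewrite lam_actD IHp IHq scalerDr.
Qed.

Lemma lam_actC t u a b p : la t a (la u b p) = la u b (la t a p).
Proof.
elim/lampoly_ind: p a b => [|v p IH|c p IH|p q IHp IHq] a b.
- by rewrite !lam_act1 !lam_actZ !lam_act1 !scalerA mulrC.
- rewrite !lam_actX !lam_actD !lam_actX IH -!addrA; congr (_ + _).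
  case: (v == u); case: (v == t).
  + by rewrite !IH [LHS]addrC.
  + by rewrite lam_act0 addr0 add0r IH.
  + by rewrite lam_act0 addr0 add0r IH.
  + by rewrite !lam_act0.
- by rewrite !lam_actZ IH.
rewrite [la u b (p + q)]lam_actD [la t a (p + q)]lam_actD.
rewrite [LHS]lam_actD [RHS]lam_actD; exact: (f_equal2 +%R (IHp a b) (IHq a b)).
Qed.

Lemma msym_lam_act (sigma : 'S_s) t a p :
  msym sigma (la t a p) = la (sigma t) a (msym sigma p).
Proof.
have symX u : msym sigma 'X_u = 'X_(sigma u) :> lampoly.
  by rewrite /msym mmapX mmap1U.
elim/lampoly_ind: p a => [|u p IH|c p IH|p q IHp IHq] a.
- by rewrite lam_act1 msymZ rmorph1 lam_act1.
- rewrite lam_actX msymD !msymM symX lam_actX IH (inj_eq perm_inj).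
  by case: eqP => _; rewrite ?IH ?msym0.
- by rewrite lam_actZ !msymZ lam_actZ IH.
rewrite lam_actD !msymD [RHS]lam_actD; exact: (f_equal2 +%R (IHp a) (IHq a)).
Qed.
End Leibniz.
End LamAct.

Definition leibniz (F : fieldType) (A : comAlgType F) (D : A -> A) :=
  forall a b, D (a * b) = D a * b + a * D b.

HB.lock Definition act (F : fieldType) (A : comAlgType F) (D : {linear A -> A})
  (s : nat) (t : 'I_s) (a : A) : lamquot D s -> lamquot D s :=
  lamquot_map (lam_act D t a).
HB.lock Definition mulX (F : fieldType) (A : comAlgType F) (D : {linear A -> A})
  (s : nat) (t : 'I_s) : lamquot D s -> lamquot D s := lamquot_map ( *%R 'X_t).
HB.lock Definition msymq (F : fieldType) (A : comAlgType F) (D : {linear A -> A})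
  (s : nat) (sigma : 'S_s) : lamquot D s -> lamquot D s := lamquot_map (msym sigma).

Section Act.
Context (F : fieldType) (A : comAlgType F) (D : {linear A -> A}).
Hypothesis DM : leibniz D.
Context (s : nat).
Implicit Types (t u : 'I_s) (a b : A).
Local Notation Q := (lamquot D s).

Local Notation act := (@act F A D s).
Local Notation mulX := (@mulX F A D s).
Local Notation msymq := (@msymq F A D s).

Lemma act_pi t a p : act t a (\pi_Q p) = \pi_Q (lam_act D t a p).
Proof. by rewrite act.unlock; apply: lamquot_act_pi. Qed.
Lemma mulX_pi t p : mulX t (\pi_Q p) = \pi_Q ('X_t * p).
Proof. by rewrite mulX.unlock; apply: lamquot_mulX_pi. Qed.
Lemma msymq_pi sigma p : msymq sigma (\pi_Q p) = \pi_Q (msym sigma p).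
Proof. by rewrite msymq.unlock; apply: lamquot_perm_pi. Qed.
Local Notation piD := (@lamquot_piD F A D s).

Lemma actA t a b q : act t a (act t b q) = act t (a * b) q.
Proof. by elim/quotW: q => p; rewrite !act_pi lam_actM. Qed.

Lemma act_scalar t (k : F) q : act t k%:A q = k *: q.
Proof.
elim/quotW: q => p; rewrite act_pi lam_act_scalar //.
by rewrite -lamquot_scale_pi.
Qed.

Lemma act1 t : left_id 1 (act t).
Proof. by move=> q; rewrite -[1]scale1r act_scalar scale1r. Qed.

Lemma actDr t : right_distributive (act t) +%R.
Proof.
move=> a; elim/quotW => p; elim/quotW => q.
by rewrite -piD !act_pi lam_actD piD.
Qed.

Lemma actDl t q : {morph act t ^~ q : a b / a + b}.
Proof. by move=> a b; elim/quotW: q => p; rewrite !act_pi lam_actDl piD. Qed.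

Lemma actC t u a b q : act t a (act u b q) = act u b (act t a q).
Proof. by elim/quotW: q => p; rewrite !act_pi lam_actC. Qed.

(** The operator -Lambda_t is a derivation over D for the t-th module structure. *)
Lemma mulX_act t u a q : mulX u (act t a q) =
  act t a (mulX u q) - (if u == t then act t (D a) q else 0).
Proof.
elim/quotW: q => p; rewrite !(act_pi, mulX_pi) lam_actX.
by case: eqP => _; rewrite ?addr0 ?subr0 // piD addrK.
Qed.

Lemma mulXD t p q : mulX t (p + q) = mulX t p + mulX t q.
Proof.
by elim/quotW: p => p; elim/quotW: q => q; rewrite -piD !mulX_pi mulrDr piD.
Qed.

Lemma msymqD sigma p q : msymq sigma (p + q) = msymq sigma p + msymq sigma q.
Proof.
by elim/quotW: p => p; elim/quotW: q => q; rewrite -piD !msymq_pi msymD piD.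
Qed.

Lemma msymq_act sigma t a q :
  msymq sigma (act t a q) = act (sigma t) a (msymq sigma q).
Proof. by elim/quotW: q => p; rewrite !(act_pi, msymq_pi) msym_lam_act. Qed.
End Act.

(** The same space for all t: the index tells which of the s commuting module structures
    over the algebra is in use. *)
Definition lam_module (F : fieldType) (A : comAlgType F) (D : {linear A -> A})
  (DM : leibniz D) (s : nat) (t : 'I_s) := lamquot D s.

Section LamModuleInstance.
Context (F : fieldType) (A : comAlgType F) (D : {linear A -> A}) (DM : leibniz D).
Context (s : nat) (t : 'I_s).
HB.instance Definition _ := GRing.Zmodule.on (lam_module DM t).
Fact lam_module_actA a b (q : lam_module DM t) : act t a (act t b q) = act t (a * b) q.
Proof. exact: (actA DM). Qed.
HB.instance Definition _ := GRing.Zmodule_isLmodule.Build A (lam_module DM t)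
  lam_module_actA (act1 DM t) (actDr DM t) (actDl DM t).
End LamModuleInstance.

(** * Operators acting block by block *)

Section SetBlock.
Context (F : fieldType) (A : comAlgType F) (s : nat).
Implicit Types (v : word A s) (t u : 'I_s) (w : seq A).

Lemma set_blockE v t w : (set_block v t w) t = w.
Proof. by rewrite ffunE eqxx. Qed.
Lemma set_block_ne v t w u : u != t -> (set_block v t w) u = v u.
Proof. by rewrite ffunE => /negbTE->. Qed.
Lemma set_block_id v t : set_block v t (v t) = v.
Proof. by apply/ffunP => u; rewrite ffunE; case: eqP => // ->. Qed.
Lemma set_block2 v t w w' : set_block (set_block v t w) t w' = set_block v t w'.
Proof. by apply/ffunP => u; rewrite !ffunE; case: eqP. Qed.
Lemma set_blockC v t u w w' : u != t ->
  set_block (set_block v t w) u w' = set_block (set_block v u w') t w.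
Proof.
move=> ut; apply/ffunP => i; rewrite !ffunE.
by case: (eqVneq i u) => // ->; rewrite (negbTE ut).
Qed.

Lemma woff_set_block t u v w : woff t (set_block v u w) =
  (\sum_(i < s | (i < t)%N && (i != u)) size (v i) + (if (u < t)%N then size w else 0))%N.
Proof.
rewrite /woff; have [ut|tu] := ltnP u t.
  rewrite (bigD1 u) //= set_blockE addnC; congr (_ + _)%N.
  by apply: eq_bigr => i /andP[_ iu]; rewrite set_block_ne.
rewrite addn0; apply: eq_big => [i|i it].
  by case: (eqVneq i u) => [->|]; rewrite ?andbT // ltnNge tu.
by rewrite set_block_ne //; apply: contraTneq it => ->; rewrite -leqNgt.
Qed.

Lemma woffE t u v : woff t v =
  (\sum_(i < s | (i < t)%N && (i != u)) size (v i) + (if (u < t)%N then size (v u) else 0))%N.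
Proof. by rewrite -woff_set_block set_block_id. Qed.

Lemma wlen_set_block v t w :
  (wlen (set_block v t w) + size (v t) = wlen v + size w)%N.
Proof.
rewrite /wlen (bigD1 t) //= [in RHS](bigD1 t) //= set_blockE.
rewrite (eq_bigr (fun i => size (v i))); last by move=> i it; rewrite set_block_ne.
by rewrite addnC addnA [LHS]addnAC.
Qed.
End SetBlock.

Section Tot.
Context (F : fieldType) (A : comAlgType F) (D : {linear A -> A}).
Context (DM : leibniz D) (s : nat).
Implicit Types (t u : 'I_s) (a b : A) (w : seq A) (v : word A s).
Implicit Types (f : cochain D s) (Phi Psi : seq A -> chain A).
Local Notation Q := (lamquot D s).
Local Notation act := (@act F A D s).

Definition in_block f v t : seq A -> lam_module DM t := fun w => f (set_block v t w).

Definition block_op Phi t f v : Q := ev (in_block f v t) (Phi (v t)).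

Definition total_op Phi f v : Q := \sum_(t < s) (-1) ^+ woff t v *: block_op Phi t f v.

Lemma block_opE Phi t f v :
  block_op Phi t f v = \sum_(p <- Phi (v t)) act t p.1 (f (set_block v t p.2)).
Proof. by []. Qed.

Lemma block_op_set_block Phi t f v w :
  block_op Phi t f (set_block v t w) = ev (in_block f v t) (Phi w).
Proof.
rewrite /block_op set_blockE; apply: (@ev_ext _ (lam_module DM t)) => w'.
by rewrite /in_block set_block2.
Qed.

Lemma block_op_set_block_ne Phi t u f v w : u != t ->
  block_op Phi t f (set_block v u w) =
  \sum_(p <- Phi (v t)) act t p.1 (in_block f (set_block v t p.2) u w).
Proof.
move=> ut; rewrite block_opE set_block_ne 1?eq_sym //.
by apply: eq_bigr => p _; rewrite /in_block (set_blockC _ _ _ ut).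
Qed.

Lemma block_op_ext Phi t f g v : f =1 g -> block_op Phi t f v = block_op Phi t g v.
Proof. by move=> fg; apply: (@ev_ext _ (lam_module DM t)) => w; apply: fg. Qed.

(** Seen from the block u, the operator is a sum of its own action on this block and of
    actions on other blocks, which compose the functions of block u with module
    operations commuting with everything. A property of functions of one block that is
    stable under these is preserved. *)
Lemma total_op_closed Phi (P : forall u, (seq A -> lam_module DM u) -> Prop) :
  (forall u (G G' : seq A -> lam_module DM u), G =1 G' -> P u G -> P u G') ->
  (forall u, P u (fun=> 0)) ->
  (forall u (G G' : seq A -> lam_module DM u), P u G -> P u G' -> P u (fun w => G w + G' w)) ->
  (forall u (k : nat -> F) (G : seq A -> lam_module DM u), P u G ->
     P u (fun w => k (size w) *: (G w : Q))) ->
  (forall u t a (G : seq A -> lam_module DM u), u != t -> P u G -> P u (fun w => act t a (G w))) ->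
  (forall u (G : seq A -> lam_module DM u), P u G -> P u (fun w => ev G (Phi w))) ->
  forall f, (forall v u, P u (in_block f v u)) -> forall v u, P u (in_block (total_op Phi f) v u).
Proof.
move=> Pext P0 PD Psz Pact Pop f Pf v u.
have Psum I (r : seq I) (G : I -> seq A -> lam_module DM u) :
    (forall i, P u (G i)) -> P u (fun w => \sum_(i <- r) G i w).
  move=> PG; elim: r => [|i r IH].
    by apply: Pext (P0 u) => w; rewrite big_nil.
  by apply: Pext (PD _ _ _ (PG i) IH) => w; rewrite big_cons.
apply: (Psum _ _ (fun t w => (-1) ^+ woff t (set_block v u w) *:
                              block_op Phi t f (set_block v u w))) => t.
pose c := (\sum_(i < s | (i < t)%N && (i != u)) size (v i))%N.
pose k n : F := (-1) ^+ (c + (if (u < t)%N then n else 0))%N.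
apply: (Pext _ (fun w => k (size w) *: (block_op Phi t f (set_block v u w) : Q))) => [w|].
  by rewrite woff_set_block.
apply: (Psz u k (fun w => block_op Phi t f (set_block v u w))).
have [<-|ut] := eqVneq u t.
  by apply: (Pext _ _ _ _ (Pop _ _ (Pf v u))) => w; rewrite block_op_set_block.
apply: (Pext _ _ _ (fun w => esym (block_op_set_block_ne Phi f v w ut))).
apply: (Psum _ _ (fun p w => act t p.1 (in_block f (set_block v t p.2) u w))) => p.
exact: Pact.
Qed.

(** The signs of the two operators square to 1 when they act on the same block. *)
Lemma total_op_comp Phi Psi f v :
  total_op Phi (total_op Psi f) v =
  \sum_(t < s) block_op Phi t (block_op Psi t f) v
  + \sum_(t < s) \sum_(u < s | u != t) \sum_(p <- Phi (v t)) \sum_(q <- Psi (v u))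
      (-1) ^+ (woff t v + woff u (set_block v t p.2))%N *:
        act t p.1 (act u q.1 (f (set_block (set_block v t p.2) u q.2))).
Proof.
have scaleZ t (k : F) a (q : Q) : act t a (k *: q) = k *: act t a q.
  by rewrite -!(act_scalar DM t) !(actA DM) mulrC.
have actsum t a I (r : seq I) (P : pred I) (G : I -> Q) :
   act t a (\sum_(i <- r | P i) G i) = \sum_(i <- r | P i) act t a (G i).
  exact: (@scaler_sumr A (lam_module DM t)).
rewrite -big_split /=; apply: eq_bigr => t _.
rewrite block_opE.
under [in LHS]eq_bigr => p _ do rewrite actsum (bigD1 t) //=.
rewrite big_split scalerDr /=; congr (_ + _).
  rewrite block_opE scaler_sumr; apply: eq_bigr => p _.
  rewrite !scaleZ scalerA -exprD (woffE t t) woff_set_block ltnn addn0.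
  by rewrite -signr_odd addnn odd_double scale1r.
rewrite exchange_big scaler_sumr /=; apply: eq_bigr => u ut.
rewrite scaler_sumr; apply: eq_bigr => p _.
rewrite block_opE set_block_ne // scaleZ actsum !scaler_sumr.
by apply: eq_bigr => q _; rewrite scalerA exprD.
Qed.

Definition parity_odd Phi := forall w p, p \in Phi w -> odd (size p.2) = ~~ odd (size w).

(** Changing the parity of an earlier block flips the sign of the operator on a later one,
    in one of the two orders of composition only. *)
Lemma total_op_anticomm Phi Psi f v : parity_odd Phi -> parity_odd Psi ->
  total_op Phi (total_op Psi f) v + total_op Psi (total_op Phi f) v =
  \sum_(t < s) (block_op Phi t (block_op Psi t f) v + block_op Psi t (block_op Phi t f) v).
Proof.
move=> oPhi oPsi; rewrite !total_op_comp big_split /= addrACA -[RHS]addr0; congr (_ + _).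
rewrite [X in _ + X](exchange_big_dep xpredT) //=.
rewrite -big_split big1 //= => t _.
rewrite [X in _ + X](eq_bigl (fun u => u != t)); last by move=> u; rewrite eq_sym.
rewrite -big_split big1 //= => u ut.
rewrite [X in _ + X]exchange_big -big_split /= big1_seq // => p /= pP.
rewrite -big_split big1_seq // => q /= qP.
rewrite (actC DM) (set_blockC _ _ _ ut) -scalerDl.
suff -> : (-1) ^+ (woff t v + woff u (set_block v t p.2))
   + (-1) ^+ (woff u v + woff t (set_block v u q.2)) = 0 :> F by rewrite scale0r.
rewrite !woff_set_block [woff t v](woffE _ u) [woff u v](woffE _ t).
rewrite -[X in X + _]signr_odd -[X in _ + X]signr_odd !oddD.
have := oPhi _ _ pP; have := oPsi _ _ qP.
case: (ltngtP t u) => [_|_|/val_inj tu]; last by rewrite tu eqxx in ut.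
  by move=> _ -> /=; rewrite ?addbF; case: (odd (size _)); case: odd; case: odd;
     rewrite /= ?expr0 ?expr1 ?subrr ?addNr.
by move=> -> _ /=; rewrite ?addbF; case: (odd (size _)); case: odd; case: odd;
     rewrite /= ?expr0 ?expr1 ?subrr ?addNr.
Qed.
End Tot.

(** * Preservation of the conditions on cochains *)

Section Conditions.
Context (F : fieldType) (A : comAlgType F) (D : {linear A -> A}).
Context (DM : leibniz D) (s : nat).
Implicit Types (t u : 'I_s) (a b : A) (w : seq A) (v : word A s).
Implicit Types (f : cochain D s) (Phi Psi : seq A -> chain A).
Local Notation Q := (lamquot D s).
Local Notation act := (@act F A D s).
Local Notation mulX := (@mulX F A D s).
Local Notation blk := (in_block DM).
Local Notation totop := (total_op DM).

Lemma lam_module_scalar t (k : F) (q : lam_module DM t) : k%:A *: q = k *: (q : Q).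
Proof. exact: act_scalar. Qed.

Lemma act_F t a (k : F) q : act t a (k *: q) = k *: act t a q.
Proof. by rewrite -!(act_scalar DM t) !(actA DM) mulrC. Qed.

Lemma act_sum t a I (r : seq I) (P : pred I) (G : I -> Q) :
   act t a (\sum_(i <- r | P i) G i) = \sum_(i <- r | P i) act t a (G i).
Proof. exact: (@scaler_sumr A (lam_module DM t)). Qed.

Lemma act_ev t u a (G : seq A -> lam_module DM u) c :
  act t a (ev G c) = ev (fun w => act t a (G w) : lam_module DM u) c.
Proof.
rewrite /ev act_sum; apply: eq_bigr => p _; exact: (actC DM).
Qed.

Lemma multilin_ext u (G G' : seq A -> lam_module DM u) : G =1 G' -> multilin G -> multilin G'.
Proof. by move=> e LG p q k a b; rewrite -!e. Qed.

Lemma multilin_zero u : multilin (fun=> 0 : lam_module DM u).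
Proof. by move=> p q k a b; rewrite scaler0 addr0. Qed.

Lemma multilin_add u (G G' : seq A -> lam_module DM u) :
  multilin G -> multilin G' -> multilin (fun w => G w + G' w).
Proof. by move=> LG LG' p q k a b; rewrite LG LG' scalerDr addrACA. Qed.

Lemma multilin_sizeZ u (k : nat -> F) (G : seq A -> lam_module DM u) :
  multilin G -> multilin (fun w => k (size w) *: (G w : Q) : lam_module DM u).
Proof.
move=> LG p q c a b; rewrite LG !size_cat /= scalerDr.
by congr (_ + _); rewrite !lam_module_scalar !scalerA mulrC.
Qed.

Lemma multilin_act u t a (G : seq A -> lam_module DM u) :
  multilin G -> multilin (fun w => act t a (G w) : lam_module DM u).
Proof.
move=> LG p q c d e; rewrite LG !lam_module_scalar (actDr DM).
by rewrite act_F.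
Qed.

Lemma multilin_total_op Phi f :
  (forall u (G : seq A -> lam_module DM u), multilin G -> multilin (fun w => ev G (Phi w))) ->
  (forall v u, multilin (blk f v u)) -> forall v u, multilin (blk (totop Phi f) v u).
Proof.
move=> Pop; apply: (total_op_closed (P := fun u => @multilin F A (lam_module DM u))) => // u.
- exact: multilin_ext.
- exact: multilin_zero.
- exact: multilin_add.
- exact: multilin_sizeZ.
- by move=> t a G _; apply: multilin_act.
Qed.

Lemma shuffle_free_total_op Phi f :
  (forall u (G : seq A -> lam_module DM u), shuffle_free G -> shuffle_free (fun w => ev G (Phi w))) ->
  (forall v u, shuffle_free (blk f v u)) -> forall v u, shuffle_free (blk (totop Phi f) v u).
Proof.
move=> Pop; apply: (total_op_closed (P := fun u => @shuffle_free A (lam_module DM u))) => // u.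
- by move=> G G' e LG a x b y; rewrite -(LG a x b y); apply/shsum_ext/fsym.
- by move=> a x b y; apply: shsum0.
- by move=> G G' LG LG' a x b y; rewrite shsumD LG LG' addr0.
- move=> k G LG a x b y.
  rewrite (shsum_sizeE (g := fun w => (k (size (a :: x) + size (b :: y))%N)%:A *: G w)).
    by rewrite shsumZ LG scaler0.
  by move=> w ->; rewrite lam_module_scalar.
- move=> t a G _ LG b x c y; rewrite /shsum -act_ev -/(shsum _ _ _) LG.
  exact: (@scaler0 A (lam_module DM t)).
Qed.

Definition sesq u (G : seq A -> lam_module DM u) :=
  forall w, letters (der_letter D) G w = - mulX u (G w).

Lemma mulX0 t : mulX t (0 : Q) = 0.
Proof. by apply: (addrI (mulX t 0)); rewrite -(mulXD DM) !addr0. Qed.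

Lemma mulX_F t (k : F) (q : Q) : mulX t (k *: q) = k *: mulX t q.
Proof.
rewrite -!(act_scalar DM t) (mulX_act DM) eqxx.
rewrite (der_scalar DM); have -> : act t 0 q = 0 by apply: (@scale0r A (lam_module DM t)).
by rewrite subr0.
Qed.

(** Together with the analogous formula for the derivation of a word, this shows that the
    correction [der_coefs] is common to both sides of the sesquilinearity condition. *)
Lemma mulX_ev u (G : seq A -> lam_module DM u) c :
  mulX u (ev G c) = ev (fun w => mulX u (G w) : lam_module DM u) c - der_coefs D G c.
Proof.
rewrite /ev /der_coefs -sumrB.
elim: c => [|p c IH]; first by rewrite !big_nil mulX0.
by rewrite !big_cons (mulXD DM) IH (mulX_act DM) eqxx.
Qed.

Lemma sesq_total_op Phi f :
  (forall u (G : seq A -> lam_module DM u), multilin G -> multilin (fun w => ev G (Phi w))) ->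
  (forall u (G : seq A -> lam_module DM u), multilin G -> forall w,
     letters (der_letter D) (fun w => ev G (Phi w)) w =
     ev (letters (der_letter D) G) (Phi w) + der_coefs D G (Phi w)) ->
  (forall v u, multilin (blk f v u)) -> (forall v u, sesq (blk f v u)) ->
  forall v u, sesq (blk (totop Phi f) v u).
Proof.
move=> Lop Sop Lf Sf v u.
suff [] : multilin (blk (totop Phi f) v u) /\ sesq (blk (totop Phi f) v u) by [].
move: v u.
apply: (total_op_closed (P := fun u G => @multilin F A (lam_module DM u) G /\ sesq G)) => // u.
- move=> G G' e [LG SG]; split; first exact: multilin_ext e LG.
  by move=> w; rewrite -e -SG; apply/letters_ext/fsym.
- by split=> [|w]; [exact: multilin_zero|rewrite mulX0 oppr0; apply: ev0].
- move=> G G' [LG SG] [LG' SG']; split=> [|w]; first exact: multilin_add.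
  by rewrite lettersD SG SG' (mulXD DM) opprD.
- move=> k G [LG SG]; split=> [|w]; first exact: multilin_sizeZ.
  rewrite (@letters_ext _ _ _ _ (fun w => (k (size w))%:A *: G w)).
    by rewrite (@letters_sizeZ _ _ _ (fun n => (k n)%:A)) SG lam_module_scalar mulX_F scalerN.
  by move=> w'; rewrite lam_module_scalar.
- move=> t a G ut [LG SG]; split=> [|w]; first exact: multilin_act.
  rewrite /letters -act_ev -/(letters _ _ _) SG (mulX_act DM) (negbTE ut) subr0.
  exact: (@scalerN A (lam_module DM t)).
- move=> G [LG SG]; split=> [|w]; first exact: Lop.
  rewrite Sop // mulX_ev opprB addrC; congr (_ + _).
  transitivity (ev (fun w => - (mulX u (G w) : lam_module DM u)) (Phi w)); last exact: evN.
  by apply: ev_ext => w'; rewrite SG.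
by move=> u'; split; [apply: Lf|apply: Sf].
Qed.

Lemma multilin_multilinear f : (forall v u, multilin (blk f v u)) -> multilinear f.
Proof.
move=> Lf v t i lt k a b; rewrite /set_letter !set_nthE lt.
have := Lf v t (take i (v t)) (drop i.+1 (v t)) k a b.
by rewrite lam_module_scalar.
Qed.

Lemma multilinear_multilin f : multilinear f -> forall v u, multilin (blk f v u).
Proof.
move=> Lf v u p q k a b; rewrite lam_module_scalar /blk.
have := Lf (set_block v u (p ++ 0 :: q)) u (size p).
rewrite set_blockE size_cat /= addnS ltnS leq_addr => /(_ isT k a b).
have E c : set_letter (set_block v u (p ++ 0 :: q)) u (size p) c =
           set_block v u (p ++ c :: q).
  rewrite /set_letter set_block2 set_blockE set_nthE.
  rewrite size_cat /= addnS ltnS leq_addr take_size_cat //.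
  by rewrite drop_cat ltnNge leqnSn /= subSnn /= drop0.
by rewrite !E.
Qed.

Lemma letters_derE u (G : seq A -> lam_module DM u) w :
  letters (der_letter D) G w = \sum_(i < size w) G (set_nth 0 w i (D w`_i)).
Proof.
elim: w G => [|a w IH] G; first by rewrite letters_nil big_ord0.
by rewrite letters_der_cons IH big_ord_recl.
Qed.

Lemma sesq_sesquilinear f : (forall v u, sesq (blk f v u)) -> sesquilinear f.
Proof.
move=> Sf v t; have := Sf v t (v t).
by rewrite letters_derE /blk set_block_id mulX.unlock.
Qed.

Lemma sesquilinear_sesq f : sesquilinear f -> forall v u, sesq (blk f v u).
Proof.
move=> Sf v u w; have := Sf (set_block v u w) u.
rewrite letters_derE set_blockE mulX.unlock /blk => <-.
by apply: eq_bigr => i _; rewrite /set_letter set_block2 set_blockE.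
Qed.

Lemma dbar_sum (M : lmodType A) (G : seq A -> M) a w :
  dbar G (a :: w) =
  \sum_(i < size w) alt_sign A i *: G (take i (a :: w) ++
      (a :: w)`_i * (a :: w)`_i.+1 :: drop i.+2 (a :: w))
  + alt_sign A (size w) *: (last a w *: G (belast a w)).
Proof.
elim: w a G => [|b w IH] a G.
  by rewrite dbar_cons merge0 dbar_nil subr0 big_ord0 add0r scale1r.
rewrite dbar_cons merge_cons IH big_ord_recl scale1r /= drop0 opprD addrA.
have sgS n : alt_sign A n.+1 = - alt_sign A n by rewrite /alt_sign /=; case: odd; rewrite ?opprK.
rewrite sgS scaleNr; congr (_ + _ - _).
by rewrite -sumrN; apply: eq_bigr => i _; rewrite sgS scaleNr.
Qed.

Lemma lam_module_sign u n (q : lam_module DM u) : alt_sign A n *: q = (-1) ^+ n *: (q : Q).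
Proof.
have -> : alt_sign A n = ((-1) ^+ n : F)%:A.
  rewrite alt_signE -signr_odd -[in RHS]signr_odd.
  by case: (odd n); rewrite ?expr0 ?expr1 ?scaleN1r ?scale1r.
exact: lam_module_scalar.
Qed.

Lemma lam_module_scaleE t a (q : lam_module DM t) : a *: q = lamquot_map (lam_act D t a) q.
Proof. by transitivity (act t a q); rewrite // act.unlock. Qed.

Lemma block_diffE t f v :
  block_diff t f v = (-1) ^+ woff t v *: block_op DM (@bar_chain A) t f v.
Proof.
rewrite /block_diff /block_op; case E: (v t) => [|a w]; first by rewrite ev_nil scaler0.
rewrite [ev _ _]bar_cons dbar_sum -E !scalerDr.
rewrite -addrA; congr (_ + _); first by rewrite lam_module_scaleE.
rewrite [X in _ = _ *: X](@opprD (lam_module DM t)) scalerDr; congr (_ + _).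
  rewrite [X in _ = _ *: X](_ : _ = \sum_(i < size w) (-1) ^+ i.+1 *: (blk f v t
    (take i (v t) ++ (v t)`_i * (v t)`_i.+1 :: drop i.+2 (v t)) : Q)).
    rewrite scaler_sumr; apply: eq_bigr => i _.
    by rewrite scalerA -exprD.
  rewrite -sumrN; apply: eq_bigr => i _.
  by rewrite lam_module_sign exprS mulN1r scaleNr.
rewrite lam_module_sign -addnS exprD -scalerA; congr (_ *: _).
by rewrite exprS mulN1r scaleNr lam_module_scaleE.
Qed.

Lemma diff_total_op f : diff f =1 totop (@bar_chain A) f.
Proof. by move=> v; apply: eq_bigr => t _; apply: block_diffE. Qed.

End Conditions.

(** * Compatibility with the symmetric group *)

Section InversionSign.
Context (s : nat) (sigma : 'S_s).

Definition inversions (z : 'I_s -> nat) : nat :=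
  (\sum_(t < s) \sum_(t' < s | (t < t')%N && (sigma t' < sigma t)%N) z t * z t')%N.

Lemma inversionsE (z : 'I_s -> nat) t :
  inversions z = (z t * (\sum_(j < s | (t < j)%N && (sigma j < sigma t)%N) z j
                       + \sum_(i < s | (i < t)%N && (sigma t < sigma i)%N) z i)
   + \sum_(i < s | i != t) \sum_(j < s | [&& (i < j)%N, (sigma j < sigma i)%N & j != t])
       z i * z j)%N.
Proof.
have E (i : 'I_s) : (\sum_(j < s | (i < j)%N && (sigma j < sigma i)%N) z i * z j)%N =
  ((if (i < t)%N && (sigma t < sigma i)%N then z t * z i else 0)
  + \sum_(j < s | [&& (i < j)%N, (sigma j < sigma i)%N & j != t]) z i * z j)%N.
  case: ifP => c; last first.
    apply: eq_bigl => j; case: (eqVneq j t) => [->|]; last by rewrite andbT.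
    by rewrite c !andbF.
  rewrite (bigD1 t c) /= mulnC; congr (_ + _)%N.
  by apply: eq_bigl => j; rewrite -andbA.
rewrite /inversions (bigD1 t) //= (eq_bigr _ (fun i _ => E i)) big_split /=.
rewrite addnA -big_mkcondr mulnDr !big_distrr /=.
congr (_ + _ + _)%N; apply: eq_bigl => i.
by case: (eqVneq i t) => [->|]; rewrite ?ltnn.
Qed.

(** The block t is inverted with the blocks counted by R and L in the proof. Changing the
    parity of its size changes the number of inversions by R + L modulo 2, which is also the
    difference between the total sizes preceding it before and after the permutation. *)
Lemma inversions_parity (z z' : 'I_s -> nat) t :
  (forall i, i != t -> z' i = z i) -> odd (z' t) = ~~ odd (z t) ->
  odd (inversions z + \sum_(i < s | (i < t)%N) z i) =
  odd (\sum_(i < s | (sigma i < sigma t)%N) z i + inversions z').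
Proof.
move=> zz' zt; rewrite (inversionsE z t) (inversionsE z' t).
set R := (\sum_(j < s | (t < j)%N && _) z j)%N.
set L := (\sum_(i < s | (i < t)%N && _) z i)%N.
have -> : (\sum_(j < s | (t < j)%N && (sigma j < sigma t)%N) z' j)%N = R.
  by apply: eq_bigr => j /andP[tj _]; rewrite zz' // neq_ltn tj orbT.
have -> : (\sum_(i < s | (i < t)%N && (sigma t < sigma i)%N) z' i)%N = L.
  by apply: eq_bigr => j /andP[tj _]; rewrite zz' // neq_ltn tj.
set T := (\sum_(i < s | i != t) _)%N; set T' := (\sum_(i < s | i != t) _)%N.
have -> : T' = T.
  apply: eq_bigr => i it; apply: eq_bigr => j /and3P[_ _ jt].
  by rewrite !zz'.
pose C := (\sum_(i < s | (i < t)%N && (sigma i < sigma t)%N) z i)%N.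
have -> : (\sum_(i < s | (i < t)%N) z i = C + L)%N.
  rewrite (bigID (fun i => (sigma i < sigma t)%N)) /=; congr (_ + _)%N.
  apply: eq_bigl => i; case: (ltngtP i t) => //= it; rewrite -leqNgt leq_eqVlt.
  by rewrite (inj_eq val_inj) (inj_eq perm_inj) -(inj_eq val_inj) gtn_eqF.
have -> : (\sum_(i < s | (sigma i < sigma t)%N) z i = C + R)%N.
  rewrite (bigID (fun i : 'I_s => (i < t)%N)) /=; congr (_ + _)%N.
    by apply: eq_bigl => i; rewrite andbC.
  apply: eq_bigl => i; rewrite andbC -leqNgt leq_eqVlt.
  by case: eqP => // /val_inj ->; rewrite !ltnn andbF.
rewrite !(oddD, oddM) zt.
by case: (odd (z t)); case: (odd C); case: (odd R); case: (odd L); case: (odd T).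
Qed.
End InversionSign.

Section Symmetry.
Context (F : fieldType) (A : comAlgType F) (D : {linear A -> A}).
Context (DM : leibniz D) (s : nat).
Implicit Types (t u : 'I_s) (a b : A) (w : seq A) (v : word A s).
Implicit Types (f : cochain D s) (Phi Psi : seq A -> chain A).
Local Notation Q := (lamquot D s).
Local Notation totop := (total_op DM).

Definition perm_word (sigma : 'S_s) v : word A s := [ffun t => v (sigma t)].

Lemma sym_actE sigma f v : sym_act sigma f v =
  (-1) ^+ inversions sigma (fun t => size (v (sigma t)))
    *: msymq sigma (f (perm_word sigma v)).
Proof. by rewrite msymq.unlock. Qed.

Lemma perm_word_set_block sigma v t w :
  perm_word sigma (set_block v (sigma t) w) = set_block (perm_word sigma v) t w.
Proof. by apply/ffunP => u; rewrite !ffunE (inj_eq perm_inj). Qed.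

Lemma msymqF sigma (k : F) (q : Q) : msymq sigma (k *: q) = k *: msymq sigma q.
Proof.
elim/quotW: q => p; have E r : k *: \pi_Q r = \pi_Q (k%:A *: r) :> Q.
  exact: lamquot_scale_pi.
by rewrite E !msymq_pi E msymZ.
Qed.

Lemma msymq_sum sigma I (r : seq I) (P : pred I) (G : I -> Q) :
  msymq sigma (\sum_(i <- r | P i) G i) = \sum_(i <- r | P i) msymq sigma (G i).
Proof.
have E0 : msymq sigma (0 : Q) = 0.
  by apply: (addrI (msymq sigma 0)); rewrite -msymqD !addr0.
exact: (big_morph (@msymq F A D s sigma) (@msymqD F A D s sigma) E0).
Qed.

Lemma total_op_sym_act sigma Phi f v : parity_odd Phi ->
  sym_act sigma (totop Phi f) v = totop Phi (sym_act sigma f) v.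
Proof.
move=> oPhi; rewrite sym_actE msymq_sum scaler_sumr.
rewrite /total_op [RHS](reindex_inj (@perm_inj _ sigma)) /=.
apply: eq_bigr => t _; rewrite msymqF !block_opE msymq_sum !scaler_sumr ffunE.
rewrite big_seq [RHS]big_seq; apply: eq_bigr => p pP.
rewrite (msymq_act DM) sym_actE perm_word_set_block (act_F DM) !scalerA -!exprD.
congr (_ *: _); rewrite -signr_odd -[RHS]signr_odd; congr (_ ^+ (nat_of_bool _)).
pose z i := size (v (sigma i)).
pose z' i := size (set_block v (sigma t) p.2 (sigma i)).
have -> : woff t (perm_word sigma v) = (\sum_(i < s | (i < t)%N) z i)%N.
  by apply: eq_bigr => i _; rewrite ffunE.
have -> : woff (sigma t) v = (\sum_(i < s | (sigma i < sigma t)%N) z i)%N.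
  by rewrite /woff (reindex_inj (@perm_inj _ sigma)).
apply: (@inversions_parity _ sigma z z' t) => [i it|].
  by rewrite /z' set_block_ne // (inj_eq perm_inj).
by rewrite /z' /z set_blockE; apply: oPhi.
Qed.

Lemma sym_act_total_op_id sigma Phi f : parity_odd Phi ->
  sym_act sigma f =1 f -> sym_act sigma (totop Phi f) =1 totop Phi f.
Proof.
move=> oPhi sf v; rewrite total_op_sym_act //.
by apply: eq_bigr => t _; congr (_ *: _); apply: block_op_ext.
Qed.
End Symmetry.

(** * Monotone permutations and shuffles *)

Section LastLetter.
Context (A : comNzRingType) (M : lmodType A).
Implicit Types (x y : seq A) (f : seq A -> M).
Ltac lmod := lmod_with A M.

Lemma shsum_rcons f x a y b : shsum f (rcons x a) (rcons y b) =
  shsum (fun w => f (rcons w b)) (rcons x a) y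
  + alt_sign A (size y).+1 *: shsum (fun w => f (rcons w a)) x (rcons y b).
Proof.
elim: x y f => [|c x IHx] y f.
  elim: y f => [|d y IHy] f; first by rewrite /= shsum_cons !shsum0s !shsums0.
  move: IHy; rewrite /= => IHy; rewrite !shsum_cons IHy !shsum0s /= /alt_sign /=.
  by case: (odd (size y)) => /=; lmod.
elim: y f => [|d y IHy] f.
  have := IHx [::] (fun w => f (c :: w)); rewrite /= => {}IHx.
  by rewrite !shsum_cons IHx !shsums0 size_rcons /alt_sign /=; case: (odd (size x)) => /=; lmod.
have IHx' := IHx (d :: y) (fun w => f (c :: w)).
move: IHy IHx'; rewrite /= => IHy IHx'.
rewrite !shsum_cons IHx' IHy /= ?size_rcons /alt_sign /=.
by case: (odd (size x)); case: (odd (size y)) => /=; lmod.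
Qed.
End LastLetter.

Section MonotonePerm.
Variable k : nat.
Implicit Types (pi : 'S_k.+1) (sigma : 'S_k) (i : 'I_k) (j : 'I_k.+1).

(** A monotone permutation ends with the largest or with the smallest value; removing it
    leaves a monotone permutation, and [lift_perm] is the inverse operation. *)
Lemma lift_perm_bij (i0 j0 : 'I_k.+1) :
  {on [pred pi : 'S_k.+1 | pi i0 == j0], bijective (lift_perm i0 j0)}.
Proof.
pose lower pi i := odflt i (unlift (pi i0) (pi (lift i0 i))).
have lowerK pi i : lift (pi i0) (lower pi i) = pi (lift i0 i).
  rewrite /lower; have := neq_lift i0 i.
  by rewrite -(inj_eq (@perm_inj _ pi)) => /unlift_some[? ? ->].
have lower_inj pi : injective (lower pi).
  move=> i i' /(congr1 (lift (pi i0))); rewrite !lowerK => /perm_inj.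
  exact: lift_inj.
exists (fun pi => perm (@lower_inj pi)) => [sigma _|pi /eqP pi0]; apply/permP => i.
  by rewrite permE /lower lift_perm_lift lift_perm_id liftK.
by case: (unliftP i0 i) => [i'|] ->; rewrite ?lift_perm_id // lift_perm_lift -pi0 permE lowerK.
Qed.

Lemma widen_lift i : widen_ord (leqnSn k) i = lift ord_max i.
Proof. by apply: val_inj; rewrite /= /bump leqNgt ltn_ord. Qed.

Lemma forall_lift_max (P : pred 'I_k.+1) :
  [forall j, P j] = P ord_max && [forall i, P (lift ord_max i)].
Proof.
apply/forallP/andP => [H|[Hm /forallP H] j]; last by case: (unliftP ord_max j) => [i|] ->.
by split; last apply/forallP.
Qed.

Lemma rise_last pi : is_rise pi ord_max -> pi ord_max = ord_max.
Proof.
case/andP=> _ /forallP/(_ ((pi^-1)%g ord_max)); rewrite permKV.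
have [/(canRL (permKV pi)) //|ne] := eqVneq ((pi^-1)%g ord_max) ord_max.
rewrite [X in X ==> _](_ : _ = true); last first.
  by rewrite ltn_neqAle -ltnS ltn_ord andbT.
by rewrite implyTb ltnNge /= -ltnS ltn_ord.
Qed.

Lemma drop_last pi : is_drop pi ord_max -> pi ord_max = ord0.
Proof.
case/andP=> _ /forallP/(_ ((pi^-1)%g ord0)); rewrite permKV.
have [/(canRL (permKV pi)) //|ne] := eqVneq ((pi^-1)%g ord0) ord_max.
rewrite [X in X ==> _](_ : _ = true); last first.
  by rewrite ltn_neqAle -ltnS ltn_ord andbT.
by rewrite implyTb ltn0.
Qed.

Lemma max_lt i : ((ord_max : 'I_k.+1) < i)%N = false.
Proof. by rewrite ltnNge ltnW ?ltn_ord. Qed.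

Variables (j0 : 'I_k.+1) (j0_ext : j0 = ord_max \/ j0 = ord0).
Hypothesis k_gt0 : (0 < k)%N.

Lemma lift_mono i i' : (lift j0 i < lift j0 i')%N = (i < i')%N.
Proof.
by case: j0_ext => ->; rewrite ?lift_max // !lift0 ltnS.
Qed.

Lemma is_drop_lift sigma i :
  is_drop (lift_perm ord_max j0 sigma) (lift ord_max i) = is_drop sigma i.
Proof.
rewrite /is_drop lift_max; congr (_ && _); rewrite forall_lift_max.
rewrite max_lt implyFb andTb.
by apply: eq_forallb => i'; rewrite lift_max !lift_perm_lift lift_mono.
Qed.

Lemma is_rise_lift sigma i :
  is_rise (lift_perm ord_max j0 sigma) (lift ord_max i) = is_rise sigma i.
Proof.
rewrite /is_rise lift_max; congr (_ && _); rewrite forall_lift_max.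
rewrite max_lt implyFb andTb.
by apply: eq_forallb => i'; rewrite lift_max !lift_perm_lift lift_mono.
Qed.

Lemma is_drop_last sigma :
  is_drop (lift_perm ord_max j0 sigma) ord_max = (j0 == ord0).
Proof.
rewrite /is_drop k_gt0 forall_lift_max ltnn implyFb !andTb lift_perm_id.
apply/forallP/eqP => [|-> i].
  move/(_ (Ordinal k_gt0)); rewrite lift_max lift_perm_lift k_gt0 implyTb.
  case: j0_ext => // ->; rewrite lift_max ltnNge /= ltnW //.
by rewrite lift_perm_lift lift0 implybT.
Qed.

Lemma is_rise_last sigma :
  is_rise (lift_perm ord_max j0 sigma) ord_max = (j0 == ord_max).
Proof.
rewrite /is_rise k_gt0 forall_lift_max ltnn implyFb !andTb lift_perm_id.
apply/forallP/eqP => [|-> i].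
  move/(_ (Ordinal k_gt0)); rewrite lift_max lift_perm_lift k_gt0 implyTb.
  by case: j0_ext => // ->; rewrite lift0 ltn0.
by rewrite lift_perm_lift !lift_max; apply/implyP => _; apply: ltn_ord.
Qed.

Lemma drop_sum_lift sigma : drop_sum (lift_perm ord_max j0 sigma) =
  (drop_sum sigma + (if j0 == ord0 then k.+1 else 0))%N.
Proof.
rewrite /drop_sum big_mkcond big_ord_recr /= is_drop_last; congr (_ + _)%N.
rewrite [RHS]big_mkcond; apply: eq_bigr => i _.
rewrite widen_lift.
by rewrite is_drop_lift.
Qed.

Lemma monotone_from_lift m sigma : monotone_from m (lift_perm ord_max j0 sigma) =
  monotone_from (if j0 == ord0 then m.-1 else m) sigma && ((j0 == ord0) ==> (0 < m)%N).
Proof.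
rewrite /monotone_from forall_lift_max /= gtn_eqF // is_drop_last is_rise_last.
have -> : (j0 == ord_max) || (j0 == ord0) by case: j0_ext => ->; rewrite eqxx ?orbT.
have E i : (if lift ord_max i == 0%N :> nat
   then (lift_perm ord_max j0 sigma (lift ord_max i)).+1 == m
   else is_rise (lift_perm ord_max j0 sigma) (lift ord_max i)
        || is_drop (lift_perm ord_max j0 sigma) (lift ord_max i)) =
  (if i == 0%N :> nat then (lift j0 (sigma i)).+1 == m
   else is_rise sigma i || is_drop sigma i).
  by rewrite lift_max is_rise_lift is_drop_lift lift_perm_lift.
rewrite (eq_forallb E) andTb; case: ifP => [/eqP j00|/negbT jN0].
  rewrite j00 implyTb; case: m {E} => [|m].
    rewrite andbF; apply/negbTE/forallPn; exists (Ordinal k_gt0).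
    by rewrite eqxx.
  by rewrite andbT; apply: eq_forallb => i; rewrite lift0 eqSS.
rewrite implyFb andbT; apply: eq_forallb => i; case: j0_ext => j0E; last by rewrite j0E in jN0.
by rewrite j0E lift_max.
Qed.
End MonotonePerm.

Section MonotoneSum.
Context (A : comNzRingType) (M : lmodType A).
Implicit Types (f : seq A -> M) (e : nat -> A).
Ltac lmod := lmod_with A M.

Definition monotone_sum k m f e : M :=
  \sum_(pi : 'S_k | monotone_from m pi)
     alt_sign A (drop_sum pi) *: f [seq e (pi j) | j <- enum 'I_k].

Lemma monotone_sum_ext k m f e e' : (forall i, (i < k)%N -> e i = e' i) ->
  monotone_sum k m f e = monotone_sum k m f e'.
Proof.
move=> ee; apply: eq_bigr => pi _; congr (_ *: f _).
by apply: eq_map => j; apply: ee.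
Qed.

Lemma monotone_sum_out k m f e : (0 < k)%N -> (m == 0%N) || (k < m)%N -> monotone_sum k m f e = 0.
Proof.
move=> k0 mk; apply: big_pred0 => pi; apply/negbTE; apply: contraL mk => /forallP.
by move/(_ (Ordinal k0)); rewrite eqxx => /eqP <-; rewrite /= -leqNgt ltn_ord.
Qed.

Lemma monotone_sumS k m f e : (0 < k)%N ->
  monotone_sum k.+1 m f e =
  monotone_sum k m (fun w => f (rcons w (e k))) e
  + alt_sign A k.+1 *: (if m is m'.+1 then
      monotone_sum k m' (fun w => f (rcons w (e 0%N))) (fun i => e i.+1) else 0).
Proof.
move=> k0; rewrite /monotone_sum.
have max0 : ord_max != ord0 :> 'I_k.+1 by rewrite -val_eqE /= -lt0n.
rewrite (bigID (fun pi : 'S_k.+1 => pi ord_max == ord_max)) /=; congr (_ + _).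
  rewrite (eq_bigl (fun pi : 'S_k.+1 => (pi ord_max == ord_max) && monotone_from m pi)); last first.
    by move=> pi; rewrite andbC.
  rewrite big_mkcondr (reindex (lift_perm ord_max ord_max)); last exact: lift_perm_bij.
  rewrite (eq_bigl xpredT) => [|sigma]; last by rewrite lift_perm_id eqxx.
  rewrite [RHS]big_mkcond; apply: eq_bigr => sigma _.
  rewrite monotone_from_lift ?(negbTE max0) ?andbT //; last by left.
  case: ifP => // _; rewrite drop_sum_lift ?(negbTE max0) ?addn0 //; last by left.
  congr (_ *: f _); rewrite enum_ordSr map_rcons lift_perm_id -map_comp; congr rcons.
  apply: eq_map => i /=.
  rewrite widen_lift.
  by rewrite lift_perm_lift lift_max.
transitivity (\sum_(pi : 'S_k.+1 | (pi ord_max == ord0) && monotone_from m pi)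
     alt_sign A (drop_sum pi) *: f [seq e (pi j) | j <- enum 'I_k.+1]).
  apply: eq_bigl => pi; rewrite andbC; case: (boolP (monotone_from m pi)); rewrite ?andbF //.
  move=> /forallP/(_ ord_max); rewrite (gtn_eqF k0) !andbT => rd.
  apply/idP/eqP => [ne|->]; last by rewrite eq_sym.
  by case/orP: rd => [/rise_last E|/drop_last //]; rewrite E eqxx in ne.
rewrite big_mkcondr (reindex (lift_perm ord_max ord0)); last exact: lift_perm_bij.
rewrite (eq_bigl xpredT) => [|sigma]; last by rewrite lift_perm_id eqxx.
case: m => [|m].
  rewrite scaler0 big1 // => sigma _.
  by rewrite monotone_from_lift ?eqxx ?andbF //; right.
rewrite [X in _ *: X]big_mkcond scaler_sumr; apply: eq_bigr => sigma _.
rewrite monotone_from_lift //; last by right.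
rewrite eqxx implyTb andbT [m.+1.-1]/=.
case: ifP => _; last by rewrite scaler0.
rewrite drop_sum_lift ?eqxx //; last by right.
rewrite scalerA; congr (_ *: f _).
  by rewrite /alt_sign oddD; case: (odd k.+1); case: odd; rewrite /= ?mulrNN ?mulr1 ?mul1r.
rewrite enum_ordSr map_rcons lift_perm_id -map_comp; congr rcons.
by apply: eq_map => i /=; rewrite widen_lift lift_perm_lift lift0.
Qed.

(** The last letter of a monotone word is the last letter of q or the first one of p,
    according as its position is a rise or a drop. The shuffles of the reversal of p with
    q have the same recursion, [shsum_rcons], and the signs of the drops differ from
    those of the shuffles by [rev_sign]. *)
Lemma monotone_sumE f p a q :
  monotone_sum (size p + size q).+1 (size p).+1 f (nth 0 (p ++ a :: q)) =
  rev_sign A (size p) *: shsum (fun w => f (a :: w)) (rev p) q.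
Proof.
move E : (size p + size q)%N => k.
elim: k p q f E => [|k IH] p q f.
  case: p => //; case: q => // _.
  rewrite shsum0s /rev_sign /alt_sign /= scale1r /monotone_sum.
  rewrite (big_pred1 (1%g : 'S_1)) => [|pi].
    rewrite /drop_sum big_pred0 => [|i]; last by rewrite ord1 /is_drop ltnn.
    by rewrite scale1r enum_ordSl /= perm1 enum_ord0.
  transitivity true; last by apply/esym/eqP/permP => i; rewrite [LHS]ord1 [RHS]ord1.
  by apply/forallP => i; rewrite (ord1 i) (ord1 (pi _)).
move=> E; rewrite monotone_sumS //.
case/lastP: q E => [|q b]; last rewrite size_rcons.
  rewrite addn0 => E; rewrite (monotone_sum_out _ _ (k := k.+1)) ?E ?ltnSn ?orbT // add0r.
  case: p E => // c p [E].
  have := IH p [::] (fun w => f (rcons w c)); rewrite addn0 E => /(_ erefl) /= => ->.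
  rewrite -E !shsums0 rev_cons /= rev_signS /alt_sign /= negbK.
  by case: (odd (size p)); rewrite ?scaleN1r ?mulN1r ?scaleNr ?scale1r ?mul1r.
rewrite addnS => -[E].
have nth_last : nth 0 (p ++ a :: rcons q b) k.+1 = b.
  by rewrite -E -rcons_cons -rcons_cat nth_rcons size_cat /= addnS ltnn eqxx.
have nth_init i : (i < k.+1)%N -> nth 0 (p ++ a :: rcons q b) i = nth 0 (p ++ a :: q) i.
  by move=> ik; rewrite -rcons_cons -rcons_cat nth_rcons size_cat /= addnS E ik.
rewrite nth_last (monotone_sum_ext _ _ nth_init) IH //.
case: p E {nth_last nth_init} => [|c p] E.
  rewrite (monotone_sum_out _ _ (k := k.+1)) // scaler0 addr0 /= !shsum0s; congr (_ *: f _).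
have Er : (size p + size (rcons q b))%N = k by rewrite size_rcons addnS.
have := IH p (rcons q b) (fun w => f (rcons w c)) Er => /= ->.
rewrite rev_cons shsum_rcons /= !rev_signS -E /alt_sign /= !negbK oddD.
by case: (odd (size p)); case: (odd (size q)) => /=; lmod.
Qed.
End MonotoneSum.

Section HarrisonShuffle.
Context (F : fieldType) (A : comAlgType F) (D : {linear A -> A}).
Context (DM : leibniz D) (s : nat).
Implicit Types (t u : 'I_s) (a b : A) (w : seq A) (v : word A s).
Implicit Types (f : cochain D s) (p q : seq A).
Local Notation blk := (in_block DM).

Lemma harrison_sum v t f p a q : v t = p ++ a :: q ->
  \sum_(pi : 'S_(size (v t)) | monotone_from (size p).+1 pi)
     (-1) ^+ drop_sum pi *: f (set_block v t (perm_seq pi)) =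
  rev_sign A (size p) *: shsum (fun w => blk f v t (a :: w)) (rev p) q.
Proof.
move=> E; rewrite -(monotone_sumE (blk f v t)) -E.
have -> : (size p + size q).+1 = size (v t) by rewrite E size_cat addnS.
by apply: eq_bigr => pi _; rewrite lam_module_sign.
Qed.

(** The conditions say that f may be computed with any letter brought to the front.
    Doing this in two ways for the reversal of a nonempty word followed by another one,
    with either of the two middle letters in front, gives the vanishing on shuffles. *)
Lemma harrison_shuffle_free f : harrison f -> forall v t, shuffle_free (blk f v t).
Proof.
move=> H v t a x b y.
have H' p c q : blk f v t (p ++ c :: q) =
    rev_sign A (size p) *: shsum (fun w => blk f v t (c :: w)) (rev p) q.
  case: p => [|p0 p]; first by rewrite shsum0s scale1r.
  set pc := p0 :: p; pose v' := set_block v t (pc ++ c :: q).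
  have E : v' t = pc ++ c :: q by apply: set_blockE.
  have mb : (2 <= (size pc).+1 <= size (v' t))%N.
    by rewrite E size_cat /= addnS !ltnS leq_addr.
  have := harrison_sum f E; rewrite (H v' t _ mb) => fE.
  transitivity (f v' : lam_module DM t) => //; rewrite fE; congr (_ *: _).
  by apply: shsum_ext => w; rewrite /in_block set_block2.
have := H' (rev (a :: x)) b y.
rewrite rev_cons cat_rcons H' -rev_cons !revK !size_rev /= rev_signS.
move/(congr1 ( *:%R (rev_sign A (size x)))); rewrite !scalerA mulrCA rev_sign_sq scale1r mulr1.
rewrite shsum_cons => ->.
by rewrite /alt_sign /=; case: (odd (size x)); rewrite /= ?scale1r ?scaleN1r ?subrr ?addNr.
Qed.

Lemma shuffle_free_harrison f : (forall v t, shuffle_free (blk f v t)) -> harrison f.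
Proof.
move=> H v t m /andP[m1 m2].
pose p := take m.-1 (v t); pose q := drop m (v t); pose a := (v t)`_m.-1.
have E : v t = p ++ a :: q.
  by rewrite /p /a /q -[m in drop m](ltn_predK m1) -drop_nth ?cat_take_drop // prednK // ltnW.
have sp : (size p).+1 = m.
  rewrite size_take; case: ltnP => [_|]; first by rewrite prednK // ltnW.
  by rewrite leqNgt prednK ?m2 // ltnW.
rewrite -{1}sp (harrison_sum f E) -(size_rev p).
rewrite -(shuffle_free_catrev _ _ _ (H v t)) catrevE revK -E /in_block.
by rewrite set_block_id.
Qed.
End HarrisonShuffle.

(** * Polarization of differential polynomials *)

Section Expansion.
Context (F : fieldType) (N : nat) (M : zmodType).
Local Notation A := (diffpoly F N).
Local Notation mono := (@dpmono F N).
Implicit Types (m : diffmonom N) (a b : A).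
Variable G : diffmonom N -> F -> M.
Hypothesis GD : forall m c e, G m (c + e) = G m c + G m e.

(** The additive extension to all polynomials of a function of one term. *)
Definition expand a : M := \sum_(m <- monalg.msupp a) G m (monalg.mcoeff m a).

Let G0 m : G m 0 = 0.
Proof. by apply: (addrI (G m 0)); rewrite -GD !addr0. Qed.

Lemma expandEw (d : {fset diffmonom N}) a : (monalg.msupp a `<=` d)%fset ->
  expand a = \sum_(m <- d) G m (monalg.mcoeff m a).
Proof.
move=> le; rewrite [LHS](big_fset_incl _ le) //= => m md.
by move/mcoeff_outdom => ->; apply: G0.
Qed.

Lemma expand_mono m : expand (mono m) = G m 1.
Proof.
rewrite dpmono.unlock (@expandEw [fset m]%fset) ?msuppU_le //.
by rewrite big_seq_fset1 monalg.mcoeffUU.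
Qed.
End Expansion.

Lemma expand_lin (F : fieldType) N (M : zmodType) (G : diffmonom N -> F -> M)
    (GD : forall m c e, G m (c + e) = G m c + G m e) k (a b : diffpoly F N) :
  expand G (k *: a + b) = expand (fun m c => G m (k * c)) a + expand G b.
Proof.
pose d := (monalg.msupp a `|` monalg.msupp b `|` monalg.msupp (k *: a + b)%R)%fset.
have E1 := @expandEw _ _ _ _ GD d (k *: a + b) (fsubsetUr _ _).
have la : (monalg.msupp a `<=` d)%fset by rewrite /d -fsetUA fsubsetUl.
have lb : (monalg.msupp b `<=` d)%fset by rewrite /d fsetUAC fsubsetUr.
have GD' m c e : G m (k * (c + e)) = G m (k * c) + G m (k * e) by rewrite mulrDr GD.
apply: etrans E1 _.
apply: etrans _ (esym (f_equal2 +%R (expandEw GD' la) (expandEw GD lb))).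
rewrite -big_split /=; apply: eq_bigr => m _.
by rewrite monalg.mcoeffD monalg.mcoeffZ GD.
Qed.

Lemma expand_scale (F : fieldType) N (R : nzRingType) (M : lmodType R) (r : R)
    (G H : diffmonom N -> F -> M) (GH : forall m c, G m c = r *: H m c) (a : diffpoly F N) :
  expand G a = r *: expand H a.
Proof. by rewrite /expand scaler_sumr; apply: eq_bigr => m _. Qed.

Section BilinearSums.
Context (F : fieldType) (A : comAlgType F) (M : lmodType A).
Context (I : Type) (mono : I -> A) (pol : A -> seq (A * A)).
Implicit Types (a b c x y : A) (B : A -> A -> M) (k : F).

Lemma bilinear0r B a : bilinear B -> B a 0 = 0.
Proof.
case=> _ /(_ a 1 0 0); rewrite !scale1r addr0 => /eqP.
by rewrite -subr_eq0 opprD addNKr oppr_eq0 => /eqP.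
Qed.

Lemma bilinearZr B k a b : bilinear B -> B a (k *: b) = k%:A *: B a b.
Proof. by move=> HB; have [_ /(_ a k b 0)] := HB; rewrite addr0 bilinear0r // addr0. Qed.

Lemma bilinear_mulr B b : bilinear B -> bilinear (fun x y => B x (y * b)).
Proof.
case=> Bl Br; split=> [k x1 x2 y|x k y1 y2]; first exact: Bl.
by rewrite mulrDl -scalerAl Br.
Qed.

Lemma scalar_natA k n : (k * n%:R)%:A = k%:A * n%:R :> A.
Proof. by rewrite -scalerA scaler_nat mulr_algl. Qed.

Hypothesis span : forall P : A -> Prop,
  P 0 -> (forall k m a, P a -> P (k *: mono m + a)) -> forall a, P a.
Hypothesis polL : forall B k a b, bilinear B ->
  tensor_sum B (pol (k *: a + b)) = k%:A *: tensor_sum B (pol a) + tensor_sum B (pol b).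

Lemma pol0 B : bilinear B -> tensor_sum B (pol 0) = 0.
Proof.
move=> HB; have := polL 1 0 0 HB; rewrite !scale1r addr0 => /eqP.
by rewrite -subr_eq0 opprD addNKr oppr_eq0 => /eqP.
Qed.

Lemma polM_span :
  (forall B m1 m2, bilinear B -> tensor_sum B (pol (mono m1 * mono m2)) =
     tensor_sum (fun x y => B x (y * mono m2)) (pol (mono m1))
   + tensor_sum (fun x y => B x (y * mono m1)) (pol (mono m2))) ->
  forall B a b, bilinear B -> tensor_sum B (pol (a * b)) =
     tensor_sum (fun x y => B x (y * b)) (pol a) + tensor_sum (fun x y => B x (y * a)) (pol b).
Proof.
have mulL B k b1 b2 s : bilinear B -> tensor_sum (fun x y => B x (y * (k *: b1 + b2))) s =
   k%:A *: tensor_sum (fun x y => B x (y * b1)) s + tensor_sum (fun x y => B x (y * b2)) s.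
  case=> _ Br; rewrite /tensor_sum scaler_sumr -big_split; apply: eq_bigr => p _ /=.
  by rewrite mulrDr -scalerAr Br.
have mul0 B s : bilinear B -> tensor_sum (fun x y => B x (y * 0)) s = 0.
  by move=> HB; rewrite /tensor_sum big1 // => p _; rewrite mulr0 bilinear0r.
move=> H B a b HB; elim/span: a => [|k m1 a IHa].
  by rewrite mul0r !pol0 ?mul0 ?addr0 //; apply: bilinear_mulr.
rewrite mulrDl -scalerAl !polL ?IHa ?mulL //; last exact: bilinear_mulr.
rewrite addrACA -scalerDr; congr (_ *: _ + _).
elim/span: b {IHa} => [|e m2 b IHb].
  by rewrite mulr0 !pol0 ?mul0 ?addr0 //; apply: bilinear_mulr.
rewrite mulrDr -scalerAr !polL ?IHb ?mulL ?H //; last exact: bilinear_mulr.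
by rewrite addrACA -scalerDr.
Qed.
End BilinearSums.

Section PolDer.
Context (F : fieldType) (A : comAlgType F) (M : lmodType A) (D : {linear A -> A}).
Context (DM : forall a b, D (a * b) = D a * b + a * D b).
Context (I : Type) (mono : I -> A) (pol : A -> seq (A * A)).
Implicit Types (a b c x y : A) (B : A -> A -> M) (k : F).
Hypothesis span : forall P : A -> Prop,
  P 0 -> (forall k m a, P a -> P (k *: mono m + a)) -> forall a, P a.
Hypothesis polL : forall B k a b, bilinear B ->
  tensor_sum B (pol (k *: a + b)) = k%:A *: tensor_sum B (pol a) + tensor_sum B (pol b).
Hypothesis polM : forall B a b, bilinear B -> tensor_sum B (pol (a * b)) =
     tensor_sum (fun x y => B x (y * b)) (pol a) + tensor_sum (fun x y => B x (y * a)) (pol b).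

Definition pol_der_at a := forall B, bilinear B ->
  tensor_sum B (pol (D a)) = tensor_sum (fun x y => B (D x) y + B x (D y)) (pol a).

Lemma bilinear_der B : bilinear B -> bilinear (fun x y => B (D x) y + B x (D y)).
Proof.
case=> Bl Br; split=> [k x1 x2 y|x k y1 y2].
  by rewrite linearP /= !Bl scalerDr addrACA.
by rewrite linearP /= !Br scalerDr addrACA.
Qed.

Lemma tensor_sumD B B' s : tensor_sum (fun x y => B x y + B' x y) s = tensor_sum B s + tensor_sum B' s.
Proof. exact: big_split. Qed.

Lemma pol_derM a b : pol_der_at a -> pol_der_at b -> pol_der_at (a * b).
Proof.
move=> Ha Hb B HB; have [_ Br] := HB.
rewrite DM -[D a * b]scale1r polL // scale1r scale1r !polM //; last exact: bilinear_der.
rewrite Ha ?Hb; try exact: bilinear_mulr.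
have BrD x y z : B x (y + z) = B x y + B x z.
  by rewrite -[y]scale1r Br !scale1r.
have E c : tensor_sum (fun x y => B (D x) (y * c) + B x (D (y * c))) =1
    fun s => tensor_sum (fun x y => B (D x) (y * c) + B x (D y * c)) s
      + tensor_sum (fun x y => B x (y * D c)) s.
  move=> s; rewrite -tensor_sumD; apply: eq_bigr => p _; by rewrite DM BrD addrA.
rewrite !E -!addrA; congr (_ + _).
by rewrite [LHS]addrC [RHS]addrA.
Qed.

Lemma pol_der_span : (forall m, pol_der_at (mono m)) -> forall a, pol_der_at a.
Proof.
move=> H a B HB; elim/span: a => [|k m a IH].
  by rewrite linear0 !(pol0 polL) //; apply: bilinear_der.
rewrite linearP !polL //; last exact: bilinear_der.
by rewrite H // IH.
Qed.
End PolDer.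

Lemma scalar_mulA (F : fieldType) (A : comAlgType F) (k c : F) :
  (k * c)%:A = k%:A * c%:A :> A.
Proof. by rewrite mulr_algl scalerA. Qed.

Section Polarization.
Context (F : fieldType) (N : nat).
Local Notation A := (diffpoly F N).
Local Notation mono := (@dpmono F N).
Implicit Types (m : diffmonom N) (x : diffvar N) (a b : A).

Definition mdivx m x : diffmonom N := divcm m (ucm x).
Definition monoX x : A := mono (ucm x).

(** The tensor sum_x x (x) da/dx, in which only the variables occurring in a appear. *)
Definition polarization a : seq (A * A) :=
  flatten [seq [seq (monoX x, (monalg.mcoeff m a * (m x)%:R) *: mono (mdivx m x))
                 | x <- finsupp m] | m <- monalg.msupp a].

Section Evaluation.
Context (M : lmodType A).
Implicit Types (B : A -> A -> M).

Definition tensor_sum_mono B m : M :=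
  \sum_(x <- finsupp m) (m x)%:R *: B (monoX x) (mono (mdivx m x)).

Lemma tensor_sum_polE B a : bilinear B ->
  tensor_sum B (polarization a) = expand (fun m c => c%:A *: tensor_sum_mono B m) a.
Proof.
move=> HB; rewrite /tensor_sum /polarization big_flatten big_map; apply: eq_bigr => m _.
rewrite big_map scaler_sumr; apply: eq_bigr => x _ /=.
by rewrite bilinearZr // scalar_natA -scalerA.
Qed.

Lemma expand_coefD B m c e :
  (c + e)%:A *: tensor_sum_mono B m = c%:A *: tensor_sum_mono B m + e%:A *: tensor_sum_mono B m.
Proof. by rewrite !scalerDl. Qed.

Lemma tensor_sum_pol_mono B m : bilinear B ->
  tensor_sum B (polarization (mono m)) = tensor_sum_mono B m.
Proof.
move=> HB; apply: etrans (tensor_sum_polE _ HB) _.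
by apply: etrans (expand_mono (expand_coefD B) m) _; rewrite !scale1r.
Qed.

Lemma pol_linear B k a b : bilinear B ->
  tensor_sum B (polarization (k *: a + b)) =
  k%:A *: tensor_sum B (polarization a) + tensor_sum B (polarization b).
Proof.
move=> HB; apply: etrans (tensor_sum_polE _ HB) _.
apply: etrans (expand_lin (expand_coefD B) _ _ _) _.
apply: f_equal2; last exact/esym/tensor_sum_polE.
apply: etrans _ (esym (f_equal (fun u : M => k%:A *: u) (tensor_sum_polE a HB))).
apply: expand_scale => m c; apply: etrans (esym (scalerA _ _ _)).
exact: (f_equal (fun r : A => r *: tensor_sum_mono B m) (scalar_mulA A k c)).
Qed.

Lemma tensor_sum_monoEw (d : {fset diffvar N}) B m : (finsupp m `<=` d)%fset ->
  tensor_sum_mono B m = \sum_(x <- d) (m x)%:R *: B (monoX x) (mono (mdivx m x)).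
Proof.
move=> le; rewrite /tensor_sum_mono [LHS](big_fset_incl _ le) //= => x xd.
by move/fsfun_dflt => ->; rewrite scale0r.
Qed.

Lemma mdivxMl m1 m2 x : m1 x != 0%N -> mdivx (mmul m1 m2) x = mmul (mdivx m1 x) m2.
Proof.
move=> m1x; apply/eqP/cmP => y; rewrite !cmM !divcmE !cmM !cmU.
by case: (eqVneq x y) m1x => [<-|_] /=; lia.
Qed.

Lemma mdivxMr m1 m2 x : m2 x != 0%N -> mdivx (mmul m1 m2) x = mmul (mdivx m2 x) m1.
Proof.
move=> m1x; apply/eqP/cmP => y; rewrite !cmM !divcmE !cmM !cmU.
by case: (eqVneq x y) m1x => [<-|_] /=; lia.
Qed.

Lemma tensor_sum_monoM B m1 m2 : tensor_sum_mono B (mmul m1 m2) =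
  tensor_sum_mono (fun a b => B a (b * mono m2)) m1 + tensor_sum_mono (fun a b => B a (b * mono m1)) m2.
Proof.
pose d := (finsupp m1 `|` finsupp m2)%fset.
have le : (finsupp (mmul m1 m2) `<=` d)%fset by rewrite mdomD.
apply: etrans (tensor_sum_monoEw B le) _.
apply: etrans _ (esym (f_equal2 +%R (tensor_sum_monoEw _ (fsubsetUl _ _ : finsupp m1 `<=` d)%fset)
                                    (tensor_sum_monoEw _ (fsubsetUr _ _ : finsupp m2 `<=` d)%fset))).
apply: etrans _ (big_split _ _ _ _ _); apply: eq_bigr => x _.
rewrite cmM natrD scalerDl; apply: f_equal2.
  have [->|m1x] := eqVneq (m1 x) 0%N; first by rewrite !scale0r.
  by rewrite mdivxMl // dpmonoM.
have [->|m2x] := eqVneq (m2 x) 0%N; first by rewrite !scale0r.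
by rewrite mdivxMr // dpmonoM.
Qed.

Lemma pol_mul B a b : bilinear B -> tensor_sum B (polarization (a * b)) =
  tensor_sum (fun x y : A => B x (y * b)) (polarization a)
  + tensor_sum (fun x y : A => B x (y * a)) (polarization b).
Proof.
apply: (@polM_span F A M _ mono polarization (@diffpoly_ind F N) pol_linear) => {a b}B m1 m2 HB.
rewrite -dpmonoM tensor_sum_pol_mono // tensor_sum_monoM.
by apply: f_equal2; apply/esym/tensor_sum_pol_mono/bilinear_mulr.
Qed.

Lemma dpmono1 : mono mone = 1.
Proof. by rewrite dpmono.unlock. Qed.

Lemma tensor_sum_pol_var B x : bilinear B -> tensor_sum B (polarization (monoX x)) = B (monoX x) 1.
Proof.
move=> HB; rewrite tensor_sum_pol_mono // /tensor_sum_mono mdomU big_seq_fset1 cmUU scale1r.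
congr (B _ _); rewrite -dpmono1; congr mono.
by apply/eqP/cmP => y; rewrite divcmE subnn cm1.
Qed.

Lemma tensor_sum_pol1 B : bilinear B -> tensor_sum B (polarization 1) = 0.
Proof.
move=> HB; rewrite -dpmono1 tensor_sum_pol_mono // /tensor_sum_mono mdom1 big_seq_fset0 //.
Qed.

Lemma mdivxK m x : m x != 0%N -> mmul (ucm x) (mdivx m x) = m.
Proof.
move=> mx; apply/eqP/cmP => y; rewrite cmM divcmE cmU.
by have [<-|_] := eqVneq x y; rewrite ?add0n ?subn0 // add1n subn1 prednK ?lt0n.
Qed.

Lemma mdeg_neq0 m : monalg.mdeg m != 0%N -> exists x, m x != 0%N.
Proof.
move=> mN; have : finsupp m != fset0.
  by apply: contra_neq mN => m0; rewrite monalg.mdegE m0 big_seq_fset0.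
by case/fset0Pn => x xm; exists x; rewrite cmE_neq0.
Qed.

Lemma mono_ind (P : A -> Prop) :
  P 1 -> (forall x a, P a -> P (monoX x * a)) -> forall m, P (mono m).
Proof.
move=> P1 PX m; move: {-1}(monalg.mdeg m) (erefl (monalg.mdeg m)) => n.
elim: n m => [|n IH] m mn; first by rewrite (monalg.mdeg_eq0I mn) dpmono1.
have [|x mx] := @mdeg_neq0 m; first by rewrite mn.
rewrite -(mdivxK mx) dpmonoM; apply/PX/IH.
by have := monalg.mdegM (ucm x) (mdivx m x); rewrite mdivxK // monalg.mdegU mn add1n => -[->].
Qed.

Lemma monoXE x : monoX x = dpX F x.1 x.2.
Proof. by case: x. Qed.

(** By induction on monomials and the Leibniz rule it is enough to look at a variable x,
    where both sides are Dx (x) 1. *)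
Lemma pol_der B a : bilinear B -> tensor_sum B (polarization (dpder a)) =
   tensor_sum (fun x y : A => B (dpder x) y + B x (dpder y)) (polarization a).
Proof.
move: a B; apply: (@pol_der_span F A M (@dpder F N) _ mono polarization (@diffpoly_ind F N) pol_linear).
have D1 : dpder (1 : A) = 0 by apply: (der1 (@dpderM F N)).
have DX x : dpder (monoX x) = monoX (x.1, x.2.+1) by rewrite !monoXE dpderX.
apply: mono_ind => [|x a Ha].
  move=> B HB; apply: etrans (f_equal (fun z => tensor_sum B (polarization z)) D1) _.
  by rewrite (pol0 pol_linear HB) tensor_sum_pol1 //; apply: bilinear_der.
refine (@pol_derM F A M (@dpder F N) (@dpderM F N) polarization pol_linear pol_mul _ _ _ Ha).
move=> B HB.
apply: etrans (f_equal (fun z => tensor_sum B (polarization z)) (DX x)) _.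
apply: etrans (tensor_sum_pol_var _ HB) _.
apply: etrans _ (esym (tensor_sum_pol_var x (bilinear_der _ HB))) => /=.
apply: etrans (f_equal (fun z => B z 1) (esym (DX x))) _.
by rewrite -[LHS]addr0; congr (_ + _); rewrite -(bilinear0r (monoX x) HB) -D1.
Qed.
End Evaluation.
End Polarization.

(** * The total contraction *)

Section Total.
Context (F : fieldType) (A : comAlgType F) (D : {linear A -> A}).
Context (DM : leibniz D) (s : nat).
Implicit Types (t u : 'I_s) (a b : A) (w : seq A) (v : word A s).
Implicit Types (f : cochain D s) (Phi Psi : seq A -> chain A).
Local Notation Q := (lamquot D s).
Local Notation blk := (in_block DM).
Local Notation totop := (total_op DM).
Local Notation bop := (block_op DM).

(** The conditions on a symmetric Harrison cochain, expressed on the functions of one block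
    obtained by fixing all others. *)
Definition symHar_blocks n f :=
  [/\ forall v, wlen v != n -> f v = 0, forall v u, multilin (blk f v u),
      forall v u, sesq (blk f v u), forall v u, shuffle_free (blk f v u)
    & forall sigma, sym_act sigma f =1 f].

Lemma symHar_blocksP n f : symHar_cochain n f <-> symHar_blocks n f.
Proof.
split=> [[[Hn L S H] sym]|[Hn L S H sym]]; last split=> //; split=> //.
- exact: multilinear_multilin.
- exact: sesquilinear_sesq.
- exact: harrison_shuffle_free.
- exact: multilin_multilinear L.
- exact: sesq_sesquilinear S.
- exact: shuffle_free_harrison H.
Qed.

Lemma parity_bar_chain : parity_odd (@bar_chain A).
Proof.
move=> [|a w] p // pb; have /allP/(_ p pb)/eqP -> := csize_bar_chain (a :: w).
by rewrite /= negbK.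
Qed.

Lemma total_op_support Phi n m f :
  (forall w p, p \in Phi w -> (size p.2 + m = size w + n)%N) ->
  (forall v, wlen v != n -> f v = 0) -> forall v, wlen v != m -> totop Phi f v = 0.
Proof.
move=> sz f0 v vm; rewrite /total_op big1 // => t _.
rewrite block_opE big1_seq ?scaler0 // => p /= pP.
rewrite f0; first exact: (@scaler0 A (lam_module DM t)).
apply: contra_neq vm => E; apply: (@addIn (size p.2)).
by rewrite -(wlen_set_block v t) E [RHS]addnC (sz _ _ pP) addnC.
Qed.

Lemma symHar_blocks_total_op Phi n m f : parity_odd Phi ->
  (forall w p, p \in Phi w -> (size p.2 + m = size w + n)%N) ->
  (forall u (G : seq A -> lam_module DM u), multilin G -> multilin (fun w => ev G (Phi w))) ->
  (forall u (G : seq A -> lam_module DM u), shuffle_free G -> shuffle_free (fun w => ev G (Phi w))) ->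
  (forall u (G : seq A -> lam_module DM u), multilin G -> forall w,
     letters (der_letter D) (fun w => ev G (Phi w)) w =
     ev (letters (der_letter D) G) (Phi w) + der_coefs D G (Phi w)) ->
  symHar_blocks n f -> symHar_blocks m (totop Phi f).
Proof.
move=> oPhi sz Lop Hop Sop [Hn L S H sym]; split.
- exact: total_op_support sz Hn.
- exact: multilin_total_op.
- exact: sesq_total_op.
- exact: shuffle_free_total_op.
- by move=> sigma; apply: sym_act_total_op_id.
Qed.

Lemma symHar_blocks_diff n f : symHar_blocks n f -> symHar_blocks n.+1 (diff f).
Proof.
move=> gf; have -> : diff f = totop (@bar_chain A) f by apply/funext/diff_total_op.
apply: symHar_blocks_total_op gf => //.
- exact: parity_bar_chain.
- move=> [|a w] p // pb; have /allP/(_ p pb)/eqP -> := csize_bar_chain (a :: w).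
  by rewrite /= addnS.
- by move=> u G; apply: multilin_bar.
- by move=> u G; apply: shuffle_free_bar.
- by move=> u G L w; apply: (letters_der_bar DM).
Qed.

Lemma block_op_comp Phi Psi t f v :
  bop Phi t (bop Psi t f) v = ev (fun w => ev (blk f v t) (Psi w)) (Phi (v t)).
Proof. by apply: (@ev_ext A (lam_module DM t)) => w; rewrite -block_op_set_block. Qed.

(** Anticommutation of the differential with itself gives 2 d d = 0. *)
Lemma diff_diff f : 2%:R != 0 :> F -> diff (diff f) =1 fun=> 0.
Proof.
move=> two v; have Ed : diff f = totop (@bar_chain A) f by apply/funext/diff_total_op.
rewrite Ed diff_total_op; have := total_op_anticomm DM f v parity_bar_chain parity_bar_chain.
rewrite big1 => [|t _]; last first.
  rewrite block_op_comp.
  have -> : ev (fun w => ev (blk f v t) (bar_chain w)) (bar_chain (v t)) = 0 := bar_bar _ _.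
  exact: addr0.
rewrite -mulr2n -scaler_nat => /eqP.
by rewrite scaler_eq0 (negbTE two) => /eqP.
Qed.

Section Homotopy.
Context (pol : A -> seq (A * A)).
Hypothesis polL : forall (M : lmodType A) (B : A -> A -> M) (k : F) (a b : A), bilinear B ->
  tensor_sum B (pol (k *: a + b)) = k%:A *: tensor_sum B (pol a) + tensor_sum B (pol b).
Hypothesis polM : forall (M : lmodType A) (B : A -> A -> M) a b, bilinear B ->
  tensor_sum B (pol (a * b)) = tensor_sum (fun x y : A => B x (y * b)) (pol a)
                       + tensor_sum (fun x y : A => B x (y * a)) (pol b).
Hypothesis polD : forall (M : lmodType A) (B : A -> A -> M) a, bilinear B ->
  tensor_sum B (pol (D a)) = tensor_sum (fun x y : A => B (D x) y + B x (D y)) (pol a).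

Definition total_contr f := totop (contr_chain pol) f.

Lemma parity_contr_chain : parity_odd (contr_chain pol).
Proof.
by move=> w p ph; have /allP/(_ p ph)/eqP -> := csize_contr_chain pol w.
Qed.

Lemma symHar_blocks_contr n f : symHar_blocks n.+1 f -> symHar_blocks n (total_contr f).
Proof.
apply: symHar_blocks_total_op.
- exact: parity_contr_chain.
- move=> w p ph; have /allP/(_ p ph)/eqP -> := csize_contr_chain pol w.
  by rewrite addSn addnS.
- by move=> u G; apply: (multilin_contr (polL (M := lam_module DM u))).
- by move=> u G _; apply: (shuffle_free_contr pol G).
- by move=> u G L w; apply: (letters_der_contr DM (polL (M := lam_module DM u))
    (polD (M := lam_module DM u))).
Qed.

Lemma diff_contr n f v : symHar_blocks n f ->
  diff (total_contr f) v + total_contr (diff f) v =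
  \sum_(t < s) (contr_laplacian pol (blk f v t) (v t) : Q).
Proof.
move=> [_ L _ H _].
have Ed g : diff g = totop (@bar_chain A) g by apply/funext/diff_total_op.
rewrite !Ed /total_contr (total_op_anticomm DM f v parity_bar_chain parity_contr_chain).
apply: eq_bigr => t _; rewrite !block_op_comp.
exact: (homotopy (polM (M := lam_module DM t)) (v t) (L v t) (H v t)).
Qed.
End Homotopy.
End Total.

(** * The homotopy operator on monomial words *)

Section EulerOperator.
Context (F : fieldType) (A : comAlgType F) (M : lmodType A).
Context (pol : A -> seq (A * A)).
Implicit Types (f : seq A -> M) (a b : A).

Lemma scale_algl (k : F) a (v : M) : (k *: a) *: v = k%:A *: (a *: v).
Proof. by rewrite -[k *: a]mulr_algl scalerA. Qed.

Definition euler_form f w a b := f (a * b :: w) - a *: f (b :: w).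

Lemma bilinear_euler_form f w : multilin f -> bilinear (euler_form f w).
Proof.
move=> L; rewrite /euler_form; split=> [k a b y|x k a b].
  rewrite mulrDl -scalerAl (multilin_head L) scalerDl [(k *: a) *: _]scale_algl.
  by rewrite opprD addrACA -scalerBr.
rewrite mulrDr -scalerAr !(multilin_head L) scalerDr [x *: (k%:A *: _)]scalerA [x * k%:A]mulrC -scalerA.
by rewrite opprD addrACA -scalerBr.
Qed.

Lemma euler_head f a w :
  \sum_(p <- euler pol a) p.1 *: f (p.2 :: w) = tensor_sum (euler_form f w) (pol a).
Proof.
rewrite /euler big_flatten big_map; apply: eq_bigr => xy _.
by rewrite big_cons big_seq1 scale1r scaleNr.
Qed.

Lemma letters_euler_cons f a w : letters (euler pol) f (a :: w) =
  tensor_sum (euler_form f w) (pol a) + letters (euler pol) (fun w => f (a :: w)) w.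
Proof. by rewrite letters_cons euler_head. Qed.

Lemma letters_euler2 f a b : letters (euler pol) f [:: a; b] =
  tensor_sum (euler_form f [:: b]) (pol a) + tensor_sum (euler_form (fun w => f (a :: w)) [::]) (pol b).
Proof. by rewrite !letters_euler_cons letters_nil addr0. Qed.

Lemma bilinear_last f : multilin f -> bilinear (fun a b : A => b *: f [:: a]).
Proof.
move=> L; split=> [k a b y|x k a b].
  by rewrite (multilin_head L) scalerDr !scalerA mulrC.
by rewrite scalerDl [(k *: a) *: _]scale_algl.
Qed.
End EulerOperator.

Section MonomialWords.
Context (F : fieldType) (N : nat).
Local Notation A := (diffpoly F N).
Local Notation mono := (@dpmono F N).
Local Notation mdeg := monalg.mdeg.
Local Notation pol := (@polarization F N).
Implicit Types (m : diffmonom N) (x : diffvar N) (ms : seq (diffmonom N)).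

Definition tdeg ms : nat := \sum_(m <- ms) mdeg m.

(** The eigenvalue of [contr_laplacian] on a word of monomials. A variable alone has
    weight 0, because the projection onto vector fields keeps it, and the two short
    constant words have weight 1, because of the term added to the contraction. *)
Definition weight ms : nat :=
  (if (size ms == 1) && (tdeg ms == 1) then 0
   else if (0 < size ms <= 2) && (tdeg ms == 0) then 1
   else tdeg ms)%N.

Lemma tdeg_cons m ms : tdeg (m :: ms) = (mdeg m + tdeg ms)%N.
Proof. exact: big_cons. Qed.

Lemma weight_le ms : (weight ms <= (tdeg ms).+1)%N.
Proof. by rewrite /weight; case: ifP => // _; case: ifP. Qed.

Lemma mdeg0_mono m : mdeg m = 0%N -> mono m = 1.
Proof. by move/monalg.mdeg_eq0I ->; apply: dpmono1. Qed.

Lemma mdeg_divx m x : m x != 0%N -> mdeg m = (mdeg (mdivx m x)).+1.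
Proof.
by move=> mx; have := monalg.mdegM (ucm x) (mdivx m x); rewrite mdivxK // monalg.mdegU.
Qed.

Lemma mdeg1_mono m : mdeg m = 1%N -> exists x, mono m = monoX F x.
Proof.
move=> m1; have [|x mx] := mdeg_neq0 (m := m); first by rewrite m1.
exists x; rewrite -(mdivxK mx) dpmonoM (@mdeg0_mono (mdivx m x)) ?mulr1 //.
by have := mdeg_divx mx; rewrite m1 => -[].
Qed.

Context (M : lmodType A).
Implicit Types (f : seq A -> M).

(** Euler's formula: sum_x x dm/dx is m times its degree, while the terms
    x f(.., dm/dx, ..) involve words of lower degree. *)
Lemma letters_euler_mono f ms : multilin f ->
  (forall ms', size ms' = size ms -> (tdeg ms').+1 = tdeg ms -> f (map mono ms') = 0) ->
  letters (euler pol) f (map mono ms) = (tdeg ms)%:R *: f (map mono ms).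
Proof.
elim: ms f => [|m ms IH] f L lower; first by rewrite letters_nil /tdeg big_nil scale0r.
rewrite letters_cons IH; last 2 first.
- exact: multilin_cons.
- by move=> ms' sz dg; apply: (lower (m :: ms')); rewrite /= ?sz // !tdeg_cons -dg addnS.
rewrite tdeg_cons natrD scalerDl; apply: f_equal2 => //.
apply: etrans (euler_head _ _ _ _) _.
apply: etrans (tensor_sum_pol_mono _ (bilinear_euler_form _ L)) _.
rewrite monalg.mdegE natr_sum scaler_suml /tensor_sum_mono.
rewrite big_seq [RHS]big_seq; apply: eq_bigr => x; rewrite -cmE_neq0 => mx.
congr (_ *: _); rewrite /euler_form.
rewrite -dpmonoM mdivxK // (lower (mdivx m x :: ms)) ?scaler0 ?subr0 //.
by rewrite !tdeg_cons (mdeg_divx mx).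
Qed.

Lemma tdeg1 m : tdeg [:: m] = mdeg m.
Proof. by rewrite /tdeg big_seq1. Qed.

Lemma tdeg2 m1 m2 : tdeg [:: m1; m2] = (mdeg m1 + mdeg m2)%N.
Proof. by rewrite tdeg_cons tdeg1. Qed.

Lemma mdeg_ucm x : mdeg (ucm x : diffmonom N) = 1%N.
Proof. exact: monalg.mdegU. Qed.

Lemma mdeg_one : mdeg (mone : diffmonom N) = 0%N.
Proof. exact: monalg.mdeg1. Qed.

(** The form in which the triangularity of [contr_laplacian] is used: f vanishes on words
    of the same length and lower weight. *)
Definition lower_zero f ms := forall ms',
  size ms' = size ms -> (weight ms' < weight ms)%N -> f (map mono ms') = 0.

Lemma weight1 m : weight [:: m] = (if mdeg m == 1 then 0 else if mdeg m == 0 then 1 else mdeg m)%N.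
Proof. by rewrite /weight tdeg1. Qed.

Lemma weight2 m1 m2 : weight [:: m1; m2] =
  (if mdeg m1 + mdeg m2 == 0 then 1 else mdeg m1 + mdeg m2)%N.
Proof. by rewrite /weight tdeg2. Qed.

Lemma laplacian_mono1 f m : multilin f -> lower_zero f [:: m] ->
  contr_laplacian pol f [:: mono m] = (weight [:: m])%:R *: f [:: mono m].
Proof.
move=> L low; rewrite /contr_laplacian addr0.
have f1 : (1 < weight [:: m])%N -> f [:: 1] = 0.
  move=> lt1; have := low [:: mone]; rewrite /= dpmono1; apply=> //.
  by rewrite weight1 mdeg_one.
case n1: (mdeg m == 1)%N.
  have [x ->] := mdeg1_mono (eqP n1).
  rewrite weight1 n1 scale0r letters_euler_cons letters_nil addr0.
  rewrite tensor_sum_pol_var; last exact: bilinear_euler_form.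
  rewrite tensor_sum_pol_var; last exact: bilinear_last.
  by rewrite /euler_form mulr1 scale1r addrA subrK subrr.
have E : letters (euler pol) f [:: mono m] = (mdeg m)%:R *: f [:: mono m].
  rewrite -tdeg1; apply: (@letters_euler_mono f [:: m]) => // ms' sz dg.
  apply: low => //; case: ms' sz dg => [|m' []] // _; rewrite !tdeg1 !weight1 n1 => dg.
  by move: n1; rewrite -dg; case: (mdeg m') => [|[|k]].
rewrite E weight1 n1; case n0: (mdeg m == 0)%N.
  rewrite (mdeg0_mono (eqP n0)) (eqP n0) scale0r add0r !scale1r.
  by rewrite tensor_sum_pol1 ?subr0 //; apply: bilinear_last.
rewrite f1 ?weight1 ?n1 ?n0; last by case: (mdeg m) n0 n1 => [|[]].
rewrite scaler0 sub0r tensor_sum_pol_mono; last exact: bilinear_last.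
rewrite /tensor_sum_mono big1 ?oppr0 ?addr0 // => x _.
rewrite (_ : f [:: monoX F x] = 0) ?scaler0 //.
apply: (low [:: ucm x]) => //; rewrite !weight1 n1 n0 mdeg_ucm /=.
by rewrite lt0n n0.
Qed.

Lemma laplacian_mono2 f m1 m2 : multilin f -> lower_zero f [:: m1; m2] ->
  contr_laplacian pol f [:: mono m1; mono m2] = (weight [:: m1; m2])%:R *: f [:: mono m1; mono m2].
Proof.
move=> L low; rewrite /contr_laplacian addr0.
have f11 : (1 < weight [:: m1; m2])%N -> f [:: 1; 1] = 0.
  move=> lt1; have := low [:: mone; mone]; rewrite /= dpmono1; apply=> //.
  by rewrite weight2 mdeg_one.
case n1: (mdeg m1 + mdeg m2 == 1)%N.
  have -> : (weight [:: m1; m2])%:R = 1 :> A by rewrite weight2 (eqP n1).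
  rewrite [RHS]scale1r letters_euler2.
  have [[d1 d2]|[d1 d2]] : mdeg m1 = 1%N /\ mdeg m2 = 0%N \/ mdeg m1 = 0%N /\ mdeg m2 = 1%N.
  - by case: (mdeg m1) (mdeg m2) n1 => [|[|?]] [|[|?]] // _; [right|left].
  - have [x ->] := mdeg1_mono d1; rewrite (mdeg0_mono d2).
    rewrite tensor_sum_pol_var; last exact: bilinear_euler_form.
    rewrite tensor_sum_pol1; last by apply: bilinear_euler_form; apply: multilin_cons.
    by rewrite /euler_form !mulr1 addr0 subrK.
  have [x ->] := mdeg1_mono d2; rewrite (mdeg0_mono d1).
  rewrite tensor_sum_pol1; last exact: bilinear_euler_form.
  rewrite tensor_sum_pol_var; last by apply: bilinear_euler_form; apply: multilin_cons.
  by rewrite /euler_form mulr1 mul1r add0r subrK.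
have E : letters (euler pol) f [:: mono m1; mono m2] =
     (mdeg m1 + mdeg m2)%:R *: f [:: mono m1; mono m2].
  rewrite -tdeg2; apply: (@letters_euler_mono f [:: m1; m2]) => // ms' sz dg.
  apply: low => //; case: ms' sz dg => [|m1' [|m2' []]] // _; rewrite !tdeg2 !weight2 => dg.
  by move: n1; rewrite -dg; case: (mdeg m1' + mdeg m2')%N => [|k].
rewrite E weight2; case n0: (mdeg m1 + mdeg m2 == 0)%N.
  move: (n0); rewrite addn_eq0 => /andP[/eqP d1 /eqP d2].
  by rewrite (mdeg0_mono d1) (mdeg0_mono d2) d1 d2 scale0r add0r mulr1.
rewrite f11 ?scaler0 ?addr0 // weight2 n0.
by case: (mdeg m1 + mdeg m2)%N n0 n1 => [|[]].
Qed.

Lemma laplacian_mono f ms : multilin f -> lower_zero f ms ->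
  contr_laplacian pol f (map mono ms) = (weight ms)%:R *: f (map mono ms).
Proof.
case: ms => [|m1 [|m2 [|m3 ms]]] L low.
- by rewrite /contr_laplacian letters_nil !addr0 /weight /tdeg /= big_nil scale0r.
- exact: laplacian_mono1.
- exact: laplacian_mono2.
have wE ms' : size ms' = size [:: m1, m2, m3 & ms] -> weight ms' = tdeg ms'.
  by case: ms' => [|? [|? [|? ?]]].
rewrite /contr_laplacian /= !addr0 wE //;
apply: (@letters_euler_mono f [:: m1, m2, m3 & ms]) => // ms' sz dg.
by apply: low => //; rewrite !wE // dg.
Qed.
End MonomialWords.

(** * Vanishing in weight zero *)

Section ConstantWords.
Context (F : fieldType) (A : comAlgType F) (M : lmodType A).
Hypothesis charF0 : [pchar F] =i pred0.
Implicit Types (f : seq A -> M) (a : A).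

Lemma natF_neq0 n : n.+1%:R != 0 :> F.
Proof. by have /pcharf0P -> := charF0. Qed.

Lemma nat_scale_inj n (v : M) : n.+1%:R *: v = 0 -> v = 0.
Proof.
move/(congr1 ( *:%R ((n.+1%:R : F)^-1)%:A)); rewrite scaler0 scalerA -scalar_natA.
by rewrite mulVf ?natF_neq0 // !scale1r.
Qed.

Lemma shsum_nseq1 f a q :
  shsum f [:: a] (nseq q a) = (~~ odd q)%:R *: f (nseq q.+1 a).
Proof.
elim: q f => [|q IH] f; first by rewrite shsums0 scale1r.
rewrite /= shsum_cons shsum0s IH /alt_sign /=.
by case: (odd q); rewrite /= ?mulr0n ?mulr1n; lmod_with A M.
Qed.

Lemma shsum_nseq2 f a q :
  shsum f [:: a; a] (nseq q a) = (q./2.+1)%:R *: f (nseq q.+2 a).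
Proof.
elim: q f => [|q IH] f; first by rewrite shsums0 scale1r.
rewrite /= shsum_cons (shsum_nseq1 _ a q.+1) IH /alt_sign /= scale1r -scalerDl -natrD.
congr (_%:R *: _); rewrite uphalf_half negbK.
by case: (odd q); rewrite ?addnS ?addn0 ?add1n.
Qed.

(** The signed shuffle of the first letter of a constant word with the rest is a nonzero
    multiple of the word when its length is odd; for even length, the first two letters
    are shuffled with the rest. *)
Lemma shuffle_free_ones f a k : shuffle_free f -> (2 < k)%N -> f (nseq k a) = 0.
Proof.
move=> H; case: k => [|[|[|k]]] // _; case ok: (odd k).
  have := H a [:: a] a (nseq k a); rewrite (shsum_nseq2 _ a k.+1).
  exact: nat_scale_inj.
by have := H a [::] a (nseq k.+1 a); rewrite (shsum_nseq1 _ a k.+2) /= negbK ok scale1r.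
Qed.
End ConstantWords.

Section Nilpotency.
Context (F : fieldType) (charF0 : [pchar F] =i pred0) (N s : nat).
Local Notation A := (diffpoly F N).
Local Notation D := (@dpder F N).
Local Notation DM := (@dpderM F N).
Local Notation mono := (@dpmono F N).
Local Notation pol := (@polarization F N).
Local Notation Q := (lamquot D s).
Local Notation blk := (@in_block F A D DM s).
Local Notation good := (@symHar_blocks F A D DM s).
Local Notation mshape := {ffun 'I_s -> seq (diffmonom N)}.
Implicit Types (V : mshape) (f : cochain D s) (v : word A s) (t : 'I_s).

Definition mword V : word A s := [ffun t => map mono (V t)].
Definition tweight V : nat := \sum_(t < s) weight (V t).

Lemma mword_set V t ms :
  set_block (mword V) t (map mono ms) = mword [ffun u => if u == t then ms else V u].
Proof. by apply/ffunP => u; rewrite !ffunE; case: eqP. Qed.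

Lemma lam_module_nat t n (q : lam_module DM t) : n%:R *: q = n%:R *: (q : Q).
Proof. by rewrite !scaler_nat. Qed.

Lemma total_laplacian f V : (forall v u, multilin (blk f v u)) ->
  (forall V', (tweight V' < tweight V)%N -> f (mword V') = 0) ->
  \sum_(t < s) (contr_laplacian pol (blk f (mword V) t) (mword V t) : Q) =
  (tweight V)%:R *: f (mword V).
Proof.
move=> L low; rewrite /tweight natr_sum scaler_suml; apply: eq_bigr => t _.
rewrite ffunE laplacian_mono //; last first.
  move=> ms _ lt; rewrite /in_block mword_set; apply: low.
  rewrite /tweight (bigD1 t) //= [X in (_ < X)%N](bigD1 t) //= ffunE eqxx.
  rewrite -addSn leq_add // leq_eqVlt; apply/orP; left; apply/eqP.
  by apply: eq_bigr => u ut; rewrite ffunE (negbTE ut).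
rewrite lam_module_nat /in_block mword_set; congr (_ *: f (mword _)).
by apply/ffunP => u; rewrite ffunE; case: eqP => [->|].
Qed.

Lemma tdeg0_ones (ms : seq (diffmonom N)) :
  tdeg ms = 0%N -> map mono ms = nseq (size ms) 1.
Proof.
elim: ms => // m ms IH; rewrite tdeg_cons => /eqP.
by rewrite addn_eq0 => /andP[/eqP m0 /eqP/IH /= ->]; rewrite mdeg0_mono.
Qed.

Lemma weight0_ones ms : (1 < size ms)%N -> weight ms = 0%N ->
  (2 < size ms)%N /\ map mono ms = nseq (size ms) 1.
Proof.
case: ms => [|m1 [|m2 ms]] // _; rewrite /weight /=.
case: ifP => // sz0 deg0; split.
  by move: sz0; rewrite deg0 andbT; case: ms {deg0}.
exact: tdeg0_ones deg0.
Qed.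

(** Since there are more letters than blocks, some block has at least two letters. Having
    weight 0, it is constant and has at least three letters. *)
Lemma weight0_vanish n f V : (s < n)%N -> good n f -> tweight V = 0%N -> f (mword V) = 0.
Proof.
move=> sn [Hn _ _ H _] V0; have [wn|] := eqVneq (wlen (mword V)) n; last exact: Hn.
have [/existsP[t t2]|] := boolP [exists t : 'I_s, (1 < size (V t))%N]; last first.
  rewrite negb_exists => /forallP small; move: sn; rewrite -wn ltnNge; case/negP.
  rewrite -[X in (_ <= X)%N]card_ord -sum1_card; apply: leq_sum => t _.
  by rewrite ffunE size_map leqNgt small.
have wt : weight (V t) = 0%N.
  by move/eqP: V0; rewrite sum_nat_eq0 => /forallP/(_ t)/eqP.
have [t3 ones] := weight0_ones t2 wt.
rewrite -(set_block_id (mword V) t) ffunE ones.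
exact: (shuffle_free_ones charF0 1 (H (mword V) t) t3).
Qed.

(** The weight of each block exceeds its degree by at most 1. *)
Lemma tweight_bound V d : (forall t m, m \in V t -> (monalg.mdeg m <= d)%N) ->
  (tweight V <= d * wlen (mword V) + s)%N.
Proof.
move=> Vd; rewrite /wlen big_distrr /= -[X in (_ + X)%N]card_ord -sum1_card -big_split.
apply: leq_sum => t _; rewrite /= ffunE size_map addn1; apply: leq_trans (weight_le _) _.
rewrite ltnS /tdeg; elim: (V t) (Vd t) => [|m ms IH] H; first by rewrite big_nil.
rewrite big_cons mulnS leq_add ?H ?inE ?eqxx // IH // => m' m's.
by rewrite H // inE m's orbT.
Qed.

Definition letter_bound d (w : seq A) :=
  forall a m, a \in w -> m \in monalg.msupp a -> (monalg.mdeg m <= d)%N.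

Lemma multilin_mono_zero (M : lmodType A) (G : seq A -> M) d w : multilin G -> letter_bound d w ->
  (forall ms, size ms = size w -> (forall m, m \in ms -> (monalg.mdeg m <= d)%N) ->
     G (map mono ms) = 0) -> G w = 0.
Proof.
elim: w G => [|a w IH] G L deg low; first exact: (low [::]).
have step m : m \in monalg.msupp a -> G (mono m :: w) = 0.
  move=> ma; apply: (IH (fun w => G (mono m :: w))); first exact: multilin_cons.
    by move=> b m' bw; apply: deg; rewrite inE bw orbT.
  move=> ms sz msd; apply: (low (m :: ms)); first by rewrite /= sz.
  move=> m'; rewrite inE => /orP[/eqP ->|]; last exact: msd.
  by apply: (deg a); rewrite ?inE ?eqxx.
have span r : {subset r <= enum_fset (monalg.msupp a)} ->
    G (\sum_(m <- r) monalg.mcoeff m a *: mono m :: w) = 0.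
  elim: r => [|m r IHr] sub; first by rewrite big_nil; apply: (multilin0 [::]).
  rewrite big_cons (multilin_head L) IHr => [|m' m'r]; last by apply: sub; rewrite inE m'r orbT.
  by rewrite step ?scaler0 ?addr0 //; apply: sub; rewrite inE eqxx.
by rewrite (diffpolyE a); apply: span.
Qed.

(** The blocks are expanded into monomials one after the other; r lists those that remain
    to be expanded. *)
Lemma multilin_mword_zero f v d : (forall v u, multilin (blk f v u)) ->
  (forall t, letter_bound d (v t)) ->
  (forall V, (forall t, size (V t) = size (v t)) ->
     (forall t m, m \in V t -> (monalg.mdeg m <= d)%N) -> f (mword V) = 0) -> f v = 0.
Proof.
move=> L vd low.
suff H (r : seq 'I_s) : forall v', (forall t, size (v' t) = size (v t)) ->
    (forall t, t \in r -> letter_bound d (v' t)) ->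
    (forall t, t \notin r -> exists ms, v' t = map mono ms /\
       forall m, m \in ms -> (monalg.mdeg m <= d)%N) -> f v' = 0.
  by apply: (H (enum 'I_s)) => // t; rewrite ?mem_enum.
elim: r => [|t r IH] v' sz vr vmono.
  have /fin_all_exists[V HV] : forall t, exists ms, v' t = map mono ms /\
       forall m, m \in ms -> (monalg.mdeg m <= d)%N.
    by move=> t; apply: vmono.
  have -> : v' = mword [ffun t => V t].
    by apply/ffunP => t; rewrite !ffunE; case: (HV t).
  apply: low => t; rewrite ffunE; last by case: (HV t).
  by rewrite -sz; have [-> _] := HV t; rewrite size_map.
rewrite -(set_block_id v' t);
apply: (@multilin_mono_zero (lam_module DM t) (blk f v' t) d); first exact: L.
  by apply: vr; rewrite inE eqxx.
move=> ms szm msd; apply: IH => u.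
- by case: (eqVneq u t) => [->|ut]; rewrite ?set_blockE ?size_map ?set_block_ne // szm.
- move=> ur; case: (eqVneq u t) => [->|ut]; last first.
    by rewrite set_block_ne //; apply: vr; rewrite inE ur orbT.
  rewrite set_blockE => a m /mapP[m' m'ms ->]; rewrite dpmono.unlock.
  by move/(fsubsetP msuppU_le) => /fset1P ->; apply: msd.
case: (eqVneq u t) => [->|ut] ur; first by exists ms; rewrite set_blockE.
by rewrite set_block_ne //; apply: vmono; rewrite inE negb_or ut.
Qed.

End Nilpotency.

(** * The primitive of a cocycle *)

Lemma leq_max_mem (I : eqType) (r : seq I) (h : I -> nat) i :
  i \in r -> (h i <= \max_(j <- r) h j)%N.
Proof. by move=> ir; apply: (@leq_bigmax_seq _ r xpredT h). Qed.

Section LinearClosure.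
Context (F : fieldType) (A : comAlgType F) (D : {linear A -> A}).
Context (DM : leibniz D) (s : nat).
Implicit Types (t u : 'I_s) (v : word A s) (f g : cochain D s) (Phi : seq A -> chain A).
Local Notation Q := (lamquot D s).
Local Notation blk := (in_block DM).
Local Notation totop := (total_op DM).
Local Notation good := (@symHar_blocks F A D DM s).

Lemma total_op_linear Phi f g (c : F) v :
  totop Phi (fun v => f v + c *: g v) v = totop Phi f v + c *: totop Phi g v.
Proof.
rewrite scaler_sumr -big_split; apply: eq_bigr => t _ /=.
rewrite scalerA mulrC -scalerA -scalerDr; congr (_ *: _).
rewrite !block_opE scaler_sumr -big_split; apply: eq_bigr => p _ /=.
by rewrite (actDr DM) (act_F DM).
Qed.

Lemma total_op_eq Phi f g v :
  (forall t p, p \in Phi (v t) -> f (set_block v t p.2) = g (set_block v t p.2)) ->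
  totop Phi f v = totop Phi g v.
Proof.
move=> fg; apply: eq_bigr => t _; rewrite !block_opE; congr (_ *: _).
by apply: eq_big_seq => p pP; rewrite fg.
Qed.

Lemma total_op0 Phi v : totop Phi (fun=> 0) v = 0.
Proof.
rewrite /total_op big1 // => t _; rewrite /block_op.
by have -> : ev (blk (fun=> 0) v t) (Phi (v t)) = 0 := ev0 _ _; rewrite scaler0.
Qed.

Lemma diff_linear f g (c : F) v :
  diff (fun v => f v + c *: g v) v = diff f v + c *: diff g v.
Proof. by rewrite !(diff_total_op DM) total_op_linear. Qed.

Lemma diff0 v : diff (fun=> 0 : Q) v = 0 :> Q.
Proof. by rewrite (diff_total_op DM) total_op0. Qed.

Lemma symHar_blocks0 n : good n (fun=> 0).
Proof.
split=> // [v u|v u w|v u a x b y|sigma v].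
- exact: multilin_zero.
- rewrite (mulX0 DM) oppr0; exact: ev0.
- exact: shsum0.
by rewrite sym_actE -[X in msymq _ X](scale0r (0 : Q)) msymqF scale0r scaler0.
Qed.

Lemma symHar_blocks_linear n f g (c : F) : good n f -> good n g -> good n (fun v => f v + c *: g v).
Proof.
move=> [Hf Lf Sf Ff Mf] [Hg Lg Sg Fg Mg]; split.
- by move=> v vn; rewrite Hf // Hg // scaler0 addr0.
- move=> v u; exact: multilin_add (Lf v u) (multilin_sizeZ (fun=> c) (Lg v u)).
- move=> v u w; have -> : letters (der_letter D) (blk (fun v => f v + c *: g v) v u) w =
      letters (der_letter D) (blk f v u) w + c%:A *: letters (der_letter D) (blk g v u) w.
    rewrite -[X in _ + X]evZ -lettersD; apply: letters_ext => w'.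
    by rewrite lam_module_scalar.
  by rewrite Sf Sg lam_module_scalar (mulXD DM) (mulX_F DM) opprD scalerN.
- move=> v u a x b y.
  rewrite (@shsum_ext _ _ _ (fun w => blk f v u w + c%:A *: blk g v u w)); last first.
    by move=> w; rewrite lam_module_scalar.
  by rewrite shsumD shsumZ Ff Fg scaler0 addr0.
move=> sigma v; rewrite sym_actE msymqD msymqF scalerDr scalerA mulrC -scalerA.
by rewrite -!sym_actE Mf Mg.
Qed.

(** Every condition on cochains relates finitely many values, hence passes to a limit in
    which each value is eventually constant. *)
Lemma symHar_blocks_limit n (f : cochain D s) (fB : nat -> cochain D s) (K : word A s -> nat) :
  (forall B, good n (fB B)) -> (forall v B, (K v <= B)%N -> f v = fB B v) -> good n f.
Proof.
move=> gB lim.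
have ev_lim v u c : exists K0, forall B, (K0 <= B)%N -> ev (blk f v u) c = ev (blk (fB B) v u) c.
  exists (\max_(p <- c) K (set_block v u p.2))%N => B KB.
  apply: eq_big_seq => p pc; congr (_ *: _); apply: lim; apply: leq_trans KB.
  exact: (leq_max_mem (fun p => K (set_block v u p.2)) pc).
split.
- by move=> v vn; rewrite (lim v _ (leqnn _)); case: (gB (K v)) => /(_ v vn).
- move=> v u p q k a b.
  pose B := maxn (K (set_block v u (p ++ (k *: a + b) :: q)))
    (maxn (K (set_block v u (p ++ a :: q))) (K (set_block v u (p ++ b :: q)))).
  rewrite /in_block !(lim _ B) ?leq_max ?leqnn ?orbT //.
  by case: (gB B) => _ L _ _ _; apply: (L v u p q k a b).
- move=> v u w; have [K0 HK] := ev_lim v u (letters_chain (der_letter D) w).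
  pose B := maxn K0 (K (set_block v u w)).
  rewrite /letters (HK B) ?leq_maxl // {2}/in_block (lim _ B) ?leq_maxr //.
  by case: (gB B) => _ _ S _ _; apply: (S v u w).
- move=> v u a x b y; have [K0 HK] := ev_lim v u (shuffle (a :: x) (b :: y)).
  by rewrite /shsum (HK K0) //; case: (gB K0) => _ _ _ H _; apply: (H v u a x b y).
move=> sigma v; pose B := maxn (K v) (K (perm_word sigma v)).
rewrite sym_actE (lim (perm_word sigma v) B) ?leq_maxr // -sym_actE.
rewrite (lim v B) ?leq_maxl //.
by case: (gB B) => _ _ _ _; apply.
Qed.
End LinearClosure.

Section Main.
Context (F : fieldType) (charF0 : [pchar F] =i pred0) (N s : nat).
Local Notation A := (diffpoly F N).
Local Notation D := (@dpder F N).
Local Notation DM := (@dpderM F N).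
Local Notation pol := (@polarization F N).
Local Notation Q := (lamquot D s).
Local Notation blk := (@in_block F A D DM s).
Local Notation hom := (@total_contr F A D DM s pol).
Local Notation good := (@symHar_blocks F A D DM s).
Implicit Types (f g : cochain D s) (v : word A s) (t : 'I_s).

(** The coefficient is the inverse of the weight that this step removes: the previous
    residue vanishes below weight k, and d h multiplies it by k in weight k. *)
Fixpoint residue f k : cochain D s :=
  if k is k'.+1 then
    fun v => residue f k' v + - (k'.+1%:R)^-1 *: diff (hom (residue f k')) v
  else f.

Section Residue.
Context (n : nat) (f : cochain D s).
Hypotheses (sn : (s < n.+1)%N) (gf : good n.+1 f) (df : forall v, diff f v = 0).
Local Notation res := (residue f).

Lemma symHar_blocks_pol_contr g : good n.+1 g -> good n (hom g).
Proof. by apply: symHar_blocks_contr; [apply: pol_linear|apply: pol_der]. Qed.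

Lemma diff_diff0 g v : diff (diff g) v = 0.
Proof. by apply: (diff_diff DM); apply: (natF_neq0 charF0 1). Qed.

Lemma residue_symHar k : good n.+1 (res k).
Proof.
elim: k => [|k IH]; first exact: gf.
exact: (symHar_blocks_linear (- (k.+1%:R)^-1) IH (symHar_blocks_diff (symHar_blocks_pol_contr IH))).
Qed.

Lemma residue_cocycle k v : diff (res k) v = 0.
Proof.
elim: k v => [|k IH] v; first exact: df.
rewrite (diff_linear DM) IH add0r.
by rewrite diff_diff0 scaler0.
Qed.

Lemma diff_contr_cocycle g v : good n.+1 g -> (forall v, diff g v = 0) ->
  diff (hom g) v = \sum_(t < s) (contr_laplacian pol (blk g v t) (v t) : Q).
Proof.
move=> gg dg; rewrite -(diff_contr (@pol_mul F N) v gg).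
have -> : diff g = fun=> 0 by apply/funext.
by rewrite [X in _ + X]total_op0 addr0.
Qed.

Lemma residue_mword k V : (tweight V <= k)%N -> res k (mword F V) = 0.
Proof.
elim: k V => [|k IH] V Vk.
  by apply: (weight0_vanish charF0 sn gf); apply/eqP; rewrite -leqn0.
have [_ L _ _ _] := residue_symHar k.
have low V' : (tweight V' < tweight V)%N -> res k (mword F V') = 0.
  by move=> lt; apply: IH; rewrite -ltnS (leq_trans lt).
have E := etrans (diff_contr_cocycle (mword F V) (residue_symHar k) (@residue_cocycle k))
  (total_laplacian L low).
apply: etrans (f_equal (fun q => res k (mword F V) + - (k.+1%:R)^-1 *: q) E) _.
move: Vk; rewrite leq_eqVlt => /orP[/eqP->|]; last by rewrite ltnS => /IH ->; rewrite !scaler0 addr0.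
by rewrite scalerA mulNr mulVf ?scaleN1r ?subrr // (natF_neq0 charF0).
Qed.

Definition degree_bound v : nat :=
  \max_(t < s) \max_(a <- v t) \max_(m <- monalg.msupp a) monalg.mdeg m.

(** An upper bound for the weight of all monomial words in the expansion of v. *)
Definition vanish_bound v : nat := degree_bound v * wlen v + s.

Lemma residue_vanish k v : (vanish_bound v <= k)%N -> res k v = 0.
Proof.
move=> vk; have [_ L _ _ _] := residue_symHar k.
apply: (multilin_mword_zero (d := degree_bound v) L) => [t a m av ma|V sz Vd].
  apply: leq_trans (leq_bigmax t).
  apply: leq_trans (leq_max_mem (fun a => \max_(m <- monalg.msupp a) monalg.mdeg m)%N av).
  exact: (leq_max_mem (fun m => monalg.mdeg m) ma).
apply: residue_mword; apply: leq_trans (@tweight_bound F N s V _ Vd) _.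
apply: leq_trans vk; rewrite /vanish_bound leq_add2r leq_mul2l; apply/orP; right.
by apply: leq_sum => t _; rewrite ffunE size_map sz.
Qed.

Definition contr_bound v : nat :=
  \max_(t < s) \max_(p <- contr_chain pol (v t)) vanish_bound (set_block v t p.2).

Lemma contr_residue_vanish k v : (contr_bound v <= k)%N -> hom (res k) v = 0.
Proof.
move=> vk; rewrite -(total_op0 DM (contr_chain pol) v); apply: total_op_eq => t p pP.
apply: residue_vanish; apply: leq_trans vk; apply: leq_trans (leq_bigmax t).
exact: (leq_max_mem (fun p => vanish_bound (set_block v t p.2)) pP).
Qed.

(** The differential of this sum telescopes to f minus the residue of index B. *)
Fixpoint partial_primitive B : cochain D s :=
  if B is k.+1 then fun v => partial_primitive k v + (k.+1%:R)^-1 *: hom (res k) v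
  else fun=> 0.

Lemma partial_primitive_symHar B : good n (partial_primitive B).
Proof.
elim: B => [|k IH]; first exact: symHar_blocks0.
exact: (symHar_blocks_linear (k.+1%:R^-1) IH (symHar_blocks_pol_contr (residue_symHar k))).
Qed.

Lemma diff_partial_primitive B v : diff (partial_primitive B) v = f v - res B v.
Proof.
elim: B v => [|k IH] v; first by rewrite (diff0 DM) subrr.
by rewrite (diff_linear DM) IH /= opprD scaleNr opprK addrA.
Qed.

Definition primitive v : Q := partial_primitive (contr_bound v) v.

Lemma primitiveE v B : (contr_bound v <= B)%N -> primitive v = partial_primitive B v.
Proof.
move=> le; rewrite /primitive -(subnKC le); elim: (B - _)%N => [|k IH]; first by rewrite addn0.
by rewrite addnS /= -IH contr_residue_vanish ?leq_addr // scaler0 addr0.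
Qed.

Lemma primitive_symHar : good n primitive.
Proof. exact: symHar_blocks_limit partial_primitive_symHar primitiveE. Qed.

Lemma diff_primitive : diff primitive =1 f.
Proof.
(* B is so large that the primitive is the partial sum of index B on all the words
   at which it enters in the value of the differential at v. *)
move=> v; pose K := (\max_(t < s) \max_(p <- bar_chain (v t)) contr_bound (set_block v t p.2))%N.
pose B := maxn K (vanish_bound v).
rewrite -[RHS]subr0 -(@residue_vanish B v) ?leq_maxr // -diff_partial_primitive.
rewrite !(diff_total_op DM); apply: total_op_eq => t p pP; apply: primitiveE.
apply: leq_trans (leq_maxl _ _); apply: leq_trans (leq_bigmax t).
exact: (leq_max_mem (fun p => contr_bound (set_block v t p.2)) pP).
Qed.
End Residue.
End Main.

Theorem theorem1p3 (F : fieldType) (charF0 : [pchar F] =i pred0)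
    (N s n : nat) (hs : (1 <= s)%N) (hn : (s < n)%N) :
  symHar_cohomology_eq0 (@dpder F N) s n.
Proof.
case: n hn => // n sn f [/(symHar_blocksP (@dpderM F N)) gf df].
exists (primitive f); last exact: (diff_primitive charF0 sn gf df).
exact/(symHar_blocksP (@dpderM F N))/primitive_symHar.
Qed.
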